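(* Let $n$ be a positive integer. Let $p$ be a prime number. Let $M$ be a $2n$-dimensional $p$-adic analytic manifold and let $Q$ be a compact submanifold of $M$. Let $\omega_0$ and $\omega_1$ be two $p$-adic analytic symplectic forms on $M$ which coincide on $Q$. Then there exist open neighborhoods $U_0,U_1$ of $Q$ in $M$ and a $p$-adic analytic diffeomorphism $\psi:U_0\to U_1$ which fixes $Q$ and such that $\psi^*\omega_1=\omega_0$ on $U_0$.
   Context: A function between open subsets of $(\mathbb{Q}_p)^{\ell_1}$ and $(\mathbb{Q}_p)^{\ell_2}$ is $p$-adic analytic if its domain is a union of balls on each of which it is given by a convergent $p$-adic power series. An $\ell$-dimensional $p$-adic analytic manifold is a Hausdorff topological space with an atlas of charts (homeomorphisms from open subsets onto open subsets of $(\mathbb{Q}_p)^\ell$) whose changes of charts are bi-analytic. A ($p$-adic analytic, embedded) submanifold $Q\subset M$ is a subset such that around each of its points there is a chart $\phi:U\to V$ of $M$ for which $\phi(U\cap Q)$ is a slice of $\phi(U)$ (the set of points of $\phi(U)$ whose last coordinates equal given constants). A $p$-adic analytic symplectic form on $M$ is a closed $p$-adic analytic $2$-form $\omega$ that is non-degenerate: for all $m\in M$ and $0\neq u\in\mathrm{T}_mM$ there is $v\in\mathrm{T}_mM$ with $\omega(u,v)\neq0$. ''$\omega_0$ and $\omega_1$ coincide on $Q$'' means $(\omega_0)_m=(\omega_1)_m$ as bilinear forms on $\mathrm{T}_mM$ for all $m\in Q$. ''$\psi$ fixes $Q$'' means $\psi(m)=m$ for all $m\in Q$. A $p$-adic analytic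 diffeomorphism is a bi-analytic bijection. *)

(* Defs.v *)
From HB Require Import structures.
From mathcomp Require Import all_boot all_order all_algebra.
From mathcomp Require Import fraction generic_quotient finmap.
From mathcomp Require Import all_classical.
From mathcomp Require Import topology.
From mathcomp.analysis.showcase Require Import summability.

Set Implicit Arguments.
Unset Strict Implicit.
Unset Printing Implicit Defensive.

Import Order.TTheory GRing.Theory Num.Theory.

Local Open Scope classical_set_scope.
Local Open Scope ring_scope.

(* Z_p is the inverse limit of the rings Z/p^n: an element is the sequence of
   its residues, the n-th one being represented in {0, ..., p^n - 1}. *)
Record padic_int (p : nat) (p_pr : prime p) := PadicInt {
  zres :> nat -> nat;
  zresP : forall n, (zres n.+1 %% p ^ n = zres n)%N }.

Section PadicInt.
Variables (p : nat) (p_pr : prime p).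
Local Notation Zp := (padic_int p_pr).

HB.instance Definition _ := gen_eqMixin Zp.
HB.instance Definition _ := gen_choiceMixin Zp.

Lemma zres_inj (x y : Zp) : x =1 y -> x = y.
Proof.
case: x y => [f Pf] [g Pg] /= /funext fg; subst g.
by congr PadicInt; apply: Prop_irrelevance.
Qed.

Lemma pX_gt0 n : (0 < p ^ n)%N. Proof. by rewrite expn_gt0 prime_gt0. Qed.

Lemma zres_mod (x : Zp) n m : (n <= m)%N -> (x m %% p ^ n = x n)%N.
Proof.
move=> /subnK <-; elim: (m - n)%N => [|k IHk].
  by rewrite add0n -zresP modn_mod.
by rewrite -IHk addSn -[in RHS]zresP modn_dvdm // dvdn_exp2l ?leq_addl.
Qed.

Lemma zres_small (x : Zp) n : (x n %% p ^ n = x n)%N.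
Proof. exact: zres_mod. Qed.

Definition zmk (s : nat -> nat) (sP : forall n, s n.+1 = s n %[mod p ^ n]) : Zp.
Proof.
exists (fun n => s n %% p ^ n)%N => n.
by rewrite modn_dvdm ?sP // dvdn_exp2l.
Defined.

Lemma zmod_succ (x : Zp) n : x n.+1 = x n %[mod p ^ n].
Proof. by rewrite !(zres_mod _ (leqnSn n)) zres_small. Qed.

Lemma zadd_subproof (x y : Zp) n :
  (x n.+1 + y n.+1 = x n + y n %[mod p ^ n])%N.
Proof. by rewrite -modnDm !zmod_succ modnDm. Qed.

Lemma zmul_subproof (x y : Zp) n :
  (x n.+1 * y n.+1 = x n * y n %[mod p ^ n])%N.
Proof. by rewrite -modnMm !zmod_succ modnMm. Qed.

Lemma zres_lt (x : Zp) n : (x n < p ^ n)%N.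
Proof. by rewrite -zres_small ltn_mod pX_gt0. Qed.

Lemma zopp_subproof (x : Zp) n :
  (p ^ n.+1 - x n.+1 = p ^ n - x n %[mod p ^ n])%N.
Proof.
apply/eqP; rewrite -(eqn_modDr (x n.+1)) subnK ?(ltnW (zres_lt _ _)) //.
rewrite -modnDmr zmod_succ modnDmr subnK ?(ltnW (zres_lt _ _)) //.
by rewrite modnn expnS modnMl.
Qed.

Lemma zconst_subproof k n : k = k %[mod p ^ n]. Proof. by []. Qed.

Definition zconst k : Zp := zmk (zconst_subproof k).
Definition zadd (x y : Zp) : Zp := zmk (zadd_subproof x y).
Definition zopp (x : Zp) : Zp := zmk (zopp_subproof x).
Definition zmul (x y : Zp) : Zp := zmk (zmul_subproof x y).

Lemma zaddA : associative zadd.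
Proof. by move=> x y z; apply: zres_inj => n /=; rewrite modnDml modnDmr addnA. Qed.

Lemma zaddC : commutative zadd.
Proof. by move=> x y; apply: zres_inj => n /=; rewrite addnC. Qed.

Lemma zadd0 : left_id (zconst 0) zadd.
Proof. by move=> x; apply: zres_inj => n /=; rewrite mod0n add0n zres_small. Qed.

Lemma zaddN : left_inverse (zconst 0) zopp zadd.
Proof.
move=> x; apply: zres_inj => n /=.
by rewrite modnDml subnK ?(ltnW (zres_lt _ _)) // modnn mod0n.
Qed.

HB.instance Definition _ := GRing.isZmodule.Build Zp zaddA zaddC zadd0 zaddN.

Lemma zmulA : associative zmul.
Proof. by move=> x y z; apply: zres_inj => n /=; rewrite modnMml modnMmr mulnA. Qed.

Lemma zmulC : commutative zmul.
Proof. by move=> x y; apply: zres_inj => n /=; rewrite mulnC. Qed.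

Lemma zmul1 : left_id (zconst 1) zmul.
Proof.
by move=> x; apply: zres_inj => n /=; rewrite modnMml mul1n zres_small.
Qed.

Lemma zmulDl : left_distributive zmul zadd.
Proof.
by move=> x y z; apply: zres_inj => n /=; rewrite modnMml modnDm mulnDl.
Qed.

Lemma zone_neq0 : zconst 1 != 0.
Proof.
apply/eqP => /(congr1 (fun x : Zp => x 1%N)) /=.
by rewrite expn1 mod0n modn_small // prime_gt1.
Qed.

HB.instance Definition _ :=
  GRing.Zmodule_isComNzRing.Build Zp zmulA zmulC zmul1 zmulDl zone_neq0.

Lemma zres0 n : (0 : Zp) n = 0%N. Proof. exact: mod0n. Qed.

Lemma zresD (x y : Zp) n : (x + y) n = ((x n + y n) %% p ^ n)%N.
Proof. by []. Qed.

Lemma zresM (x y : Zp) n : (x * y) n = ((x n * y n) %% p ^ n)%N.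
Proof. by []. Qed.

Lemma zres_eq0 (x : Zp) k n : (k <= n)%N -> (x k == 0)%N = (p ^ k %| x n)%N.
Proof. by move=> kn; rewrite /dvdn zres_mod. Qed.

Lemma zneq0P (x : Zp) : x != 0 -> exists n, x n != 0%N.
Proof.
move=> /eqP x0; apply/not_existsP => xn; apply: x0; apply: zres_inj => n.
by rewrite zres0; apply/eqP; apply: contra_notT (xn n).
Qed.

Definition zunit : {pred Zp} := fun x => `[< exists y, y * x = 1 >].
Definition zinv (x : Zp) : Zp :=
  if pselect (exists y, y * x = 1) is left h then sval (cid h) else x.

Lemma zmulV : {in zunit, left_inverse 1 zinv *%R}.
Proof.
by move=> x /asboolP h; rewrite /zinv; case: pselect => // {}h; case: cid.
Qed.

Lemma zunitP (x y : Zp) : y * x = 1 -> x \in zunit.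
Proof. by move=> yx; apply/asboolP; exists y. Qed.

Lemma zinv_out : {in [predC zunit], zinv =1 id}.
Proof.
by move=> x /negP h; rewrite /zinv; case: pselect => // e; case: h; apply/asboolP.
Qed.

HB.instance Definition _ :=
  GRing.ComNzRing_hasMulInverse.Build Zp zmulV zunitP zinv_out.

(* The p-adic valuation, with junk value 0 at 0. *)
Definition zval (x : Zp) : nat :=
  if pselect (exists n, x n.+1 != 0%N) is left h then ex_minn h else 0%N.

Lemma zvalP (x : Zp) : x != 0 ->
  x (zval x) = 0%N /\ x (zval x).+1 != 0%N.
Proof.
move=> x0; rewrite /zval; case: pselect => [h|[]].
  case: ex_minnP => m xm minm; split=> //; case: m xm minm => [_ _|m _ minm].
    by have := zres_lt x 0; rewrite expn0; case: (zres x 0).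
  by apply/eqP; case: eqP => // /eqP /minm; rewrite ltnn.
have [[|n] xn] := zneq0P x0; last by exists n.
by move: xn; have := zres_lt x 0; rewrite expn0; case: (zres x 0).
Qed.

Lemma zval_le (x : Zp) k : x != 0 -> (k <= zval x)%N = (x k == 0)%N.
Proof.
move=> x0; have [v0 v1] := zvalP x0.
case: leqP => [kv|vk]; first by rewrite (zres_eq0 _ kv) v0 dvdn0.
apply/esym/negP => xk0; case/negP: v1; rewrite (zres_eq0 _ vk).
by rewrite (eqP xk0) dvdn0.
Qed.

Lemma zres_logn (x : Zp) n : x != 0 -> (zval x < n)%N ->
  (0 < x n)%N /\ logn p (x n) = zval x.
Proof.
move=> x0 vn; have [v0 v1] := zvalP x0.
have xn0 : (0 < x n)%N.
  by rewrite lt0n; apply: contra v1 => /eqP xn; rewrite (zres_eq0 _ vn) xn dvdn0.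
split=> //; apply/eqP; rewrite eqn_leq -ltnS ltnNge -!pfactor_dvdn //.
by rewrite -!zres_eq0 ?(ltnW vn) // v0 v1.
Qed.

Lemma zmul_res_eq0 (x y : Zp) k : x != 0 -> y != 0 ->
  (k <= (zval x + zval y).+1)%N ->
  (zres (x * y) k == 0%N) = (k <= zval x + zval y)%N.
Proof.
move=> x0 y0; set N := _.+1 => kN.
have [xp lx] : (0 < x N)%N /\ logn p (x N) = zval x.
  by apply: zres_logn => //; rewrite ltnS leq_addr.
have [yp ly] : (0 < y N)%N /\ logn p (y N) = zval y.
  by apply: zres_logn => //; rewrite ltnS leq_addl.
rewrite (zres_eq0 _ kN) zresM -lx -ly -lognM //.
rewrite -pfactor_dvdn ?muln_gt0 ?xp //; by rewrite /dvdn modn_dvdm // dvdn_exp2l.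
Qed.

Lemma zmul_neq0 (x y : Zp) : x != 0 -> y != 0 -> x * y != 0.
Proof.
move=> x0 y0; apply/eqP => xy0.
by have := zmul_res_eq0 x0 y0 (leqnn _); rewrite xy0 zres0 ltnn.
Qed.

Lemma zmul_eq0 : GRing.integral_domain_axiom Zp.
Proof.
move=> x y xy0; apply: contra_eqT xy0; rewrite negb_or => /andP[].
exact: zmul_neq0.
Qed.

HB.instance Definition _ := GRing.ComUnitRing_isIntegral.Build Zp zmul_eq0.

Lemma zvalM (x y : Zp) : x != 0 -> y != 0 -> zval (x * y) = (zval x + zval y)%N.
Proof.
move=> x0 y0; have xy0 := zmul_neq0 x0 y0.
apply/eqP; rewrite eqn_leq leqNgt !zval_le // zmul_res_eq0 // ltnn /=.
by rewrite zmul_res_eq0.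
Qed.

Lemma zvalN (x : Zp) : x != 0 -> zval (- x) = zval x.
Proof.
move=> x0; have h k : (zres (- x) k == 0%N) = (zres x k == 0%N).
  apply/eqP/eqP => xk.
    have : (x - x) k = 0%N by rewrite subrr zres0.
    by rewrite zresD xk addn0 zres_small.
  have : (x - x) k = 0%N by rewrite subrr zres0.
  by rewrite zresD xk add0n zres_small.
have nx0 : - x != 0 by rewrite oppr_eq0.
apply/eqP; rewrite eqn_leq !zval_le // h -[X in X && _]h.
by rewrite (zvalP x0).1 (zvalP nx0).1.
Qed.

Definition znorm (x : Zp) : rat := if x == 0 then 0 else p%:R ^- zval x.

Lemma pQ_gt0 n : 0 < (p%:R ^- n : rat).
Proof. by rewrite invr_gt0 exprn_gt0 // ltr0n prime_gt0. Qed.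

Lemma znorm0 : znorm 0 = 0. Proof. by rewrite /znorm eqxx. Qed.

Lemma znorm_ge0 x : 0 <= znorm x.
Proof. by rewrite /znorm; case: eqP => // _; exact/ltW/pQ_gt0. Qed.

Lemma znorm_eq0 x : (znorm x == 0) = (x == 0).
Proof. by rewrite /znorm; case: (eqVneq x 0) => [_|x0]; rewrite ?eqxx // gt_eqF // pQ_gt0. Qed.

Lemma znormM x y : znorm (x * y) = znorm x * znorm y.
Proof.
rewrite /znorm mulf_eq0; case: (eqVneq x 0) => [_|x0] /=; first by rewrite mul0r.
case: (eqVneq y 0) => [_|y0] /=; first by rewrite mulr0.
by rewrite zvalM // exprD invfM.
Qed.

Lemma znormN x : znorm (- x) = znorm x.
Proof. by rewrite /znorm oppr_eq0; case: eqVneq => // x0; rewrite zvalN. Qed.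

Lemma znorm_le x k : (znorm x <= p%:R ^- k) = (zres x k == 0%N).
Proof.
rewrite /znorm; case: (eqVneq x 0) => [->|x0].
  by rewrite zres0 eqxx ltW // pQ_gt0.
rewrite -zval_le // lef_pV2 ?posrE ?exprn_gt0 ?ltr0n ?prime_gt0 //.
by rewrite ler_eXn2l // ltr1n prime_gt1.
Qed.

Lemma znormD (x y : Zp) : znorm (x + y) <= Num.max (znorm x) (znorm y).
Proof.
wlog le_xy : x y / znorm x <= znorm y => [hw|].
  have /orP[|yx] := le_total (znorm x) (znorm y); first exact: hw.
  by rewrite addrC maxC hw.
rewrite (max_idPr le_xy).
have [y0|y0] := eqVneq y 0.
  by rewrite {1}y0 addr0.
have ny : znorm y = p%:R ^- zval y by rewrite /znorm (negPf y0).
have yk : zres y (zval y) == 0%N by rewrite -znorm_le -ny.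
have xk : zres x (zval y) == 0%N by rewrite -znorm_le -ny.
by rewrite ny znorm_le zresD (eqP xk) (eqP yk) mod0n.
Qed.

End PadicInt.

Section Padic.
Variables (p : nat) (p_pr : prime p).
Local Notation Zp := (padic_int p_pr).

Definition padic : Type := {fraction Zp}.

HB.instance Definition _ := GRing.Field.on padic.

Definition padic_norm (x : padic) : rat :=
  let r : {ratio Zp} := repr (x : {fraction Zp}) in
  znorm \n_r / znorm \d_r.

Local Notation "x %:F" := (@FracField.tofrac Zp x).

Lemma pi_fracE (r : {ratio Zp}) :
  (\pi_({fraction Zp})%qT r) = (\n_r)%:F / (\d_r)%:F.
Proof.
have d0 : \d_r != 0 by exact: denom_ratioP.
unlock FracField.tofrac.
rewrite -[X in _ = _ * X]FracField.pi_inv -[RHS]FracField.pi_mul.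
apply/eqmodP; rewrite /= FracField.equivfE /FracField.mulf /FracField.invf.
by rewrite !numden_Ratio ?oner_eq0 ?mulf_neq0 ?oner_eq0 // !mul1r !mulr1 mulrC.
Qed.

Lemma padicP (x : padic) : exists n d : Zp, d != 0 /\ x = n%:F / d%:F.
Proof.
elim/quotW: x => r; exists \n_r, \d_r; split; first exact: denom_ratioP.
exact: pi_fracE.
Qed.

Lemma padic_norm_frac (n d : Zp) : d != 0 ->
  padic_norm (n%:F / d%:F) = znorm n / znorm d.
Proof.
move=> d0; rewrite /padic_norm; set s := repr _.
have s0 : \d_s != 0 by exact: denom_ratioP.
have := pi_fracE s; rewrite reprK => /eqP.
rewrite eqr_div ?tofrac_eq0 // -!rmorphM /= tofrac_eq => /eqP E.
by apply/eqP; rewrite eqr_div ?znorm_eq0 // -!znormM E.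
Qed.

Lemma padic_norm0 : padic_norm 0 = 0.
Proof.
have -> : 0 = 0%:F / 1%:F :> padic by rewrite rmorph0 mul0r.
by rewrite padic_norm_frac ?oner_eq0 // znorm0 mul0r.
Qed.

Lemma padic_norm_eq0 (x : padic) : padic_norm x = 0 -> x = 0.
Proof.
have [n [d [d0 ->]]] := padicP x; rewrite padic_norm_frac // => /eqP.
rewrite mulf_eq0 invr_eq0 !znorm_eq0 (negPf d0) orbF => /eqP ->.
by rewrite rmorph0 mul0r.
Qed.

Lemma padic_norm_ge0 (x : padic) : 0 <= padic_norm x.
Proof.
have [n [d [d0 ->]]] := padicP x.
by rewrite padic_norm_frac // divr_ge0 ?znorm_ge0.
Qed.

Lemma padic_normN (x : padic) : padic_norm (- x) = padic_norm x.
Proof.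
have [n [d [d0 ->]]] := padicP x.
by rewrite -mulNr -rmorphN !padic_norm_frac // znormN.
Qed.

Lemma padic_normM (x y : padic) :
  padic_norm (x * y) = padic_norm x * padic_norm y.
Proof.
have [n [d [d0 ->]]] := padicP x; have [m [e [e0 ->]]] := padicP y.
rewrite mulf_div -!rmorphM !padic_norm_frac ?mulf_neq0 // !znormM.
by rewrite mulf_div.
Qed.

Lemma padic_normD (x y : padic) :
  padic_norm (x + y) <= Num.max (padic_norm x) (padic_norm y).
Proof.
have [n [d [d0 ->]]] := padicP x; have [m [e [e0 ->]]] := padicP y.
have dp : 0 < znorm d by rewrite lt_neqAle eq_sym znorm_eq0 d0 znorm_ge0.
have ep : 0 < znorm e by rewrite lt_neqAle eq_sym znorm_eq0 e0 znorm_ge0.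
rewrite addf_div ?tofrac_eq0 // -!rmorphM -rmorphD.
rewrite !padic_norm_frac ?mulf_neq0 // ler_pdivrMr znormM ?mulr_gt0 //.
apply: le_trans (znormD _ _) _; rewrite !znormM maxr_pMl ?mulr_ge0 ?znorm_ge0 //.
by rewrite [znorm d * _ in X in _ <= Num.max _ X]mulrC !mulrA !divfK ?gt_eqF.
Qed.

Definition padic_dist (x y : padic) : rat := padic_norm (x - y).

Lemma padic_distxx x : padic_dist x x = 0.
Proof. by rewrite /padic_dist subrr padic_norm0. Qed.

Lemma padic_dist_positivity x y : padic_dist x y = 0 -> x = y.
Proof. by move=> /padic_norm_eq0 /eqP; rewrite subr_eq0 => /eqP. Qed.

Lemma padic_distC x y : padic_dist x y = padic_dist y x.
Proof. by rewrite /padic_dist -opprB padic_normN. Qed.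

Lemma padic_dist_triangle y x z :
  padic_dist x z <= padic_dist x y + padic_dist y z.
Proof.
rewrite /padic_dist -(subrKA y); apply: le_trans (padic_normD _ _) _.
by rewrite ge_max lerDl lerDr !padic_norm_ge0.
Qed.

HB.instance Definition _ := isPointed.Build padic 0.
HB.instance Definition _ := isMetric.Build rat padic
  padic_distxx padic_dist_positivity padic_distC padic_dist_triangle.

End Padic.

Section Analytic.
Variables (p : nat) (p_pr : prime p).
Local Notation Qp := (padic p_pr).

Definition monomial k (I : {ffun 'I_k -> nat}) (x : 'rV[Qp]_k) : Qp :=
  \prod_(i < k) x 0 i ^+ I i.

(* The multivariate power series with coefficients c, centred at a, sums to s
   at x. Sums are unconditional: limits along the directed set of finite sets
   of multi-indices. *)
Definition power_series_sum k (c : {ffun 'I_k -> nat} -> Qp)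
    (a x : 'rV[Qp]_k) (s : Qp) : Prop :=
  partial_sum (fun I => c I * monomial I (x - a)) @ totally --> s.

(* 'rV_k carries the sup-distance, so that its balls are the sets
   a + p^m Z_p^k. Only the values of f on U matter, and U is open if f is
   analytic on U. *)
Definition analytic_on k a b (U : set 'rV[Qp]_k)
    (f : 'rV[Qp]_k -> 'M[Qp]_(a, b)) : Prop :=
  forall x, U x ->
    exists (x0 : 'rV[Qp]_k) (r : rat)
           (c : 'I_a -> 'I_b -> {ffun 'I_k -> nat} -> Qp),
      [/\ ball x0 r x, ball x0 r `<=` U
        & forall y, ball x0 r y ->
            forall i j, power_series_sum (c i j) x0 y (f y i j)].

(* The library's derive requires a normed module over a numFieldType, which
   excludes Q_p. *)
Definition pderive k a b (f : 'rV[Qp]_k -> 'M[Qp]_(a, b)) (i : 'I_k)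
    (x : 'rV[Qp]_k) : 'M[Qp]_(a, b) :=
  lim ((fun h : Qp => h^-1 *: (f (h *: 'e_i + x) - f x)) @ (0 : Qp)^').

(* Vectors are rows: the differential of f at x is u |-> u *m jacobian f x. *)
Definition jacobian k l (f : 'rV[Qp]_k -> 'rV[Qp]_l) (x : 'rV[Qp]_k) :
    'M[Qp]_(k, l) :=
  \matrix_(i, j) pderive f i x 0 j.

End Analytic.

Section Manifold.
Variables (p : nat) (p_pr : prime p).
Local Notation Qp := (padic p_pr).

(* The map and the inverse of a chart are total functions, whose values
   outside the domain and outside the image are irrelevant. *)
Record chart (l : nat) (T : topologicalType) := Chart {
  dom : set T;
  cmap :> T -> 'rV[Qp]_l;
  cinv : 'rV[Qp]_l -> T;
  dom_open : open dom;
  img_open : open (cmap @` dom);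
  cmapK : forall m, dom m -> cinv (cmap m) = m;
  cmap_continuous : {within dom, continuous cmap};
  cinv_continuous : {within cmap @` dom, continuous cinv} }.

Definition compatible l T (c d : chart l T) : Prop :=
  analytic_on (c @` (dom c `&` dom d)) (d \o cinv c) /\
  analytic_on (d @` (dom c `&` dom d)) (c \o cinv d).

Record manifold (l : nat) := Manifold {
  carrier :> topologicalType;
  manifold_hausdorff : hausdorff_space carrier;
  atlas : set (chart l carrier);
  atlas_cover : forall m, exists2 c, atlas c & dom c m;
  atlas_compatible : forall c d, atlas c -> atlas d -> compatible c d }.

(* The charts of M are those of its maximal atlas. *)
Definition is_chart l (M : manifold l) (c : chart l M) : Prop :=
  forall d, atlas d -> compatible c d.

Definition chart_at l (M : manifold l) (m : M) : Type :=
  {c : chart l M | is_chart c /\ dom c m}.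

Definition chart_of_at l (M : manifold l) (m : M) (c : chart_at m) :
  chart l M := sval c.
Coercion chart_of_at : chart_at >-> chart.

Definition analytic_map k l (M : manifold k) (N : manifold l) (U : set M)
    (f : M -> N) : Prop :=
  forall (c : chart k M) (d : chart l N), is_chart c -> is_chart d ->
    analytic_on (c @` (U `&` dom c `&` f @^-1` dom d)) (d \o f \o cinv c).

Definition analytic_diffeo k l (M : manifold k) (N : manifold l)
    (U : set M) (V : set N) (f : M -> N) : Prop :=
  [/\ open U, open V, set_bij U V f, analytic_map U f
    & exists g : N -> M,
        (forall m, U m -> g (f m) = m) /\ analytic_map V g].

Definition submanifold l (M : manifold l) (Q : set M) : Prop :=
  forall m, Q m -> exists c : chart l M,
    [/\ is_chart c, dom c m & exists (k : nat) (b : 'rV[Qp]_l),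
      (k <= l)%N /\
      c @` (dom c `&` Q) =
        [set x | (c @` dom c) x /\ forall i : 'I_l, (k <= i)%N -> x 0 i = b 0 i]].

End Manifold.

Section Tangent.
Variables (p : nat) (p_pr : prime p) (l : nat) (M : manifold p_pr l) (m : M).
Local Notation Qp := (padic p_pr).

(* A tangent vector at m is the family of its coordinates in all the charts at
   m, subject to the usual transformation law under changes of charts. *)
Definition tangent_pred : {pred chart_at m -> 'rV[Qp]_l} := fun v =>
  `[< forall c d : chart_at m, v d = v c *m jacobian (d \o cinv c) (c m) >].

Fact tangent_submod_closed : submod_closed tangent_pred.
Proof.
split; first by apply/asboolP => c d; rewrite mul0mx.
move=> a u v /asboolP uP /asboolP vP; apply/asboolP => c d.
by rewrite mulmxDl -scalemxAl -uP -vP.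
Qed.

HB.instance Definition _ := GRing.isSubmodClosed.Build Qp _ tangent_pred
  tangent_submod_closed.

Record tangent := Tangent {
  tcoord :> chart_at m -> 'rV[Qp]_l;
  tcoordP : tcoord \in tangent_pred }.

HB.instance Definition _ := [isSub for tcoord].
HB.instance Definition _ := [Choice of tangent by <:].
HB.instance Definition _ := [SubChoice_isSubLmodule of tangent by <:].

End Tangent.

Section Forms.
Variables (p : nat) (p_pr : prime p).
Local Notation Qp := (padic p_pr).

Definition form_field l (M : manifold p_pr l) : Type :=
  forall m : M, tangent m -> tangent m -> Qp.

Definition alternating_form l (M : manifold p_pr l) (w : form_field M) :=
  forall m : M, [/\ forall u, scalar (w m u), forall v, scalar (w m ^~ v)
                  & forall u, w m u u = 0].

(* A is the matrix of coefficients of w in the chart c, as a function of the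
   coordinates. *)
Definition coefficients l (M : manifold p_pr l) (w : form_field M)
    (c : chart p_pr l M) (A : 'rV[Qp]_l -> 'M[Qp]_l) : Prop :=
  forall (m : M) (cm : is_chart c /\ dom c m) (u v : tangent m),
    let c_m : chart_at m := exist _ c cm in
    w m u v = (u c_m *m A (c m) *m (v c_m)^T) 0 0.

Definition analytic_form l (M : manifold p_pr l) (w : form_field M) : Prop :=
  forall c : chart p_pr l M, is_chart c ->
    exists A, coefficients w c A /\ analytic_on (c @` dom c) A.

(* For w = \sum_(j < k) A_jk dx_j /\ dx_k, the coefficients of d w. *)
Definition exterior_derivative l (A : 'rV[Qp]_l -> 'M[Qp]_l) (i j k : 'I_l)
    (x : 'rV[Qp]_l) : Qp :=
  pderive A i x j k + pderive A j x k i + pderive A k x i j.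

Definition closed_form l (M : manifold p_pr l) (w : form_field M) : Prop :=
  forall (c : chart p_pr l M) A, is_chart c -> coefficients w c A ->
    forall x, (c @` dom c) x -> forall i j k, exterior_derivative A i j k x = 0.

Definition nondegenerate l (M : manifold p_pr l) (w : form_field M) : Prop :=
  forall (m : M) (u : tangent m), u != 0 -> exists v, w m u v != 0.

Definition symplectic_form l (M : manifold p_pr l) (w : form_field M) : Prop :=
  [/\ alternating_form w, analytic_form w, closed_form w & nondegenerate w].

(* u' is the image of u under the tangent map of f at m. *)
Definition pushforward k l (M : manifold p_pr k) (N : manifold p_pr l)
    (f : M -> N) (m : M) (u : tangent m) (u' : tangent (f m)) : Prop :=
  forall (c : chart_at m) (d : chart_at (f m)),
    u' d = u c *m jacobian (d \o f \o cinv c) (c m).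

(* w = f^* w' on U. *)
Definition is_pullback_on k l (M : manifold p_pr k) (N : manifold p_pr l)
    (U : set M) (f : M -> N) (w' : form_field N) (w : form_field M) : Prop :=
  forall m : M, U m -> forall u v : tangent m,
    exists u' v', [/\ pushforward u u', pushforward v v'
                    & w m u v = w' (f m) u' v'].

End Forms.

(* Main.v *)
Require Import Defs.
From HB Require Import structures.
From mathcomp Require Import all_boot all_order all_algebra.
From mathcomp Require Import fraction finmap.
From mathcomp Require Import all_classical topology normedtype.
From mathcomp.analysis.showcase Require Import summability.
From mathcomp Require Import ring.

Set Implicit Arguments.
Unset Strict Implicit.
Unset Printing Implicit Defensive.

Import Order.TTheory GRing.Theory Num.Theory.

Local Open Scope classical_set_scope.
Local Open Scope ring_scope.

(** Moser's trick, run on power series. Fix [q] in [Q] and a chart at [q] where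
    [Q] is [y = 0], and work on a ball of radius [p^-N], rescaled to [Zp^l];
    analytic functions become elements of the Tate algebra. Dividing coefficients
    by their weight under the Euler field of [y] gives a one-form [s] vanishing on
    [Q] with [ds = w1 - w0]. The time-dependent field [Y = - s (w0 + t ds)^-1] has
    norm at most [1] for [N] large, so the exponential of [eps (d/dt + Y)] converges
    for [eps = p^2], since [|eps^n / n!| <= p^-n]. (Time is reparametrized so that
    [t] runs from [0] to [eps].) This exponential is a ring morphism, hence it is
    composition with a map, the flow; it transports [w1] to [w0] because the Lie
    derivative of the interpolating form vanishes.

    The local maps so obtained and their inverses fix [Q] and do not increase
    distances, so they preserve every small ball centred at a point of [Q]. By
    compactness finitely many of their domains cover [Q]; as these are clopen,
    using at each point the first domain containing it glues the maps into a
    diffeomorphism of a neighborhood of [Q]. *)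

(** * The p-adic norm *)

(** Time is made the coordinate [ord0] of a polydisc with one more dimension, so the time-dependent
    field becomes a single derivation, and its exponential yields the flow, its inverse and the
    transport of forms. The price: the interpolated form must be invertible for every [t] in [Zp],
    and dividing [t] by [eps] costs a factor [p^2]. Rescaling pays for both. Since [w1 - w0]
    vanishes at the centre, on a small ball the interpolation is a small perturbation of the
    constant matrix of [w0] at the centre, and a Neumann series inverts it. For [Y] to be small as
    well, the primitive must vanish to second order: it is a sum of [y_a * g a c], where [y_a]
    compensates the power of [p] by which rescaling multiplies derivatives, while [g a c], zero at
    the centre, supplies the smallness. Elements of the Tate algebra are functions on [Zp^k] that
    admit coefficients; in characteristic zero the function determines them, so identities are
    checked at points and bounds on coefficients. The product and pullback rules for exponentials
    come from uniqueness for a recursion, exchanges of limits from one Fubini theorem. *)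

Section Norm.
Variables (p : nat) (p_pr : prime p).
Local Notation Zp := (padic_int p_pr).
Local Notation Qp := (padic p_pr).

(* Sealed: rewriting with ring laws would otherwise unfold [padic_norm], whose
   body is a quotient. *)
Fact nm_subproof : {f : Qp -> rat | f = @padic_norm p p_pr}.
Proof. by exists (@padic_norm p p_pr). Qed.

Definition nm : Qp -> rat := sval nm_subproof.

Lemma nmE : nm = @padic_norm p p_pr.
Proof. by rewrite /nm; case: nm_subproof. Qed.

Lemma nm0 : nm 0 = 0. Proof. by rewrite nmE padic_norm0. Qed.
Lemma nm_ge0 x : 0 <= nm x. Proof. by rewrite nmE padic_norm_ge0. Qed.
Lemma nmN x : nm (- x) = nm x. Proof. by rewrite nmE padic_normN. Qed.
Lemma nmM x y : nm (x * y) = nm x * nm y. Proof. by rewrite nmE padic_normM. Qed.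
Lemma nmD x y : nm (x + y) <= Num.max (nm x) (nm y).
Proof. by rewrite nmE padic_normD. Qed.
Lemma nm_eq0 x : (nm x == 0) = (x == 0).
Proof.
by rewrite nmE; apply/eqP/eqP => [/padic_norm_eq0|->] //; rewrite padic_norm0.
Qed.

Definition zemb (x : Zp) : Qp := @FracField.tofrac Zp x.

Lemma zemb_zmod : zmod_morphism zemb. Proof. exact: raddfB. Qed.
Lemma zemb_monoid : monoid_morphism zemb.
Proof. by split; [exact: (rmorph1 (@FracField.tofrac Zp))|exact: (rmorphM (@FracField.tofrac Zp))]. Qed.

HB.instance Definition _ := GRing.isZmodMorphism.Build Zp Qp zemb zemb_zmod.
HB.instance Definition _ := GRing.isMonoidMorphism.Build Zp Qp zemb zemb_monoid.

Lemma zemb_inj : injective zemb.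
Proof. by move=> x y /eqP; rewrite [_ == _]tofrac_eq => /eqP. Qed.

Lemma nm_zemb (x : Zp) : nm (zemb x) = znorm x.
Proof.
have -> : zemb x = zemb x / zemb 1 by rewrite rmorph1 divr1.
rewrite nmE padic_norm_frac ?oner_eq0 //.
suff -> : znorm (1 : Zp) = 1 by rewrite divr1.
have := znormM (1 : Zp) 1; rewrite mulr1 => /eqP.
rewrite -subr_eq0 -{1}[znorm 1]mulr1 -mulrBr mulf_eq0 znorm_eq0 oner_eq0 /=.
by rewrite subr_eq0 => /eqP <-.
Qed.

Lemma znorm_le1 (x : Zp) : znorm x <= 1.
Proof.
have := znorm_le x 0; rewrite expr0 invr1 => ->.
by have := zres_lt x 0; rewrite expn0; case: (zres x 0).
Qed.

Lemma nm_zemb_le1 (x : Zp) : nm (zemb x) <= 1.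
Proof. by rewrite nm_zemb znorm_le1. Qed.

Lemma nm1 : nm 1 = 1.
Proof.
have := nmM (1 : Qp) 1; rewrite mulr1 => /eqP.
rewrite -subr_eq0 -{1}[nm 1]mulr1 -mulrBr mulf_eq0 => /orP[|].
  by rewrite nm_eq0 oner_eq0.
by rewrite subr_eq0 => /eqP <-.
Qed.

Lemma nm_gt0 (x : Qp) : (0 < nm x) = (x != 0).
Proof. by rewrite lt_neqAle nm_ge0 andbT eq_sym nm_eq0. Qed.

Lemma nmX (x : Qp) k : nm (x ^+ k) = nm x ^+ k.
Proof.
by elim: k => [|k IH]; rewrite ?expr0 ?nm1 // !exprS nmM IH.
Qed.

Lemma nmV (x : Qp) : nm x^-1 = (nm x)^-1.
Proof.
have [->|x0] := eqVneq x 0; first by rewrite invr0 nm0 invr0.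
have nx : nm x != 0 by rewrite nm_eq0.
by apply: (mulfI nx); rewrite -nmM !divff ?nm1.
Qed.

Lemma nmB_le (x y : Qp) e : nm x <= e -> nm y <= e -> nm (x - y) <= e.
Proof.
move=> xe ye; apply: le_trans (nmD _ _) _.
by rewrite nmN ge_max xe ye.
Qed.

Lemma nmD_le (x y : Qp) e : nm x <= e -> nm y <= e -> nm (x + y) <= e.
Proof.
by move=> xe ye; apply: le_trans (nmD _ _) _; rewrite ge_max xe ye.
Qed.

Lemma nm_sum_le (I : Type) (r : seq I) (P : pred I) (F : I -> Qp) (e : rat) :
  0 <= e -> (forall i, P i -> nm (F i) <= e) -> nm (\sum_(i <- r | P i) F i) <= e.
Proof.
move=> e0 Fe; elim/big_ind: _ => //; first by rewrite nm0.
by move=> x y; apply: nmD_le.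
Qed.

Lemma nm_sum_le_seq (I : eqType) (r : seq I) (F : I -> Qp) (e : rat) :
  0 <= e -> (forall i, i \in r -> nm (F i) <= e) -> nm (\sum_(i <- r) F i) <= e.
Proof. by move=> e0 Fe; rewrite big_seq; apply: nm_sum_le. Qed.

Lemma zres_nat (n k : nat) : zres (n%:R : Zp) k = (n %% p ^ k)%N.
Proof.
elim: n k => [|n IH] k; first by rewrite mulr0n zres0 mod0n.
rewrite -addn1 natrD zresD IH.
have -> : zres (1%:R : Zp) k = (1 %% p ^ k)%N by [].
by rewrite modnDm.
Qed.

Lemma nm_nat (n : nat) : nm n%:R <= 1.
Proof. by rewrite -(rmorph_nat zemb) nm_zemb_le1. Qed.

Lemma nm_nat_logn (n : nat) : (0 < n)%N -> nm n%:R = p%:R ^- logn p n.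
Proof.
move=> n0; rewrite -(rmorph_nat zemb) nm_zemb /znorm.
have h k : ((n%:R : Zp) k == 0%N) = (k <= logn p n)%N.
  by rewrite zres_nat -pfactor_dvdn.
case: eqVneq => [E|E].
  by have := h (logn p n).+1; rewrite E zres0 ltnn.
congr (_ ^- _); apply/eqP; rewrite eqn_leq -h.
by rewrite (zvalP E).1 /= zval_le // h leqnn.
Qed.

Lemma pr_gt0 : 0 < (p%:R : rat). Proof. by rewrite ltr0n prime_gt0. Qed.
Lemma pr_gt1 : 1 < (p%:R : rat). Proof. by rewrite ltr1n prime_gt1. Qed.

Lemma nm_p : nm p%:R = p%:R^-1.
Proof. by rewrite nm_nat_logn ?prime_gt0 // (pfactorK 1). Qed.

Lemma nm_pX k : nm (p%:R ^+ k) = p%:R ^- k.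
Proof. by rewrite nmX nm_p exprVn. Qed.

Lemma nat_neq0 (n : nat) : (0 < n)%N -> (n%:R : Qp) != 0.
Proof. by move=> n0; rewrite -nm_gt0 nm_nat_logn // pQ_gt0. Qed.

Lemma p_neq0 : (p%:R : Qp) != 0.
Proof. by rewrite nat_neq0 ?prime_gt0. Qed.

Lemma pX_neq0 k : (p%:R ^+ k : Qp) != 0.
Proof. by rewrite expf_neq0 ?p_neq0. Qed.

(** For positive [n] the norm of [1 / n] is [p ^ logn p n], a divisor of [n]. This linear growth is
    what the factor [p ^ degm I] has to beat in the homotopy operator [lam]. *)
Lemma nm_natV_le (n : nat) : nm (n%:R^-1) <= n%:R.
Proof.
case: n => [|n]; first by rewrite invr0 nm0.
rewrite nmV nm_nat_logn // invrK -natrX ler_nat.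
by apply: dvdn_leq => //; rewrite pfactor_dvdnn.
Qed.

Lemma logn_fact_le k : (logn p k`! <= k)%N.
Proof.
rewrite logn_fact //.
(* A strengthened bound for Legendre's sum: each quotient is at least twice the next one, so a spare
   copy of it pays for the next term and the next spare copy. *)
suff H j : (\sum_(1 <= i < j.+1) k %/ p ^ i + k %/ p ^ j <= k)%N.
  exact: leq_trans (leq_addr _ _) (H k).
elim: j => [|j IH]; first by rewrite big_geq // expn0 divn1.
rewrite big_nat_recr //= -addnA; apply: leq_trans IH; rewrite leq_add2l.
rewrite expnSr divnMA addnn -muln2.
apply: leq_trans (leq_trunc_div (k %/ p ^ j) p).
by rewrite leq_mul2l prime_gt1 // orbT.
Qed.

(** Here the choice [eps = p^2] pays off: of the [2 k] factors [p] at most [k] are lost to [k!],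
    which leaves a geometric decay. *)
Lemma nm_expcoef k : nm ((p%:R ^+ 2) ^+ k / k`!%:R) <= p%:R ^- k.
Proof.
rewrite nmM nmV nmX nm_pX nm_nat_logn ?fact_gt0 // invrK.
rewrite exprVn -exprM mul2n -addnn exprD invfM -mulrA ler_piMr //.
  by rewrite invr_ge0 exprn_ge0 // ltW // pr_gt0.
rewrite mulrC ler_pdivrMr ?exprn_gt0 ?pr_gt0 // mul1r.
by rewrite ler_eXn2l ?pr_gt1 // logn_fact_le.
Qed.

Lemma small_pX (e : rat) : 0 < e -> exists k, p%:R ^- k <= e.
Proof.
move=> e0; have [n ne] : exists n : nat, e^-1 <= n%:R.
  by exists (Num.bound e^-1); apply/ltW/archi_boundP; rewrite invr_ge0 ltW.
exists n; rewrite -[e]invrK lef_pV2 ?posrE ?exprn_gt0 ?pr_gt0 ?invr_gt0 //.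
apply: le_trans ne _; rewrite -natrX ler_nat.
by apply: ltnW; rewrite ltn_expl // prime_gt1.
Qed.

Lemma small_pXM (B e : rat) : 0 < e -> exists k, B * p%:R ^- k <= e.
Proof.
move=> e0; have [B0|B0] := ltP 0 B; last first.
  exists 0%N; apply: le_trans (ltW e0).
  by rewrite expr0 invr1 mulr1.
have [k Hk] := small_pX (divr_gt0 e0 B0); exists k.
by move: Hk; rewrite ler_pdivlMr // mulrC.
Qed.

Lemma le_pXV a b : (a <= b)%N -> (p%:R ^- b : rat) <= p%:R ^- a.
Proof.
move=> ab; rewrite lef_pV2 ?posrE ?exprn_gt0 ?pr_gt0 //.
by rewrite ler_eXn2l ?pr_gt1.
Qed.

Lemma le_pXM (B e : rat) k k' : (k <= k')%N -> 0 <= B ->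
  B * p%:R ^- k <= e -> B * p%:R ^- k' <= e.
Proof. by move=> kk B0; apply: le_trans; rewrite ler_wpM2l // le_pXV. Qed.

(** Shift of digits: the residue of the quotient modulo [p ^ n] is that of [x] modulo [p ^ (n + v)],
    divided by [p ^ v]. *)
Lemma zdivp (x : Zp) v : zres x v = 0%N -> exists y : Zp, x = (p%:R) ^+ v * y.
Proof.
move=> xv.
have dv n : (p ^ v %| x (n + v))%N by rewrite -zres_eq0 ?xv // leq_addl.
have H n : (x (n.+1 + v) %/ p ^ v = x (n + v) %/ p ^ v %[mod p ^ n])%N.
  apply/eqP; rewrite -(@eqn_modDr 0) !addn0.
  suff : ((x (n.+1 + v) %/ p ^ v) * p ^ v
          == (x (n + v) %/ p ^ v) * p ^ v %[mod p ^ n * p ^ v])%N.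
    by rewrite -!muln_modl eqn_pmul2r // expn_gt0 prime_gt0.
  by rewrite !divnK // -expnD addSn; apply/eqP; apply: zmod_succ.
exists (zmk p_pr H); apply: zres_inj => n.
rewrite -natrX zresM zres_nat /= modnMm mulnC divnK //.
by rewrite zres_mod ?leq_addr.
Qed.

(** Each residue of [x] is inverted by the Euclidean algorithm; the inverses are compatible because
    an inverse modulo [p ^ n] is unique. *)
Lemma zunit_val0 (x : Zp) : zres x 1 != 0%N -> exists y : Zp, x * y = 1.
Proof.
move=> x1.
have co n : coprime (x n) (p ^ n).
  case: n => [|n]; first by rewrite expn0 coprimen1.
  rewrite coprime_sym coprimeXl // prime_coprime //.
  by apply: contra x1; rewrite (@zres_eq0 _ _ x 1 n.+1) ?expn1.
have H n : exists y, (x n * y = 1 %[mod p ^ n])%N.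
  case: n => [|n]; first by exists 0%N; rewrite expn0 !modn1.
  have xn0 : (0 < x n.+1)%N.
    rewrite lt0n; apply: contra x1 => /eqP E.
    by rewrite (@zres_eq0 _ _ x 1 n.+1) // E dvdn0.
  case: (egcdnP (p ^ n.+1) xn0) => km kn E _.
  exists km; rewrite mulnC E.
  by move: (co n.+1); rewrite /coprime => /eqP ->; rewrite modnMDl.
pose y n := sval (cid (H n)).
have yP n : (x n * y n = 1 %[mod p ^ n])%N by rewrite /y; case: cid.
have cons n : (y n.+1 = y n %[mod p ^ n])%N.
  have E1 : (x n * y n.+1 = 1 %[mod p ^ n])%N.
    rewrite -modnMml -zmod_succ modnMml.
    have := congr1 (modn^~ (p ^ n))%N (yP n.+1).
    by rewrite /= !modn_dvdm // dvdn_exp2l.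
  rewrite -[y n.+1]mul1n -[y n]mul1n -modnMml -(yP n) modnMml.
  rewrite mulnAC -modnMml E1 modnMml; by [].
exists (zmk p_pr cons); apply: zres_inj => n.
by rewrite zresM /= modnMmr yP.
Qed.

Lemma zunitfact (x : Zp) : x != 0 ->
  exists u w : Zp, x = p%:R ^+ zval x * u /\ u * w = 1.
Proof.
move=> x0; have [v0 v1] := zvalP x0.
have [u xu] := zdivp v0.
suff /zunit_val0 [w uw] : zres u 1 != 0%N by exists u, w.
apply: contra v1 => /eqP u1; have [u' E] := zdivp u1.
rewrite {1}xu E mulrA -exprD addn1 -natrX zresM zres_nat modnn.
by rewrite mul0n mod0n.
Qed.

(** Powers of [p] are split off in numerator and denominator: that of the denominator cancels, and
    its remaining unit is inverted in [Zp]. *)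
Lemma zembP (x : Qp) : nm x <= 1 -> exists z : Zp, x = zemb z.
Proof.
have [n [d [d0 ->]]] := padicP x; rewrite nmE padic_norm_frac // => le1.
have [->|n0] := eqVneq n 0; first by exists 0; rewrite !rmorph0 mul0r.
have [u [w [Ed uw]]] := zunitfact d0; have [u' [w' [En _]]] := zunitfact n0.
have vv : (zval d <= zval n)%N.
  move: le1; rewrite /znorm (negPf n0) (negPf d0) invrK mulrC.
  rewrite ler_pdivrMr ?exprn_gt0 ?pr_gt0 // mul1r.
  by rewrite ler_eXn2l ?pr_gt1.
exists (p%:R ^+ (zval n - zval d) * u' * w).
have d0' : zemb d != 0 by rewrite /zemb tofrac_eq0.
apply: (mulIf d0'); rewrite mulfVK //.
rewrite -[LHS]/(zemb n) -rmorphM {1}En {2}Ed; congr zemb.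
rewrite -{1}(subnK vv) exprD.
transitivity (p%:R ^+ (zval n - zval d) * u' * (p%:R ^+ zval d) * (u * w)); last by ring.
by rewrite uw; ring.
Qed.

(** Completeness of [Zp]: the diagonal residues are compatible and define the limit. *)
Lemma zcauchy (x : nat -> Zp) :
  (forall n, zres (x n.+1) n = zres (x n) n) ->
  exists s : Zp, forall n, zres s n = zres (x n) n.
Proof.
move=> H.
have K n : (zres (x n.+1) n.+1 = zres (x n) n %[mod p ^ n])%N.
  by rewrite (zres_mod _ (leqnSn n)) H zres_small.
by exists (zmk p_pr K) => n /=; rewrite zres_small.
Qed.

Lemma zres_sub_eq (x y : Zp) n : (nm (zemb x - zemb y) <= p%:R ^- n) = (zres x n == zres y n).
Proof.
rewrite -rmorphB nm_zemb znorm_le.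
apply/eqP/eqP => [xy|xy].
  have -> : x = (x - y) + y by rewrite subrK.
  by rewrite zresD xy add0n zres_small.
have : zres (y - y) n = 0%N by rewrite subrr zres0.
by rewrite !zresD xy.
Qed.

End Norm.

(** * Unconditional sums *)

Section Sums.
Variables (p : nat) (p_pr : prime p).
Local Notation Zp := (padic_int p_pr).
Local Notation Qp := (padic p_pr).
Local Notation nm := (@nm p p_pr).

Definition null (I : choiceType) (c : I -> Qp) : Prop :=
  forall e : rat, 0 < e -> exists A : {fset I}, forall i, i \notin A -> nm (c i) <= e.

(** The limit along finite sets as an explicit norm estimate; [power_series_hsum] matches it with
    [power_series_sum]. *)
Definition hsum (I : choiceType) (c : I -> Qp) (s : Qp) : Prop :=
  forall e : rat, 0 < e -> exists A : {fset I}, forall B : {fset I},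
    (A `<=` B)%fset -> nm (\sum_(i <- B) c i - s) <= e.

Lemma fsum_split (I : choiceType) (A B : {fset I}) (c : I -> Qp) :
  (A `<=` B)%fset ->
  \sum_(i <- B) c i = \sum_(i <- A) c i + \sum_(i <- (B `\` A)%fset) c i.
Proof.
move=> AB; rewrite (big_fsetID _ (mem A)) /=; congr (_ + _).
  apply: eq_fbigl => i; rewrite !inE /=.
  by apply/andP/idP => [[]//|iA]; rewrite iA (fsubsetP AB).
by apply: eq_fbigl => i; rewrite !inE /= andbC.
Qed.

Lemma hsum_null (I : choiceType) (c : I -> Qp) s : hsum c s -> null c.
Proof.
move=> cs e e0; have [A HA] := cs e e0; exists A => i iA.
have -> : c i = (\sum_(j <- (i |` A)%fset) c j - s) - (\sum_(j <- A) c j - s).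
  by rewrite big_fsetU1 //=; ring.
by apply: nmB_le; apply: HA; rewrite ?fsubsetUr.
Qed.

Lemma fsum_tail (I : choiceType) (c : I -> Qp) (A B : {fset I}) e : 0 <= e ->
  (forall i, i \notin A -> nm (c i) <= e) -> (A `<=` B)%fset ->
  nm (\sum_(i <- B) c i - \sum_(i <- A) c i) <= e.
Proof.
move=> e0 tA AB; rewrite (fsum_split c AB) addrC addKr.
by apply: nm_sum_le_seq => // i; rewrite !inE => /andP[/tA].
Qed.

Lemma hsum_tail (I : choiceType) (c : I -> Qp) s (A : {fset I}) e : 0 < e ->
  hsum c s -> (forall i, i \notin A -> nm (c i) <= e) ->
  nm (\sum_(i <- A) c i - s) <= e.
Proof.
move=> e0 cs tA; have [B HB] := cs e e0.
have -> : \sum_(i <- A) c i - s = (\sum_(i <- (A `|` B)%fset) c i - s)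
    - (\sum_(i <- (A `|` B)%fset) c i - \sum_(i <- A) c i) by ring.
apply: nmB_le; first by apply: HB; rewrite fsubsetUr.
by apply: fsum_tail => //; rewrite ?ltW // fsubsetUl.
Qed.

(** Ultrametric shortcut: a single finite set per [e] is enough, since adding terms of norm at most
    [e] moves the sum by at most [e]. *)
Lemma hsumI (I : choiceType) (c : I -> Qp) s :
  (forall e, 0 < e -> exists A : {fset I},
     (forall i, i \notin A -> nm (c i) <= e) /\ nm (\sum_(i <- A) c i - s) <= e) ->
  hsum c s.
Proof.
move=> H e e0; have [A [tA As]] := H e e0; exists A => B AB.
rewrite -(subrKA (\sum_(i <- A) c i)); apply: nmD_le => //.
by apply: fsum_tail => //; apply: ltW.
Qed.

Lemma nm_le0 (x : Qp) : (forall e, 0 < e -> nm x <= e) -> x = 0.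
Proof.
move=> H; apply/eqP; rewrite -nm_eq0 eq_le nm_ge0 andbT.
by apply/ler_addgt0Pl => e e0; rewrite addr0 H.
Qed.

Lemma hsum_unique (I : choiceType) (c : I -> Qp) s t :
  hsum c s -> hsum c t -> s = t.
Proof.
move=> cs ct; apply/eqP; rewrite -subr_eq0; apply/eqP/nm_le0 => e e0.
have [A tA] := hsum_null cs e0.
have -> : s - t = (\sum_(i <- A) c i - t) - (\sum_(i <- A) c i - s) by ring.
by apply: nmB_le; apply: hsum_tail.
Qed.

Lemma eq_hsum (I : choiceType) (c d : I -> Qp) s :
  c =1 d -> hsum c s -> hsum d s.
Proof. by move=> /funext ->. Qed.

Lemma null_le (I : choiceType) (c d : I -> Qp) :
  (forall i, nm (d i) <= nm (c i)) -> null c -> null d.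
Proof.
move=> dc nc e e0; have [A tA] := nc e e0.
by exists A => i iA; apply: le_trans (dc i) (tA i iA).
Qed.

Lemma nullZ (I : choiceType) (c d : I -> Qp) (B : rat) : 0 <= B ->
  (forall i, nm (d i) <= B * nm (c i)) -> null c -> null d.
Proof.
move=> B0 dc nc e e0.
have B1 : 0 < B + 1 by rewrite ltr_wpDl.
have [A tA] := nc (e / (B + 1)) (divr_gt0 e0 B1).
exists A => i iA; apply: le_trans (dc i) _.
apply: le_trans (ler_wpM2l B0 (tA i iA)) _.
rewrite mulrA ler_pdivrMr // mulrC ler_wpM2l //; first exact: ltW.
by rewrite lerDl.
Qed.

Lemma null_bound (I : choiceType) (c : I -> Qp) : null c ->
  exists B : rat, 0 <= B /\ forall i, nm (c i) <= B.
Proof.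
move=> nc; have [A tA] := nc 1 ltr01.
have S0 : 0 <= \sum_(i <- A) nm (c i).
  by apply: sumr_ge0 => i _; apply: nm_ge0.
exists (1 + \sum_(i <- A) nm (c i)); split; first by rewrite addr_ge0.
move=> i; have [iA|/tA ci] := boolP (i \in A); last first.
  by apply: le_trans ci _; rewrite lerDl.
rewrite (big_fsetD1 _ iA) /= addrCA lerDl addr_ge0 //.
by apply: sumr_ge0 => j _; apply: nm_ge0.
Qed.

(** Partial sums over sets with tails below [p ^- n] lie in [Zp], and consecutive ones agree modulo
    [p ^ n], so [zcauchy] supplies the sum. Multiplying by a power of [p] reduces the general case
    [hsum_ex] to this one. *)
Lemma hsum_ex_int (I : choiceType) (c : I -> Qp) :
  (forall i, nm (c i) <= 1) -> null c -> exists s, hsum c s.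
Proof.
move=> c1 nc.
have e_ n : 0 < (p%:R ^- n : rat) by apply: pQ_gt0.
pose A n := sval (cid (nc _ (e_ n))).
have tA n i : i \notin A n -> nm (c i) <= p%:R ^- n by rewrite /A; case: cid => /= S; apply.
pose S n := \sum_(i <- A n) c i.
have S1 n : nm (S n) <= 1 by apply: nm_sum_le => //.
pose x n := sval (cid (zembP (S1 n))).
have xS n : S n = zemb (x n) by rewrite /x; case: cid.
have SS n : nm (S n.+1 - S n) <= p%:R ^- n.
  have -> : S n.+1 - S n = (\sum_(i <- (A n.+1 `|` A n)%fset) c i - S n) -
     (\sum_(i <- (A n.+1 `|` A n)%fset) c i - S n.+1) by ring.
  apply: nmB_le.
    by apply: fsum_tail; [exact/ltW|exact: tA|rewrite fsubsetUr].
  apply: fsum_tail; [exact/ltW| |by rewrite fsubsetUl].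
  by move=> i /tA ci; apply: le_trans ci (le_pXV _ _).
have [s Hs] : exists s : Zp, forall n, zres s n = zres (x n) n.
  by apply: zcauchy => n; apply/eqP; rewrite -zres_sub_eq -!xS.
exists (zemb s); apply: hsumI => e e0.
have [k ke] := small_pX p_pr e0; exists (A k); split=> [i /tA ci|].
  exact: le_trans ci ke.
apply: le_trans ke; rewrite -/(S k) xS zres_sub_eq; apply/eqP.
by rewrite Hs.
Qed.

Lemma hsumZ (I : choiceType) (c : I -> Qp) s a :
  hsum c s -> hsum (fun i => a * c i) (a * s).
Proof.
move=> cs; have nc := hsum_null cs.
have [->|a0] := eqVneq a 0.
  apply: hsumI => e e0; exists fset0; split=> [i _|].
    by rewrite mul0r nm0 ltW.
  by rewrite big_seq_fset0 mul0r subr0 nm0 ltW.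
have na : 0 < nm a by rewrite nm_gt0.
apply: hsumI => e e0; have ea := divr_gt0 e0 na.
have [A tA] := nc _ ea; exists A; split=> [i iA|].
  by rewrite nmM mulrC -ler_pdivlMr // tA.
rewrite -mulr_sumr -mulrBr nmM mulrC -ler_pdivlMr //.
exact: hsum_tail.
Qed.

Lemma hsum_ex (I : choiceType) (c : I -> Qp) : null c -> exists s, hsum c s.
Proof.
move=> nc; have [B [B0 cB]] := null_bound nc.
have [k kB] := small_pXM p_pr B (ltr01 : 0 < (1 : rat)).
have pk0 : p%:R ^+ k != 0 :> Qp by apply: pX_neq0.
have [s Hs] : exists s, hsum (fun i => p%:R ^+ k * c i) s.
  apply: hsum_ex_int => [i|].
    rewrite nmM nm_pX; apply: le_trans kB.
    by rewrite mulrC ler_wpM2r // invr_ge0 exprn_ge0 // ltW // pr_gt0.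
  apply: null_le nc => i; rewrite nmM ler_piMl ?nm_ge0 //.
  by rewrite -natrX nm_nat.
exists ((p%:R ^+ k)^-1 * s); apply: eq_hsum (hsumZ _ Hs) => i.
by rewrite mulrA mulVf // mul1r.
Qed.

Lemma hsumD (I : choiceType) (c d : I -> Qp) s t :
  hsum c s -> hsum d t -> hsum (fun i => c i + d i) (s + t).
Proof.
move=> cs dt e e0; have [A HA] := cs e e0; have [B HB] := dt e e0.
exists (A `|` B)%fset => C; rewrite fsubUset => /andP[AC BC].
by rewrite big_split /= opprD addrACA nmD_le // ?HA ?HB.
Qed.

Lemma nullD (I : choiceType) (c d : I -> Qp) :
  null c -> null d -> null (fun i => c i + d i).
Proof. by move=> /hsum_ex[s cs] /hsum_ex[t dt]; exact: hsum_null (hsumD cs dt). Qed.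

Lemma hsumN (I : choiceType) (c : I -> Qp) s :
  hsum c s -> hsum (fun i => - c i) (- s).
Proof.
by move=> /(hsumZ (-1)); rewrite mulN1r; apply: eq_hsum => i; rewrite mulN1r.
Qed.

Lemma hsum_le (I : choiceType) (c : I -> Qp) s e : 0 <= e ->
  hsum c s -> (forall i, nm (c i) <= e) -> nm s <= e.
Proof.
move=> e0 cs ce; apply/ler_addgt0Pl => d d0.
have [A tA] := hsum_null cs d0.
have -> : s = \sum_(i <- A) c i - (\sum_(i <- A) c i - s) by ring.
apply: nmB_le.
  by apply: le_trans (nm_sum_le _ e0 _) _ => //; rewrite lerDr ltW.
by apply: le_trans (hsum_tail d0 cs tA) _; rewrite lerDl.
Qed.

Lemma hsum_fin (I : choiceType) (c : I -> Qp) (A : {fset I}) :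
  (forall i, i \notin A -> c i = 0) -> hsum c (\sum_(i <- A) c i).
Proof.
move=> cA; apply: hsumI => e e0; exists A; split=> [i /cA ->|].
  by rewrite nm0 ltW.
by rewrite subrr nm0 ltW.
Qed.

Lemma hsum1 (I : choiceType) (c : I -> Qp) i0 :
  (forall i, i != i0 -> c i = 0) -> hsum c (c i0).
Proof.
move=> ci; have := @hsum_fin _ c [fset i0]%fset; rewrite big_seq_fset1.
by apply=> i; rewrite !inE => /ci.
Qed.

Lemma hsum0 (I : choiceType) : hsum (fun _ : I => 0) 0.
Proof.
by have := @hsum_fin _ (fun _ : I => 0) fset0; rewrite big_seq_fset0; apply.
Qed.

Lemma hsum_sum (I : choiceType) (J : Type) (r : seq J) (c : J -> I -> Qp) s :
  (forall j, hsum (c j) (s j)) ->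
  hsum (fun i => \sum_(j <- r) c j i) (\sum_(j <- r) s j).
Proof.
move=> cs; elim: r => [|j r IH].
  by rewrite big_nil; apply: eq_hsum (hsum0 _) => i; rewrite big_nil.
rewrite big_cons; apply: eq_hsum (hsumD (cs j) IH) => i.
by rewrite big_cons.
Qed.

Lemma hsum_reindex (I J : choiceType) (h : I -> J) (c : J -> Qp) s :
  injective h -> (forall j, (forall i, j <> h i) -> c j = 0) ->
  hsum (fun i => c (h i)) s -> hsum c s.
Proof.
move=> hi c0 cs; apply: hsumI => e e0.
have [A tA] := hsum_null cs e0; exists (h @` A)%fset; split.
  move=> j jA; have [[i ji]|nj] := pselect (exists i, j = h i).
    rewrite ji; apply: tA; apply: contra jA => iA; rewrite ji.
    by apply/imfsetP; exists i.
  rewrite c0 ?nm0 ?ltW // => i ji; apply: nj; by exists i.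
rewrite big_imfset /=; last by move=> x y _ _; apply: hi.
exact: hsum_tail.
Qed.

(** Smallness off a finite rectangle is the hypothesis of Fubini. Nullity of each row and each
    column would not do: entries [1] on the diagonal and [-1] just above it give row sums and column
    sums with different totals. *)
Definition null2 (I J : choiceType) (c : I -> J -> Qp) : Prop :=
  forall e : rat, 0 < e -> exists (A : {fset I}) (B : {fset J}), forall i j,
    ~~ ((i \in A) && (j \in B)) -> nm (c i j) <= e.

(** Row sums and column sums are each compared with the sum over the finite rectangle, with errors
    at most [e]. *)
Lemma hsum_fubini (I J : choiceType) (c : I -> J -> Qp) r t s :
  null2 c -> (forall i, hsum (c i) (r i)) -> (forall j, hsum (c^~ j) (t j)) ->
  hsum r s -> hsum t s.
Proof.
move=> nc cr ct rs; apply: hsumI => e e0; have [A [B H]] := nc e e0.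
have e0' := ltW e0.
exists B; split=> [j jB|].
  by apply: (hsum_le e0' (ct j)) => i; apply: H; rewrite negb_and jB orbT.
have rA i : i \notin A -> nm (r i) <= e.
  by move=> iA; apply: (hsum_le e0' (cr i)) => j; apply: H; rewrite negb_and iA.
have rB i : nm (\sum_(j <- B) c i j - r i) <= e.
  by apply: hsum_tail => // j jB; apply: H; rewrite negb_and jB orbT.
have tA j : nm (\sum_(i <- A) c i j - t j) <= e.
  by apply: (hsum_tail e0 (ct j)) => i iA; apply: H; rewrite negb_and iA.
have -> : \sum_(j <- B) t j - s =
  (\sum_(i <- A) (\sum_(j <- B) c i j - r i) - \sum_(j <- B) (\sum_(i <- A) c i j - t j))
   + (\sum_(i <- A) r i - s).
  by rewrite !sumrB exchange_big /=; ring.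
apply: nmD_le; last exact: hsum_tail.
by apply: nmB_le; apply: nm_sum_le.
Qed.

Lemma null2_rows (I J : choiceType) (c : I -> J -> Qp) : null2 c ->
  (forall i, null (c i)) /\ (forall j, null (c^~ j)).
Proof.
move=> nc; split=> [i|j] e e0; have [A [B H]] := nc e e0.
  by exists B => j jB; apply: H; rewrite negb_and jB orbT.
by exists A => i iA; apply: H; rewrite negb_and iA.
Qed.

Lemma null2I (I J : choiceType) (c : I -> J -> Qp) :
  (forall i, null (c i)) ->
  (forall e, 0 < e -> exists A : {fset I}, forall i, i \notin A ->
     forall j, nm (c i j) <= e) -> null2 c.
Proof.
move=> nc H e e0; have [A HA] := H e e0.
pose B i := sval (cid (nc i e e0)).
have HB i j : j \notin B i -> nm (c i j) <= e by rewrite /B; case: cid => /= S; apply.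
exists A, (\bigcup_(i <- A) B i)%fset => i j.
rewrite negb_and => /orP[iA|jB]; first exact: HA.
have [iA|/HA //] := boolP (i \in A).
apply: HB; apply: contra jB => jB; apply/bigfcupP; exists i => //.
by rewrite iA.
Qed.

Lemma hsum_fubini_ex (I J : choiceType) (c : I -> J -> Qp) : null2 c ->
  exists r t s, [/\ forall i, hsum (c i) (r i), forall j, hsum (c^~ j) (t j),
     hsum r s & hsum t s].
Proof.
move=> nc; have [n1 n2] := null2_rows nc.
pose r i := sval (cid (hsum_ex (n1 i))).
have rP i : hsum (c i) (r i) by rewrite /r; case: cid.
pose t j := sval (cid (hsum_ex (n2 j))).
have tP j : hsum (c^~ j) (t j) by rewrite /t; case: cid.
have [s rs] : exists s, hsum r s.
  apply: hsum_ex => e e0; have [A [B H]] := nc e e0; exists A => i iA.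
  by apply: (hsum_le (ltW e0) (rP i)) => j; apply: H; rewrite negb_and iA.
by exists r, t, s; split => //; apply: (hsum_fubini nc rP tP rs).
Qed.

Lemma cofinite_geom (B e : rat) : 0 <= B -> 0 < e ->
  exists X : {fset nat}, forall i, i \notin X -> B * p%:R ^- i <= e.
Proof.
move=> B0 e0; have [n ne] := small_pXM p_pr B e0.
exists [fset i in iota 0 n]%fset => i; rewrite !inE mem_iota /= add0n -leqNgt => ni.
exact: (le_pXM p_pr ni B0 ne).
Qed.

Lemma hsum_ord (c : nat -> Qp) n :
  (forall i, (n <= i)%N -> c i = 0) -> hsum c (\sum_(i < n) c i).
Proof.
move=> cn; have := @hsum_fin _ c [fset i in iota 0 n]%fset.
suff -> : \sum_(i <- [fset i in iota 0 n]%fset) c i = \sum_(i < n) c i.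
  by apply => i; rewrite !inE mem_iota /= add0n -leqNgt; apply: cn.
rewrite -(big_mkord xpredT) /index_iota subn0.
apply: perm_big; apply: uniq_perm => [||i]; rewrite ?fset_uniq ?iota_uniq //.
by rewrite !inE.
Qed.

(** Fubini for the family sheared by [k = i + j] and extended by zero where [k < i]. *)
Lemma hsum_diag (c : nat -> nat -> Qp) r s :
  null2 c -> (forall m, hsum (c m) (r m)) -> hsum r s ->
  hsum (fun k => \sum_(i < k.+1) c i (k - i)%N) s.
Proof.
move=> nc cr rs.
pose c' i k := if (i <= k)%N then c i (k - i)%N else 0.
have rows i : hsum (c' i) (r i).
  apply: (@hsum_reindex _ _ (addn i)) => [x y /addnI //|k nk|].
    rewrite /c'; case: leqP => // ik; case: (nk (k - i)%N).
    by rewrite subnKC.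
  by apply: eq_hsum (cr i) => k; rewrite /c' leq_addr addKn.
have cols k : hsum (c'^~ k) (\sum_(i < k.+1) c i (k - i)%N).
  have := @hsum_ord (c'^~ k) k.+1.
  rewrite (eq_bigr (fun i : 'I_k.+1 => c i (k - i)%N)); last first.
    by move=> i _; rewrite /c' -ltnS ltn_ord.
  by apply=> i ki; rewrite /c' leqNgt ki.
apply: (hsum_fubini _ rows cols rs) => e e0; have [X [Y H]] := nc e e0.
exists X, [fset (i + j)%N | i in X, j in Y]%fset => i k.
rewrite /c'; case: leqP => [ik|_ _]; last by rewrite nm0 ltW.
move=> nik; apply: H; apply: contra nik => /andP[iX kY]; rewrite iX /=.
by apply/imfset2P; exists i => //; exists (k - i)%N; rewrite // subnKC.
Qed.

Lemma hsum_cauchy (a b : nat -> Qp) s t : hsum a s -> hsum b t ->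
  hsum (fun k => \sum_(i < k.+1) a i * b (k - i)%N) (s * t).
Proof.
move=> as_ bt; have [B [B0 bB]] := null_bound (hsum_null bt).
apply: (@hsum_diag (fun i j => a i * b j) (fun i => a i * t)).
- apply: null2I => [i|e e0]; first exact: hsum_null (hsumZ _ bt).
  have [B1 B1e] : exists B1, 0 < B1 /\ B * B1 <= e.
    exists (e / (B + 1)); split; first by rewrite divr_gt0 // ltr_wpDl.
    by rewrite mulrA ler_pdivrMr ?ltr_wpDl // mulrC ler_wpM2l ?(ltW e0) // lerDl.
  have [A tA] := hsum_null as_ B1e.1; exists A => i /tA ai k.
  apply: le_trans B1e.2; rewrite nmM mulrC ler_pM ?nm_ge0 //.
- by move=> i; apply: hsumZ.
by rewrite mulrC; apply: eq_hsum (hsumZ t as_) => i; rewrite mulrC.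
Qed.

End Sums.

(** * Power series converging on the unit polydisc *)

Section Tate.
Variables (p : nat) (p_pr : prime p) (k : nat).
Local Notation Zp := (padic_int p_pr).
Local Notation Qp := (padic p_pr).
Local Notation nm := (@nm p p_pr).
Local Notation mi := {ffun 'I_k -> nat}.

Definition zv n (x : 'rV[Zp]_n) : 'rV[Qp]_n := map_mx (@zemb p p_pr) x.

Lemma zvE n (x : 'rV[Zp]_n) i : zv x 0 i = zemb (x 0 i).
Proof. by rewrite mxE. Qed.

Definition zmon (I : mi) (x : 'rV[Zp]_k) : Qp := monomial I (zv x).

Definition addm (I J : mi) : mi := [ffun i => (I i + J i)%N].
Definition subm (I J : mi) : mi := [ffun i => (I i - J i)%N].
Definition zerom : mi := [ffun => 0%N].
Definition unitm (i : 'I_k) : mi := [ffun j => (j == i) : nat].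
Definition degm (I : mi) : nat := (\sum_i I i)%N.

Lemma addm_inj I : injective (addm I).
Proof.
move=> J K /ffunP E; apply/ffunP => i; have := E i.
by rewrite !ffunE => /addnI.
Qed.

Lemma addmK I J : subm (addm I J) I = J.
Proof. by apply/ffunP => i; rewrite !ffunE addKn. Qed.

Lemma submKC (I J : mi) : (forall i, (I i <= J i)%N) -> addm I (subm J I) = J.
Proof. by move=> H; apply/ffunP => i; rewrite !ffunE subnKC. Qed.

Lemma zmonD I J x : zmon (addm I J) x = zmon I x * zmon J x.
Proof.
rewrite /zmon /monomial -big_split /=; apply: eq_bigr => i _.
by rewrite ffunE exprD.
Qed.

Lemma zmon0 x : zmon zerom x = 1.
Proof. by rewrite /zmon /monomial big1 // => i _; rewrite ffunE expr0. Qed.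

Lemma zmon1 i x : zmon (unitm i) x = zemb (x 0 i).
Proof.
rewrite /zmon /monomial (bigD1 i) //= ffunE eqxx expr1 zvE big1 ?mulr1 //.
by move=> j /negPf ji; rewrite ffunE ji expr0.
Qed.

Lemma zmon_le1 I x : nm (zmon I x) <= 1.
Proof.
rewrite /zmon /monomial; elim/big_ind: _ => [|a b a1 b1|i _].
- by rewrite nm1.
- by rewrite nmM mulr_ile1 ?nm_ge0.
- by rewrite nmX exprn_ile1 ?nm_ge0 // zvE nm_zemb_le1.
Qed.

Lemma zmon_lip I (x y : 'rV[Zp]_k) e : 0 <= e ->
  (forall i, nm (zemb (x 0 i) - zemb (y 0 i)) <= e) ->
  nm (zmon I x - zmon I y) <= e.
Proof.
move=> e0 xy.
suff : [/\ nm (zmon I x) <= 1, nm (zmon I y) <= 1 & nm (zmon I x - zmon I y) <= e] by case.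
(* The three estimates are carried together, because the Lipschitz bound for a product uses that the
   factors have norm at most one. *)
have mulP (a b a' b' : Qp) : [/\ nm a <= 1, nm b <= 1 & nm (a - b) <= e] ->
    [/\ nm a' <= 1, nm b' <= 1 & nm (a' - b') <= e] ->
    [/\ nm (a * a') <= 1, nm (b * b') <= 1 & nm (a * a' - b * b') <= e].
  move=> [a1 b1 ab] [a1' b1' ab']; split.
  - by rewrite nmM mulr_ile1 ?nm_ge0.
  - by rewrite nmM mulr_ile1 ?nm_ge0.
  have -> : a * a' - b * b' = a * (a' - b') + (a - b) * b' by ring.
  apply: nmD_le; rewrite nmM.
    by rewrite -[e]mul1r ler_pM ?nm_ge0.
  by rewrite -[e]mulr1 ler_pM ?nm_ge0.
rewrite /zmon /monomial; apply: (big_ind2 (fun a b => [/\ nm a <= 1, nm b <= 1 & nm (a - b) <= e])).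
- by rewrite nm1 subrr nm0.
- by move=> a b a' b' H1 H2; apply: mulP.
move=> i _; rewrite !zvE; elim: (I i) => [|n IH].
  by rewrite !expr0 nm1 subrr nm0.
by rewrite !exprS; apply: mulP => //; rewrite !nm_zemb_le1.
Qed.

(** Null coefficients are exactly what convergence on all of [Zp^k] requires: at the point
    [(1, ..., 1)] every monomial equals one. *)
Definition tser (c : mi -> Qp) (f : 'rV[Zp]_k -> Qp) : Prop :=
  null c /\ forall x, hsum (fun I => c I * zmon I x) (f x).

Lemma nm_cmon c I x : nm (c I * zmon I x) <= nm (c I).
Proof. by rewrite nmM ler_piMr ?nm_ge0 // zmon_le1. Qed.

Lemma tser_ex c : null c -> exists f, tser c f.
Proof.
move=> nc.
have H x : exists s, hsum (fun I => c I * zmon I x) s.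
  by apply: hsum_ex; apply: null_le nc => I; apply: nm_cmon.
by exists (fun x => sval (cid (H x))); split=> // x; case: cid.
Qed.

Lemma tser_fun c f g : tser c f -> tser c g -> f = g.
Proof.
by move=> [_ cf] [_ cg]; apply/funext => x; apply: hsum_unique (cf x) (cg x).
Qed.

Lemma tserD c d f g : tser c f -> tser d g ->
  tser (fun I => c I + d I) (fun x => f x + g x).
Proof.
move=> [nc cf] [nd dg]; split; first exact: nullD.
by move=> x; apply: eq_hsum (hsumD (cf x) (dg x)) => I; rewrite mulrDl.
Qed.

Lemma tserZ a c f : tser c f -> tser (fun I => a * c I) (fun x => a * f x).
Proof.
move=> [nc cf]; split; first by have [s /(hsumZ a)/hsum_null] := hsum_ex nc.
by move=> x; apply: eq_hsum (hsumZ a (cf x)) => I; rewrite mulrA.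
Qed.

Lemma tser_const a : tser (fun I => if I == zerom then a else 0) (fun=> a).
Proof.
have H (c : mi -> Qp) : (forall I, I != zerom -> c I = 0) -> hsum c (c zerom) by apply: hsum1.
split; first by apply: (hsum_null (H _ _)) => I /negPf ->.
move=> x; have := H (fun I => (if I == zerom then a else 0) * zmon I x).
by rewrite eqxx zmon0 mulr1; apply=> I /negPf ->; rewrite mul0r.
Qed.

Definition shiftc (I : mi) (c : mi -> Qp) (K : mi) : Qp :=
  if [forall i, I i <= K i]%N then c (subm K I) else 0.

Lemma shiftc_addm I c J : shiftc I c (addm I J) = c J.
Proof.
rewrite /shiftc addmK; case: forallP => // -[] i.
by rewrite ffunE leq_addr.
Qed.

Lemma shiftc_out I c K : (forall J, K <> addm I J) -> shiftc I c K = 0.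
Proof.
move=> H; rewrite /shiftc; case: forallP => // /submKC E.
by case: (H (subm K I)).
Qed.

Lemma nm_shiftc I c B : 0 <= B -> (forall J, nm (c J) <= B) ->
  forall K, nm (shiftc I c K) <= B.
Proof. by move=> B0 cB K; rewrite /shiftc; case: ifP => _ //; rewrite nm0. Qed.

Lemma tser_shift I c f : tser c f -> tser (shiftc I c) (fun x => zmon I x * f x).
Proof.
move=> [nc cf].
have H (c' : mi -> Qp) s : (forall K, (forall J, K <> addm I J) -> c' K = 0) ->
    hsum (fun J => c' (addm I J)) s -> hsum c' s.
  by move=> ?; apply: hsum_reindex => //; apply: addm_inj.
split.
  have [s cs] := hsum_ex nc; apply: (@hsum_null _ _ _ _ s); apply: H.
    exact: shiftc_out.
  by apply: eq_hsum cs => J; rewrite shiftc_addm.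
move=> x; apply: H => [K /shiftc_out ->|]; first by rewrite mul0r.
apply: eq_hsum (hsumZ (zmon I x) (cf x)) => J.
by rewrite shiftc_addm zmonD mulrCA.
Qed.

Lemma tser_sum (A : choiceType) (c : A -> mi -> Qp) (f : A -> 'rV[Zp]_k -> Qp) F :
  null2 c -> (forall a, tser (c a) (f a)) -> (forall x, hsum (f^~ x) (F x)) ->
  exists d, (forall I, hsum (c^~ I) (d I)) /\ tser d F.
Proof.
move=> nc cf fF; have [r [d [s [cr cd rs ds]]]] := hsum_fubini_ex nc.
exists d; split=> //; split; first exact: hsum_null ds.
move=> x; apply: (hsum_fubini (c := fun a I => c a I * zmon I x) _ _ _ (fF x)).
- move=> e e0; have [X [Y H]] := nc e e0; exists X, Y => a I aI.
  exact: le_trans (nm_cmon _ _ _) (H _ _ aI).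
- by move=> a; apply: (cf a).2.
- move=> I; have -> : d I * zmon I x = zmon I x * d I by rewrite mulrC.
  by apply: eq_hsum (hsumZ _ (cd I)) => a; rewrite mulrC.
Qed.

(** Multiplying by a monomial only shifts coefficients, so the product is a sum over [I] of [c I]
    times a shift of [d], reordered by [tser_sum]. *)
Lemma tserM c d f g B B' : 0 <= B -> 0 <= B' ->
  tser c f -> tser d g -> (forall I, nm (c I) <= B) -> (forall I, nm (d I) <= B') ->
  exists h, tser h (fun x => f x * g x) /\ forall I, nm (h I) <= B * B'.
Proof.
move=> B0 B0' cf dg cB dB.
have [|||h [ch hfg]] := @tser_sum _ (fun I K => c I * shiftc I d K)
    (fun I x => c I * (zmon I x * g x)) (fun x => f x * g x).
- apply: null2I => [I|e e0].
    by have [] := tserZ (c I) (tser_shift I dg).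
  have [B1 [B10 B1e]] : exists B1, 0 < B1 /\ B1 * B' <= e.
    exists (e / (B' + 1)); split; first by rewrite divr_gt0 // ltr_wpDl.
    by rewrite mulrAC ler_pdivrMr ?ltr_wpDl // ler_wpM2l ?(ltW e0) // lerDl.
  have [A tA] := cf.1 _ B10; exists A => I /tA cI K.
  apply: le_trans B1e; rewrite nmM ler_pM ?nm_ge0 //.
  exact: nm_shiftc.
- by move=> I; apply/tserZ/tser_shift.
- move=> x; have -> : f x * g x = g x * f x by rewrite mulrC.
  by apply: eq_hsum (hsumZ (g x) (cf.2 x)) => I /=; ring.
exists h; split=> // K; apply: (hsum_le _ (ch K)); first exact: mulr_ge0.
by move=> I; rewrite nmM ler_pM ?nm_ge0 //; apply: nm_shiftc.
Qed.

Definition stepv (x : 'rV[Zp]_k) (i : 'I_k) (h : Zp) : 'rV[Zp]_k :=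
  x + h *: 'e_i.

Lemma stepvE x i h j : stepv x i h 0 j = x 0 j + h *+ (j == i).
Proof. by rewrite !mxE eqxx /= mulr_natr eq_sym. Qed.

(** Differentiability with a quadratic remainder valid for all steps in [Zp]. It replaces limits by
    estimates, from which uniqueness and the product rule follow; [rep_pderive] links it to
    [pderive]. *)
Definition isD (i : 'I_k) (f : 'rV[Zp]_k -> Qp) x (l : Qp) : Prop :=
  exists2 B : rat, 0 <= B & forall h : Zp,
    nm (f (stepv x i h) - f x - zemb h * l) <= B * nm (zemb h) ^+ 2.

Lemma isD_unique i f x l l' : isD i f x l -> isD i f x l' -> l = l'.
Proof.
move=> [B B0 Hl] [B' B0' Hl']; apply/eqP; rewrite -subr_eq0; apply/eqP/nm_le0 => e e0.
have [n ne] := small_pXM p_pr (Num.max B B') e0.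
pose h : Zp := p%:R ^+ n.
have nh : nm (zemb h) = p%:R ^- n by rewrite /h rmorphXn rmorph_nat nm_pX.
have h0 : 0 < nm (zemb h) by rewrite nh pQ_gt0.
have : nm (zemb h * (l - l')) <= Num.max B B' * nm (zemb h) ^+ 2.
  have -> : zemb h * (l - l') = (f (stepv x i h) - f x - zemb h * l')
     - (f (stepv x i h) - f x - zemb h * l) by ring.
  by apply: nmB_le; [apply: le_trans (Hl' h) _|apply: le_trans (Hl h) _];
    rewrite ler_wpM2r ?exprn_ge0 ?nm_ge0 // le_max lexx ?orbT.
rewrite nmM => H; apply: le_trans ne.
by rewrite -nh -(ler_pM2l h0) mulrCA -expr2.
Qed.

Lemma expD_taylor (R : comPzRingType) (x h : R) n :
  exists g, (x + h) ^+ n = x ^+ n + h * (x ^+ n.-1 *+ n) + h ^+ 2 * g.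
Proof.
elim: n => [|n [g IH]]; first by exists 0; rewrite !expr0 mulr0n !mulr0 !addr0.
exists (x * g + x ^+ n.-1 *+ n + h * g); rewrite exprS IH.
case: n {IH} => [|n] /=; first by rewrite !expr0 expr1 mulr0n; ring.
have -> : x ^+ n.+1 *+ n.+2 = x ^+ n.+1 + x * (x ^+ n *+ n.+1).
  by rewrite mulrS [in X in _ + X]exprS mulrnAr.
by rewrite !exprS; move: (x ^+ n *+ n.+1) (x ^+ n) => a b; ring.
Qed.

Definition dcoef (i : 'I_k) (c : mi -> Qp) (J : mi) : Qp :=
  (J i).+1%:R * c (addm (unitm i) J).

Lemma zmon_step I x i h :
  nm (zmon I (stepv x i h) - zmon I x
      - zemb h * ((I i)%:R * zmon (subm I (unitm i)) x)) <= nm (zemb h) ^+ 2.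
Proof.
rewrite /zmon /monomial (bigD1 i) //= [X in _ - X - _](bigD1 i) //=.
rewrite [X in _ * (_ * X)](bigD1 i) //=.
set P := \prod_(j < k | j != i) zv x 0 j ^+ I j.
have -> : \prod_(j < k | j != i) zv (stepv x i h) 0 j ^+ I j = P.
  by apply: eq_bigr => j /negPf ji; rewrite !zvE stepvE ji addr0.
have -> : \prod_(j < k | j != i) zv x 0 j ^+ (subm I (unitm i)) j = P.
  by apply: eq_bigr => j /negPf ji; rewrite !ffunE ji subn0.
have P1 : nm P <= 1.
  rewrite /P; elim/big_ind: _ => [|a b a1 b1|j _].
  - by rewrite nm1.
  - by rewrite nmM mulr_ile1 ?nm_ge0.
  - by rewrite nmX exprn_ile1 ?nm_ge0 // zvE nm_zemb_le1.
rewrite !ffunE eqxx subn1 !zvE stepvE eqxx mulr1n.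
(* Expanding in [Zp] rather than in [Qp] makes the second order term [g] integral. *)
have [g /(congr1 (@zemb p p_pr))] := expD_taylor (x 0 i) h (I i).
rewrite !rmorphD !rmorphM /= rmorphMn !rmorphXn rmorphD /= => ->.
set a := zemb (x 0 i); set b := zemb h.
have -> : (a ^+ I i + b * (a ^+ (I i).-1 *+ I i) + b ^+ 2 * zemb g) * P
   - a ^+ I i * P - b * ((I i)%:R * (a ^+ (I i).-1 * P)) = b ^+ 2 * (zemb g * P).
  by rewrite -[_ *+ I i]mulr_natr; ring.
rewrite nmM nmX ler_piMr ?exprn_ge0 ?nm_ge0 //.
by rewrite nmM mulr_ile1 ?nm_ge0 // nm_zemb_le1.
Qed.

Lemma unitm_le i (I : mi) : (0 < I i)%N -> forall j, (unitm i j <= I j)%N.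
Proof. by move=> Ii j; rewrite ffunE; case: eqP => // ->. Qed.

Lemma null_dcoef i c : null c -> null (dcoef i c).
Proof.
move=> nc e e0; have [A tA] := nc e e0.
exists [fset subm I (unitm i) | I in A]%fset => J JA.
rewrite /dcoef nmM; apply: (le_trans (y := nm (c (addm (unitm i) J)))).
  by rewrite ler_piMl ?nm_ge0 // nm_nat.
apply: tA; apply: contra JA => JA; apply/imfsetP.
by exists (addm (unitm i) J) => //; rewrite addmK.
Qed.

Lemma tser_D i c f : tser c f ->
  exists g, tser (dcoef i c) g /\ forall x, isD i f x (g x).
Proof.
move=> [nc cf]; have [g [nd dg]] := tser_ex (null_dcoef i nc).
exists g; split=> // x; have [B [B0 cB]] := null_bound nc; exists B => // h.
have gx : hsum (fun I => c I * ((I i)%:R * zmon (subm I (unitm i)) x)) (g x).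
  apply: (@hsum_reindex _ _ _ _ (addm (unitm i))); first exact: addm_inj.
    move=> I HI; case: (posnP (I i)) => [->|/unitm_le/submKC E].
      by rewrite mul0r mulr0.
    by case: (HI (subm I (unitm i))).
  apply: eq_hsum (dg x) => J.
  by rewrite addmK !ffunE eqxx /= add1n /dcoef; ring.
have := hsumD (hsumD (cf (stepv x i h)) (hsumN (cf x))) (hsumN (hsumZ (zemb h) gx)).
move/hsum_le; apply; first by rewrite mulr_ge0 // exprn_ge0 ?nm_ge0.
move=> I /=.
have -> : c I * zmon I (stepv x i h) - c I * zmon I x -
  zemb h * (c I * ((I i)%:R * zmon (subm I (unitm i)) x)) =
  c I * (zmon I (stepv x i h) - zmon I x
      - zemb h * ((I i)%:R * zmon (subm I (unitm i)) x)) by ring.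
by rewrite nmM ler_pM ?nm_ge0 // zmon_step.
Qed.

Lemma zmon_at0 I : I != zerom -> zmon I 0 = 0.
Proof.
move=> I0; have [i Ii] : exists i, I i != 0%N.
  apply/not_existsP => H; case/eqP: I0; apply/ffunP => i; rewrite ffunE.
  by apply/eqP; apply: contra_notT (H i).
rewrite /zmon /monomial (bigD1 i) //= zvE mxE rmorph0 expr0n.
by case: (I i) Ii => //= n _; rewrite mul0r.
Qed.

Lemma tser_at0 c f : tser c f -> f 0 = c zerom.
Proof.
move=> [_ /(_ 0)] cf; apply: hsum_unique cf _.
have := @hsum1 _ p_pr _ (fun I => c I * zmon I 0) zerom.
by rewrite zmon0 mulr1; apply=> I /zmon_at0 ->; rewrite mulr0.
Qed.

(** Identity theorem by induction on the degree: the derivatives of the zero function vanish, and a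
    coefficient of positive degree is, up to a nonzero integer, a coefficient of lower degree of a
    derivative. *)
Lemma tser0_eq0 c : tser c (fun=> 0) -> forall I, c I = 0.
Proof.
move=> c0 I; elim: {I}(degm I) {-2}I (erefl (degm I)) c c0 => [|n IH] I dI c c0.
  suff -> : I = zerom by rewrite -(tser_at0 c0).
  apply/ffunP => i; rewrite ffunE; apply/eqP; rewrite -leqn0 -dI /degm.
  by rewrite (bigD1 i) //= leq_addr.
have [i Ii] : exists i, (0 < I i)%N.
  apply/not_existsP => H; move: dI; rewrite /degm big1 // => i _.
  by apply/eqP; rewrite -leqn0 leqNgt; apply/negP.
have [g [dg gD]] := tser_D i c0.
have g0 : g = (fun=> 0).
  apply/funext => x; apply: isD_unique (gD x) _; exists 0 => // h.
  by rewrite mulr0 !subr0 nm0 mul0r.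
have := IH (subm I (unitm i)) _ _ (eq_ind _ (tser _) dg _ g0).
rewrite /dcoef submKC; last exact: unitm_le.
move=> /(_ _)/eqP; rewrite mulf_eq0 (negPf (nat_neq0 p_pr _)) //= => H.
apply/eqP/H; apply: succn_inj; rewrite -dI /degm [in RHS](bigD1 i) //= (bigD1 i) //=.
rewrite !ffunE eqxx -addSn subn1 prednK //; congr (_ + _)%N.
by apply: eq_bigr => j /negPf ji; rewrite !ffunE ji subn0.
Qed.

Lemma tser_inj c d f : tser c f -> tser d f -> c = d.
Proof.
move=> cf df; apply/funext => I.
have := tserD cf (tserZ (-1) df).
have -> : (fun x => f x + -1 * f x) = (fun=> 0) by apply/funext => x; ring.
by move/tser0_eq0/(_ I)/eqP; rewrite mulN1r subr_eq0 => /eqP.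
Qed.

End Tate.

(** * The Tate algebra: ring structure, derivations, Gauss norm, convergent series *)

Section TateRing.
Variables (p : nat) (p_pr : prime p) (k : nat).
Local Notation Zp := (padic_int p_pr).
Local Notation Qp := (padic p_pr).
Local Notation nm := (@nm p p_pr).
Local Notation mi := {ffun 'I_k -> nat}.

(** Only the existence of coefficients is recorded, so equality is equality of functions; by
    [tser_inj] the choice made in [coef] is forced. *)
Record tate := Tate {
  tfun :> 'rV[Zp]_k -> Qp;
  tateP : exists c, tser c tfun }.

HB.instance Definition _ := gen_eqMixin tate.
HB.instance Definition _ := gen_choiceMixin tate.

Implicit Types f g : tate.

Lemma tfun_inj f g : f =1 g -> f = g.
Proof.
case: f g => [f fP] [g gP] /= /funext fg; subst g.
by congr Tate; apply: Prop_irrelevance.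
Qed.

Definition coef f : mi -> Qp := sval (cid (tateP f)).

Lemma coefP f : tser (coef f) f.
Proof. by rewrite /coef; case: cid. Qed.

Lemma coef_eq f c : tser c f -> coef f = c.
Proof. exact: tser_inj (coefP f). Qed.

Lemma null_coef f : null (coef f).
Proof. by have [] := coefP f. Qed.

Lemma coef_inj f g : coef f = coef g -> f = g.
Proof.
move=> fg; apply: tfun_inj; have := coefP f; rewrite fg => fP x.
by rewrite (tser_fun fP (coefP g)).
Qed.

Lemma tateI (h : 'rV[Zp]_k -> Qp) c : tser c h -> exists f, (f : _ -> _) = h /\ coef f = c.
Proof. by move=> ch; exists (Tate (ex_intro _ c ch)); split=> //; apply: coef_eq. Qed.

Lemma mkT c : null c -> exists f, coef f = c.
Proof. by move=> /tser_ex [h /tateI [f [_ fc]]]; exists f. Qed.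

Lemma tC_subproof a : exists c, tser c (fun _ : 'rV[Zp]_k => a : Qp).
Proof. by exists (fun I => if I == zerom k then a else 0); apply: tser_const. Qed.
Definition tC a := Tate (tC_subproof a).

Lemma tadd_subproof f g : exists c, tser c (fun x => f x + g x).
Proof. by eexists; apply: tserD; apply: coefP. Qed.
Definition tadd f g := Tate (tadd_subproof f g).

Lemma topp_subproof f : exists c, tser c (fun x => - f x).
Proof.
have [c cf] := tateP f; exists (fun I => -1 * c I).
have -> : (fun x => - f x) = (fun x => -1 * f x) by apply/funext => x; rewrite mulN1r.
exact: tserZ.
Qed.
Definition topp f := Tate (topp_subproof f).

Lemma coef_bound f : exists2 B : rat, 0 <= B & forall I, nm (coef f I) <= B.
Proof. by have [B [B0 fB]] := null_bound (null_coef f); exists B. Qed.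

Lemma tmul_subproof f g : exists c, tser c (fun x => f x * g x).
Proof.
have [B B0 fB] := coef_bound f; have [C C0 gC] := coef_bound g.
by have [c [cfg _]] := tserM B0 C0 (coefP f) (coefP g) fB gC; exists c.
Qed.
Definition tmul f g := Tate (tmul_subproof f g).

Lemma taddA : associative tadd.
Proof. by move=> f g h; apply: tfun_inj => x /=; rewrite addrA. Qed.
Lemma taddC : commutative tadd.
Proof. by move=> f g; apply: tfun_inj => x /=; rewrite addrC. Qed.
Lemma tadd0 : left_id (tC 0) tadd.
Proof. by move=> f; apply: tfun_inj => x /=; rewrite add0r. Qed.
Lemma taddN : left_inverse (tC 0) topp tadd.
Proof. by move=> f; apply: tfun_inj => x /=; rewrite addNr. Qed.

HB.instance Definition _ := GRing.isZmodule.Build tate taddA taddC tadd0 taddN.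

Lemma tmulA : associative tmul.
Proof. by move=> f g h; apply: tfun_inj => x /=; rewrite mulrA. Qed.
Lemma tmulC : commutative tmul.
Proof. by move=> f g; apply: tfun_inj => x /=; rewrite mulrC. Qed.
Lemma tmul1 : left_id (tC 1) tmul.
Proof. by move=> f; apply: tfun_inj => x /=; rewrite mul1r. Qed.
Lemma tmulDl : left_distributive tmul tadd.
Proof. by move=> f g h; apply: tfun_inj => x /=; rewrite mulrDl. Qed.
Lemma tone_neq0 : tC 1 != 0.
Proof.
apply/eqP => /(congr1 (fun f : tate => f 0)) /= /eqP.
by rewrite oner_eq0.
Qed.

HB.instance Definition _ :=
  GRing.Zmodule_isComNzRing.Build tate tmulA tmulC tmul1 tmulDl tone_neq0.

Lemma tfunD f g x : (f + g) x = f x + g x. Proof. by []. Qed.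
Lemma tfunN f x : (- f) x = - f x. Proof. by []. Qed.
Lemma tfunB f g x : (f - g) x = f x - g x. Proof. by []. Qed.
Lemma tfunM f g x : (f * g) x = f x * g x. Proof. by []. Qed.
Lemma tfunC a x : tC a x = a. Proof. by []. Qed.

Definition ev x (f : tate) : Qp := f x.
Lemma ev_zmod x : zmod_morphism (ev x). Proof. by []. Qed.
Lemma ev_monoid x : monoid_morphism (ev x). Proof. by []. Qed.
HB.instance Definition _ x := GRing.isZmodMorphism.Build tate Qp (ev x) (ev_zmod x).
HB.instance Definition _ x := GRing.isMonoidMorphism.Build tate Qp (ev x) (ev_monoid x).

Lemma tC_zmod : zmod_morphism tC.
Proof. by move=> a b; apply: tfun_inj. Qed.
Lemma tC_monoid : monoid_morphism tC.
Proof. by split=> // a b; apply: tfun_inj. Qed.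
HB.instance Definition _ := GRing.isZmodMorphism.Build Qp tate tC tC_zmod.
HB.instance Definition _ := GRing.isMonoidMorphism.Build Qp tate tC tC_monoid.

Lemma tfun_sum (J : Type) (r : seq J) (P : pred J) (F : J -> tate) x :
  (\sum_(j <- r | P j) F j) x = \sum_(j <- r | P j) F j x.
Proof. exact: (raddf_sum (ev x)). Qed.

Lemma tfun_prod (J : Type) (r : seq J) (P : pred J) (F : J -> tate) x :
  (\prod_(j <- r | P j) F j) x = \prod_(j <- r | P j) F j x.
Proof. exact: (rmorph_prod (ev x)). Qed.

Lemma tfunX f n x : (f ^+ n) x = f x ^+ n.
Proof. exact: (rmorphXn (ev x)). Qed.

Lemma tcoefD f g I : coef (f + g) I = coef f I + coef g I.
Proof. by rewrite (@coef_eq (f + g) _ (tserD (coefP f) (coefP g))). Qed.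

Lemma tcoefC a I : coef (tC a) I = if I == zerom k then a else 0.
Proof. by rewrite (@coef_eq (tC a) _ (tser_const k a)). Qed.

Lemma tcoefZ a f I : coef (tC a * f) I = a * coef f I.
Proof. by rewrite (@coef_eq (tC a * f) _ (tserZ a (coefP f))). Qed.

Lemma tcoefN f I : coef (- f) I = - coef f I.
Proof.
have -> : - f = tC (-1) * f by rewrite rmorphN1 mulN1r.
by rewrite tcoefZ mulN1r.
Qed.

Lemma coef_zmod I : zmod_morphism (coef^~ I).
Proof. by move=> f g; rewrite tcoefD tcoefN. Qed.

Lemma tcoefB f g I : coef (f - g) I = coef f I - coef g I.
Proof. exact: coef_zmod. Qed.

Lemma tcoef0 I : coef 0 I = 0.
Proof. by have := tcoefC 0 I; rewrite if_same. Qed.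

Lemma tcoef_sum (J : Type) (r : seq J) (P : pred J) (F : J -> tate) I :
  coef (\sum_(j <- r | P j) F j) I = \sum_(j <- r | P j) coef (F j) I.
Proof.
by elim/big_rec2: _ => [|j a b _ <-]; rewrite ?tcoef0 // tcoefD.
Qed.

Lemma coef_shift (I : mi) f (h : tate) : (forall x, h x = zmon I x) -> coef (h * f) = shiftc I (coef f).
Proof.
move=> hI; apply: coef_eq; have := tser_shift I (coefP f).
by congr tser; apply/funext => x; rewrite -hI.
Qed.

Lemma tX_subproof i : exists c, tser c (fun x : 'rV[Zp]_k => zemb (x 0 i)).
Proof.
have := tser_shift (unitm i) (coefP 1) => H; eexists.
have <- : (fun x : 'rV[Zp]_k => zmon (unitm i) x * (1 : tate) x) = (fun x => zemb (x 0 i)).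
  by apply/funext => x; rewrite zmon1 mulr1.
exact: H.
Qed.
Definition tX i := Tate (tX_subproof i).

Lemma tfunX1 i x : tX i x = zemb (x 0 i). Proof. by []. Qed.

Lemma tcoefXM i f I :
  coef (tX i * f) I = if (0 < I i)%N then coef f (subm I (unitm i)) else 0.
Proof.
rewrite (@coef_shift (unitm i)) /shiftc; last by move=> x; rewrite zmon1.
case: (posnP (I i)) => [Ii|/unitm_le Ii].
  by case: forallP => // /(_ i); rewrite ffunE eqxx Ii.
by case: forallP.
Qed.

Lemma td_subproof i f : exists g : tate,
  (forall x, isD i f x (g x)) /\ coef g = dcoef i (coef f).
Proof.
have [h [/tateI [g [<- gc]] fD]] := tser_D i (coefP f).
by exists g.
Qed.

Definition td i f : tate := sval (cid (td_subproof i f)).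

Lemma tdP i f x : isD i f x (td i f x).
Proof. by rewrite /td; case: cid => g /= []. Qed.

Lemma coef_td i f : coef (td i f) = dcoef i (coef f).
Proof. by rewrite /td; case: cid => g /= []. Qed.

Lemma td_unique i f g : (forall x, isD i f x (g x)) -> td i f = g.
Proof. by move=> fg; apply: tfun_inj => x; apply: isD_unique (tdP i f x) (fg x). Qed.

Lemma tdD i f g : td i (f + g) = td i f + td i g.
Proof.
apply: coef_inj; apply/funext => I.
by rewrite tcoefD !coef_td /dcoef tcoefD mulrDr.
Qed.

Lemma tdZ i a f : td i (tC a * f) = tC a * td i f.
Proof.
apply: coef_inj; apply/funext => I.
by rewrite tcoefZ !coef_td /dcoef tcoefZ mulrCA.
Qed.

Lemma td_zmod i : zmod_morphism (td i).
Proof.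
move=> f g; rewrite tdD; congr (_ + _).
by rewrite -[- g]mulN1r -[- td i g]mulN1r -(rmorphN1 tC) tdZ.
Qed.
HB.instance Definition _ i := GRing.isZmodMorphism.Build tate tate (td i) (td_zmod i).

Lemma tdC i a : td i (tC a) = 0.
Proof.
by apply: td_unique => x; exists 0 => // h; rewrite subrr mulr0 subr0 nm0 mul0r.
Qed.

Lemma tdX i j : td i (tX j) = (j == i)%:R.
Proof.
apply: td_unique => x; exists 0 => // h.
rewrite !tfunX1 stepvE rmorphD rmorphMn /= [X in X - _]addrAC subrr add0r.
suff -> : ((j == i)%:R : tate) x = (j == i)%:R by rewrite mulr_natr subrr nm0 mul0r.
by case: eqP.
Qed.

(** A bound on the Gauss norm, which is submultiplicative and not increased by [td], integers having
    norm at most one. Values on [Zp^k] do not control it: those of [x^p - x] are all divisible by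
    [p]. *)
Definition tbound f (B : rat) := forall I, nm (coef f I) <= B.

Lemma tfun_le f B x : 0 <= B -> tbound f B -> nm (f x) <= B.
Proof.
move=> B0 fB; apply: (hsum_le B0 ((coefP f).2 x)) => I.
exact: le_trans (nm_cmon _ _ _) (fB I).
Qed.

Lemma tfun_lip f B (x y : 'rV[Zp]_k) e : 0 <= B -> 0 <= e -> tbound f B ->
  (forall i, nm (zemb (x 0 i) - zemb (y 0 i)) <= e) -> nm (f x - f y) <= B * e.
Proof.
move=> B0 e0 fB xy.
have := hsumD ((coefP f).2 x) (hsumN ((coefP f).2 y)); move/hsum_le; apply.
  exact: mulr_ge0.
move=> I; rewrite -mulrBr nmM ler_pM ?nm_ge0 //.
exact: zmon_lip.
Qed.

Lemma tboundM f g B C : 0 <= B -> 0 <= C -> tbound f B -> tbound g C ->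
  tbound (f * g) (B * C).
Proof.
move=> B0 C0 fB gC.
have [c [cfg cB]] := tserM B0 C0 (coefP f) (coefP g) fB gC.
by move=> I; rewrite (@coef_eq (f * g) _ cfg).
Qed.

Lemma tboundD f g B : tbound f B -> tbound g B -> tbound (f + g) B.
Proof. by move=> fB gB I; rewrite tcoefD nmD_le. Qed.

Lemma tboundN f B : tbound f B -> tbound (- f) B.
Proof. by move=> fB I; rewrite tcoefN nmN. Qed.

Lemma tboundC a B : nm a <= B -> 0 <= B -> tbound (tC a) B.
Proof. by move=> aB B0 I; rewrite tcoefC; case: ifP => _; rewrite ?nm0. Qed.

Lemma tbound_le f B C : B <= C -> tbound f B -> tbound f C.
Proof. by move=> BC fB I; apply: le_trans (fB I) BC. Qed.

Lemma tbound0 B : 0 <= B -> tbound 0 B.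
Proof. by move=> B0 I; rewrite tcoef0 nm0. Qed.

Lemma tbound_sum (J : Type) (r : seq J) (P : pred J) (F : J -> tate) B : 0 <= B ->
  (forall j, P j -> tbound (F j) B) -> tbound (\sum_(j <- r | P j) F j) B.
Proof.
by move=> B0 FB I; rewrite tcoef_sum; apply: nm_sum_le => // j Pj; apply: FB.
Qed.

Lemma tboundZ a f B : tbound f B -> tbound (tC a * f) (nm a * B).
Proof. by move=> fB I; rewrite tcoefZ nmM ler_wpM2l ?nm_ge0. Qed.

Lemma tbound1 : tbound 1 1.
Proof. by have := @tboundC 1 1; rewrite nm1 rmorph1; apply. Qed.

Lemma tboundM1 f g : tbound f 1 -> tbound g 1 -> tbound (f * g) 1.
Proof. by move=> f1 g1; rewrite -[1 : rat]mulr1; apply: tboundM. Qed.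

Lemma tboundXn f n : tbound f 1 -> tbound (f ^+ n) 1.
Proof.
move=> f1; elim: n => [|n IH]; first exact: tbound1.
by rewrite exprS; apply: tboundM1.
Qed.

Lemma tboundX i : tbound (tX i) 1.
Proof.
move=> I; rewrite -[tX i]mulr1 tcoefXM; case: ifP => _; last by rewrite nm0.
by rewrite -(rmorph1 tC) tcoefC; case: ifP => _; rewrite ?nm1 ?nm0.
Qed.

Lemma tbound_td i f B : tbound f B -> tbound (td i f) B.
Proof.
move=> fB I; rewrite coef_td /dcoef nmM; apply: le_trans (fB (addm (unitm i) I)).
by rewrite ler_piMl ?nm_ge0 ?nm_nat.
Qed.

Lemma tboundE f : exists2 B, 0 <= B & tbound f B.
Proof. exact: coef_bound. Qed.

Lemma isDM i f g x a b :
  isD i f x a -> isD i g x b -> isD i (f * g) x (a * g x + f x * b).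
Proof.
move=> [B B0 fB] [C C0 gC].
have [Bf Bf0 /(tfun_le x Bf0) fx] := tboundE f.
have [Bg Bg0 gb] := tboundE g.
have D0 : 0 <= nm a * Bg by rewrite mulr_ge0 ?nm_ge0.
have D1 : 0 <= Bf * C by rewrite mulr_ge0.
have D2 : 0 <= B * Bg by rewrite mulr_ge0.
exists (nm a * Bg + Bf * C + B * Bg) => [|h]; first by rewrite !addr_ge0.
set y := stepv x i h; set z := zemb h.
have gy := tfun_le y Bg0 gb.
have z0 := nm_ge0 z; have z20 : 0 <= nm z ^+ 2 by rewrite exprn_ge0.
(* The error is split into the two given remainders and a product of first order terms, which is
   quadratic because [g] is Lipschitz. *)
have -> : (f * g) y - (f * g) x - z * (a * g x + f x * b) =
  z * a * (g y - g x) + f x * (g y - g x - z * b) + (f y - f x - z * a) * g y.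
  by rewrite !tfunM; ring.
apply: nmD_le; [apply: nmD_le|].
- rewrite (nmM (z * a)) (nmM z); have gyx : nm (g y - g x) <= Bg * nm z.
    apply: tfun_lip => // j; rewrite /y stepvE rmorphD addrC addKr rmorphMn.
    by case: eqP => _; rewrite ?mulr1n // mulr0n nm0.
  apply: (le_trans (y := nm a * Bg * nm z ^+ 2)).
    rewrite mulrAC [leRHS](_ : _ = nm z * (Bg * nm z) * nm a); last by ring.
    by rewrite ler_wpM2r ?nm_ge0 // ler_wpM2l.
  by rewrite ler_wpM2r // -addrA lerDl addr_ge0.
- rewrite (nmM (f x)); apply: le_trans (ler_pM (nm_ge0 _) (nm_ge0 _) fx (gC h)) _.
  by rewrite mulrA ler_wpM2r // addrAC lerDr addr_ge0.
- rewrite (nmM _ (g y)); apply: le_trans (ler_pM (nm_ge0 _) (nm_ge0 _) (fB h) gy) _.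
  by rewrite mulrAC ler_wpM2r // lerDr addr_ge0.
Qed.

Lemma tdM i f g : td i (f * g) = td i f * g + f * td i g.
Proof. by apply: td_unique => x; apply: isDM; apply: tdP. Qed.

Lemma td_comm i j f : td i (td j f) = td j (td i f).
Proof.
apply: coef_inj; apply/funext => I; rewrite !coef_td /dcoef !ffunE.
have -> : addm (unitm j) (addm (unitm i) I) = addm (unitm i) (addm (unitm j) I).
  by apply/ffunP => l; rewrite !ffunE addnCA.
by case: (eqVneq i j) => [->|ij] //; rewrite !add0n mulrCA.
Qed.

(** Convergence in Gauss norm together with the pointwise sum: the former is what lets [td] pass
    through the sum. *)
Definition Tsum (A : choiceType) (f : A -> tate) (F : tate) : Prop :=
  (forall e, 0 < e -> exists X : {fset A}, forall a, a \notin X -> tbound (f a) e) /\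
  forall x, hsum (fun a => f a x) (F x).

Lemma Tnull2 (A : choiceType) (f : A -> tate) :
  (forall e, 0 < e -> exists X : {fset A}, forall a, a \notin X -> tbound (f a) e) ->
  null2 (fun a => coef (f a)).
Proof.
by move=> H; apply: null2I => [a|e e0]; [exact: null_coef|exact: H].
Qed.

Lemma Tsum_ex (A : choiceType) (f : A -> tate) :
  (forall e, 0 < e -> exists X : {fset A}, forall a, a \notin X -> tbound (f a) e) ->
  exists F, Tsum f F.
Proof.
move=> H; have n2 := Tnull2 H.
have K x : exists s, hsum (fun a => f a x) s.
  apply: hsum_ex => e e0; have [X HX] := H e e0; exists X => a /HX fa.
  exact: tfun_le (ltW e0) fa.
have [d [_ dF]] := @tser_sum _ _ _ _ _ _ (fun x => sval (cid (K x))) n2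
   (fun a => coefP (f a)) (fun x => svalP (cid (K x))).
have [F [FE _]] := tateI dF; exists F; split=> // x; rewrite FE.
exact: svalP.
Qed.

Lemma Tsum_coef (A : choiceType) (f : A -> tate) F : Tsum f F ->
  forall I, hsum (fun a => coef (f a) I) (coef F I).
Proof.
move=> [H fF] I.
have [d [cd dF]] := tser_sum (Tnull2 H) (fun a => coefP (f a)) fF.
by rewrite (coef_eq dF); apply: cd.
Qed.

Lemma Tsum_bound (A : choiceType) (f : A -> tate) F B : 0 <= B ->
  Tsum f F -> (forall a, tbound (f a) B) -> tbound F B.
Proof. by move=> B0 /Tsum_coef fF fB I; apply: hsum_le (fF I) _ => // a; apply: fB. Qed.

Lemma Tsum_td (A : choiceType) (f : A -> tate) F i : Tsum f F ->
  Tsum (fun a => td i (f a)) (td i F).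
Proof.
move=> fF; have [H _] := fF.
have H' : forall e, 0 < e -> exists X : {fset A}, forall a, a \notin X -> tbound (td i (f a)) e.
  by move=> e /H[X HX]; exists X => a /HX; apply: tbound_td.
have [G G_sum] := Tsum_ex H'; suff -> : td i F = G by [].
apply: coef_inj; apply/funext => I; apply: hsum_unique _ (Tsum_coef G_sum I).
rewrite coef_td; apply: eq_hsum (hsumZ _ (Tsum_coef fF _)) => a.
by rewrite coef_td.
Qed.

Lemma TsumM (A : choiceType) (f : A -> tate) F g : Tsum f F ->
  Tsum (fun a => g * f a) (g * F).
Proof.
move=> [H fF]; split; last by move=> x; apply: hsumZ (fF x).
move=> e e0; have [B B0 gB] := tboundE g.
have e1 : 0 < e / (B + 1) by rewrite divr_gt0 // ltr_wpDl.
have [X HX] := H _ e1; exists X => a /HX fa.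
apply: tbound_le (tboundM B0 (ltW e1) gB fa).
by rewrite mulrA ler_pdivrMr ?ltr_wpDl // mulrC ler_wpM2l ?(ltW e0) // lerDl.
Qed.

Lemma TsumD (A : choiceType) (f g : A -> tate) F G : Tsum f F -> Tsum g G ->
  Tsum (fun a => f a + g a) (F + G).
Proof.
move=> [H fF] [H' gG]; split; last by move=> x; apply: hsumD.
move=> e e0; have [X HX] := H e e0; have [Y HY] := H' e e0.
exists (X `|` Y)%fset => a; rewrite inE negb_or => /andP[/HX fa /HY ga].
exact: tboundD.
Qed.

Lemma Tsum0 (A : choiceType) : Tsum (fun _ : A => 0) 0.
Proof.
split=> [e e0|x]; last exact: hsum0.
by exists fset0 => a _; apply: tbound0; apply: ltW.
Qed.

Lemma Tsum_sum (A : choiceType) (J : Type) (r : seq J) (f : J -> A -> tate) F :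
  (forall j, Tsum (f j) (F j)) ->
  Tsum (fun a => \sum_(j <- r) f j a) (\sum_(j <- r) F j).
Proof.
move=> fF; elim: r => [|j r IH].
  rewrite big_nil; have -> : (fun a => \sum_(j <- [::]) f j a) = (fun=> 0).
    by apply/funext => a; rewrite big_nil.
  exact: Tsum0.
rewrite big_cons; have -> : (fun a => \sum_(l <- j :: r) f l a) =
   (fun a => f j a + \sum_(l <- r) f l a) by apply/funext => a; rewrite big_cons.
exact: TsumD.
Qed.

End TateRing.

(** * Composition and rescaling *)

Section Composition.
Variables (p : nat) (p_pr : prime p).
Local Notation Zp := (padic_int p_pr).
Local Notation Qp := (padic p_pr).
Local Notation nm := (@nm p p_pr).
Local Notation tate := (tate p_pr).

(** The default [0] is never met in [tpt h] when the components of [h] satisfy [tbound _ 1]. *)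
Definition zint (q : Qp) : Zp :=
  if pselect (exists z, q = zemb z) is left h then sval (cid h) else 0.

Lemma zintK q : nm q <= 1 -> zemb (zint q) = q.
Proof.
by move=> /zembP h; rewrite /zint; case: pselect => // {}h; case: cid.
Qed.

Definition tpt k l (h : 'I_l -> tate k) (x : 'rV[Zp]_k) : 'rV[Zp]_l :=
  \row_i zint (h i x).

Lemma tptE k l (h : 'I_l -> tate k) x i :
  (forall i, tbound (h i) 1) -> zemb (tpt h x 0 i) = h i x.
Proof. by move=> h1; rewrite mxE zintK // (tfun_le x ler01 (h1 i)). Qed.

Lemma zv_inj n : injective (@zv p p_pr n).
Proof.
move=> x y xy; apply/rowP => i; apply: (@zemb_inj p p_pr).
by rewrite -!zvE xy.
Qed.

Definition tmon k l (h : 'I_l -> tate k) (I : {ffun 'I_l -> nat}) : tate k :=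
  \prod_i h i ^+ I i.

Lemma tbound_tmon k l (h : 'I_l -> tate k) I :
  (forall i, tbound (h i) 1) -> tbound (tmon h I) 1.
Proof.
move=> h1; rewrite /tmon; elim/big_ind: _ => [|a b a1 b1|i _]; first exact: tbound1.
  exact: tboundM1.
exact: tboundXn.
Qed.

Lemma tmonE k l (h : 'I_l -> tate k) I x : (forall i, tbound (h i) 1) ->
  tmon h I x = zmon I (tpt h x).
Proof.
move=> h1; rewrite tfun_prod /zmon /monomial; apply: eq_bigr => i _.
by rewrite tfunX zvE tptE.
Qed.

(** Substitution as a series of monomials in [h] that converges in Gauss norm: the form of
    composition that can be differentiated termwise. *)
Lemma Tsum_tmon k l (h : 'I_l -> tate k) (f : tate l) (F : tate k) :
  (forall i, tbound (h i) 1) -> (forall x, F x = f (tpt h x)) ->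
  Tsum (fun I => tC k (coef f I) * tmon h I) F.
Proof.
move=> h1 FE; split=> [e e0|x].
  have [X HX] := null_coef f e0; exists X => I /HX cI.
  by apply: tbound_le (tboundZ _ (tbound_tmon I h1)); rewrite mulr1.
by rewrite FE; apply: eq_hsum ((coefP f).2 (tpt h x)) => I; rewrite tfunM tmonE.
Qed.

Lemma Tsum_tmonX k (f : tate k) :
  Tsum (fun I => tC k (coef f I) * tmon (tX p_pr (k := k)) I) f.
Proof.
have X1 i : tbound (tX p_pr (k := k) i) 1 by apply: tboundX.
apply: Tsum_tmon => // x; congr (tfun f _); apply/rowP => i.
by apply: (@zemb_inj p p_pr); rewrite tptE.
Qed.

Lemma tcomp_ex k l (h : 'I_l -> tate k) (f : tate l) :
  (forall i, tbound (h i) 1) ->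
  exists F : tate k, (forall x, F x = f (tpt h x)) /\
    forall B, 0 <= B -> tbound f B -> tbound F B.
Proof.
move=> h1.
have cP I B : nm (coef f I) <= B -> tbound (tC k (coef f I) * tmon h I) B.
  by move=> fB; apply: tbound_le (tboundZ _ (tbound_tmon I h1)); rewrite mulr1.
have [|F FS] := @Tsum_ex p p_pr k _ (fun I => tC k (coef f I) * tmon h I).
  move=> e e0; have [X HX] := null_coef f e0.
  by exists X => I /HX; apply: cP.
exists F; split=> [x|B B0 fB].
  apply: hsum_unique (FS.2 x) _; apply: eq_hsum ((coefP f).2 (tpt h x)) => I.
  by rewrite tfunM tfunC tmonE.
by apply: Tsum_bound FS _ => // I; apply: cP.
Qed.

Definition tcomp k l (h : 'I_l -> tate k) (f : tate l) : tate k :=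
  if pselect (exists F : tate k, forall x, F x = f (tpt h x)) is left e
  then sval (cid e) else 0.

Lemma tcompE k l (h : 'I_l -> tate k) (f : tate l) x :
  (forall i, tbound (h i) 1) -> tcomp h f x = f (tpt h x).
Proof.
move=> h1; rewrite /tcomp; case: pselect => [e|[]]; first by case: cid.
by have [F [FE _]] := tcomp_ex f h1; exists F.
Qed.

Lemma tbound_tcomp k l (h : 'I_l -> tate k) (f : tate l) B :
  (forall i, tbound (h i) 1) -> 0 <= B -> tbound f B -> tbound (tcomp h f) B.
Proof.
move=> h1 B0 fB; have [F [FE FB]] := tcomp_ex f h1.
suff -> : tcomp h f = F by apply: FB.
by apply: tfun_inj => x; rewrite tcompE.
Qed.

Lemma degm_unit k (i : 'I_k) I : degm (addm (unitm i) I) = (degm I).+1.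
Proof.
rewrite /degm (bigD1 i) //= [in RHS](bigD1 i) //= !ffunE eqxx add1n addSn.
by congr (_ + _).+1; apply: eq_bigr => j /negPf ji; rewrite !ffunE ji.
Qed.

Lemma zmon_scale k (a : Zp) I (x : 'rV[Zp]_k) :
  zmon I (a *: x) = zemb a ^+ degm I * zmon I x.
Proof.
rewrite /zmon /monomial /degm -prodrXr -big_split /=; apply: eq_bigr => i _.
by rewrite !zvE mxE rmorphM exprMn.
Qed.

Lemma tscale_ex k N (f : tate k) : exists F : tate k,
  (forall I, coef F I = (p%:R ^+ N) ^+ degm I * coef f I) /\
  forall x, F x = f (p%:R ^+ N *: x).
Proof.
have a1 n : nm ((p%:R ^+ N) ^+ n) <= 1 by rewrite -!natrX nm_nat.
have [|F cF] := @mkT p p_pr k (fun I => (p%:R ^+ N) ^+ degm I * coef f I).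
  by apply: null_le (null_coef f) => I; rewrite nmM ler_piMl ?nm_ge0.
exists F; split=> [I|x]; first by rewrite cF.
apply: hsum_unique ((coefP F).2 x) _.
apply: eq_hsum ((coefP f).2 _) => I.
by rewrite cF zmon_scale rmorphXn rmorph_nat mulrCA mulrA.
Qed.

Definition tscale k N (f : tate k) : tate k := sval (cid (tscale_ex N f)).

Lemma coef_tscale k N (f : tate k) I :
  coef (tscale N f) I = (p%:R ^+ N) ^+ degm I * coef f I.
Proof. by rewrite /tscale; case: cid => F /= []. Qed.

Lemma tscaleE k N (f : tate k) x : tscale N f x = f (p%:R ^+ N *: x).
Proof. by rewrite /tscale; case: cid => F /= []. Qed.

Lemma td_tscale k N (f : tate k) i :
  td i (tscale N f) = tC k (p%:R ^+ N) * tscale N (td i f).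
Proof.
apply: coef_inj; apply/funext => I.
rewrite tcoefZ coef_tscale !coef_td /dcoef coef_tscale degm_unit exprS.
by ring.
Qed.

Lemma tscaleD k N (f g : tate k) : tscale N (f + g) = tscale N f + tscale N g.
Proof. by apply: tfun_inj => x; rewrite tfunD !tscaleE. Qed.

Lemma tscaleN k N (f : tate k) : tscale N (- f) = - tscale N f.
Proof. by apply: tfun_inj => x; rewrite tfunN !tscaleE. Qed.

Lemma tscale_tscale k N N' (f : tate k) : tscale N (tscale N' f) = tscale (N + N') f.
Proof. by apply: tfun_inj => x; rewrite !tscaleE scalerA -exprD addnC. Qed.

Lemma zerom_coef k (f : tate k) : coef f (zerom k) = f 0.
Proof. by rewrite (tser_at0 (coefP f)). Qed.

Lemma degm_eq0 k (I : {ffun 'I_k -> nat}) : degm I = 0%N -> I = zerom k.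
Proof.
move/eqP; rewrite /degm sum_nat_eq0 => /forallP /= H.
by apply/ffunP => i; rewrite ffunE; apply/eqP; apply: H.
Qed.

(** Without the constant term every monomial has positive degree, so shrinking the ball gains at
    least [p ^- N]. The smallness in the Moser argument comes from here. *)
Lemma tscale_small k N (f : tate k) B : tbound f B -> 0 <= B ->
  tbound (tscale N f - tC k (f 0)) (B * p%:R ^- N).
Proof.
move=> fB B0 I; rewrite tcoefB coef_tscale tcoefC.
case: eqVneq => [->|I0].
  rewrite zerom_coef /degm big1 ?expr0 ?mul1r ?subrr ?nm0; last by move=> i _; rewrite ffunE.
  by rewrite mulr_ge0 // ltW // pQ_gt0.
rewrite subr0 nmM mulrC ler_pM ?nm_ge0 // nmX nm_pX.
case E : (degm I) => [|n]; first by rewrite (degm_eq0 E) eqxx in I0.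
have pN : 0 <= (p%:R ^- N : rat) <= 1.
  by rewrite ltW ?pQ_gt0 //=; have := le_pXV p_pr (leq0n N); rewrite expr0 invr1.
case/andP: pN => pN0 pN1.
by rewrite exprS ler_piMr // exprn_ile1.
Qed.

End Composition.

(** Every nonzero term has denominator [n + b + c], the weight under the Euler field of a monomial
    of [y]-degree [n] times [dx_b dx_c], and the numerators [b], [c], [n] add up to it. *)
Lemma weight_sum (F : fieldType) (b c : bool) (n : nat) (u v : F) :
  (forall m, (n + m)%:R != 0 :> F) ->
  b%:R * (u / (n + c.+1)%:R * v) + c%:R * (u / (n + b.+1)%:R * v)
    + n%:R * (u / (n + (b + c))%:R * v) = u * v.
Proof.
move=> cf; have c0 := cf 0%N; have c1 := cf 1%N; have c2 := cf 2%N.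
move: c0 c1 c2; rewrite addn0 !natrD => c0 c1 c2.
by case: b; case: c; rewrite ?addn0 ?natrD /=; field; rewrite ?c0 ?c1 ?c2.
Qed.

(** * The relative Poincare lemma *)

Section Poincare.
Variables (p : nat) (p_pr : prime p) (l : nat) (y : pred 'I_l).
Local Notation Zp := (padic_int p_pr).
Local Notation Qp := (padic p_pr).
Local Notation nm := (@nm p p_pr).
Local Notation tate := (tate p_pr l).
Local Notation mi := {ffun 'I_l -> nat}.

Definition ydeg (I : mi) : nat := (\sum_(i | y i) I i)%N.

Lemma ydeg_le I : (ydeg I <= degm I)%N.
Proof. by rewrite /ydeg /degm [X in (_ <= X)%N](bigID y) /= leq_addr. Qed.

Lemma ydeg_unit b I : ydeg (addm (unitm b) I) = (y b + ydeg I)%N.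
Proof.
rewrite /ydeg (eq_bigr (fun i => ((i == b) + I i)%N)); last first.
  by move=> i _; rewrite !ffunE.
rewrite big_split /=; congr (_ + _)%N.
rewrite big_mkcond /= (bigD1 b) //= eqxx big1 ?addn0; first by case: (y b).
by move=> i /negPf ->; rewrite if_same.
Qed.

(** The norm of [1 / (n + r)] is at most [n + r], while [p ^ d] contributes [p ^- d] with
    [n <= d <= p ^ d]. *)
Lemma nm_lam d n r : (n <= d)%N ->
  nm (p%:R ^+ d / (n + r)%:R) <= r.+1%:R.
Proof.
move=> nd; rewrite nmM nm_pX.
apply: (le_trans (ler_wpM2l _ (nm_natV_le _ _))); first exact/ltW/pQ_gt0.
rewrite mulrC ler_pdivrMr ?exprn_gt0 ?pr_gt0 // -natrX -natrM ler_nat.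
have dp : (d <= p ^ d)%N by apply: ltnW; rewrite ltn_expl // prime_gt1.
have p0 : (0 < p ^ d)%N by rewrite expn_gt0 prime_gt0.
rewrite mulSn leq_add //; first exact: leq_trans nd dp.
by rewrite leq_pmulr.
Qed.

Lemma lam_ex r (f : tate) : exists F : tate,
  forall I, coef F I = p%:R ^+ degm I / (ydeg I + r)%:R * coef f I.
Proof.
have [|F cF] := @mkT p p_pr l (fun I => p%:R ^+ degm I / (ydeg I + r)%:R * coef f I).
  apply: (@nullZ p p_pr _ (coef f) _ r.+1%:R) (null_coef f) => [|I]; last first.
    by rewrite nmM ler_wpM2r ?nm_ge0 // nm_lam // ydeg_le.
  exact: ler0n.
by exists F => I; rewrite cF.
Qed.

(* The homotopy operator [int_0^1 t^(r-1) f(x, t y) dt] followed by a rescaling by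
   [p]: the weights [ydeg I + r] have unbounded inverses, which the factor
   [p ^ degm I] absorbs. *)
Definition lam r f : tate := sval (cid (lam_ex r f)).

Lemma coef_lam r f I : coef (lam r f) I = p%:R ^+ degm I / (ydeg I + r)%:R * coef f I.
Proof. by rewrite /lam; case: cid. Qed.

Lemma lamD r f g : lam r (f + g) = lam r f + lam r g.
Proof.
by apply: coef_inj; apply/funext => I; rewrite tcoefD !coef_lam tcoefD mulrDr.
Qed.

Lemma lamN r f : lam r (- f) = - lam r f.
Proof.
by apply: coef_inj; apply/funext => I; rewrite tcoefN !coef_lam tcoefN mulrN.
Qed.

(** The derivation [td b] reads coefficients one degree higher, which brings a factor [p] and, for a
    [y]-direction, one more unit of weight. *)
Lemma td_lam r (f : tate) b : td b (lam r f) = tC l p%:R * lam (y b + r) (td b f).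
Proof.
apply: coef_inj; apply/funext => I.
rewrite tcoefZ !coef_lam !coef_td /dcoef coef_lam degm_unit ydeg_unit exprS.
by rewrite (addnC (y b)) -addnA; ring.
Qed.

Lemma lam_at0 r (f : tate) : f 0 = 0 -> lam r f 0 = 0.
Proof. by move=> f0; rewrite -zerom_coef coef_lam zerom_coef f0 mulr0. Qed.

(** Setting the [y]-coordinates to zero keeps exactly the coefficients of [y]-degree zero, and the
    identity theorem kills them. Those are the ones whose Euler weight may vanish. *)
Lemma coef_vanish (f : tate) : (forall x : 'rV[Zp]_l, (forall i, y i -> x 0 i = 0) -> f x = 0) ->
  forall I, ydeg I = 0%N -> coef f I = 0.
Proof.
move=> fv.
pose pi (x : 'rV[Zp]_l) : 'rV[Zp]_l := \row_i if y i then 0 else x 0 i.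
have zpi I x : zmon I (pi x) = if ydeg I == 0%N then zmon I x else 0.
  rewrite /zmon /monomial; case: eqP => [/eqP|] yI.
    apply: eq_bigr => i _; rewrite !zvE mxE; case: ifP => // yi.
    by move: yI; rewrite sum_nat_eq0 => /forallP/(_ i)/implyP/(_ yi)/eqP ->; rewrite !expr0.
  have [i yi Ii] : exists2 i, y i & I i != 0%N.
    apply: contra_notP yI => H; apply: big1 => i yi; apply/eqP.
    by apply: contra_notT H => Ii; exists i.
  rewrite (bigD1 i) //= zvE mxE yi rmorph0 expr0n.
  by case: (I i) Ii => //= n _; rewrite mul0r.
have : tser (fun I => if ydeg I == 0%N then coef f I else 0) (fun=> 0).
  split.
    by apply: null_le (null_coef f) => I; case: ifP => _ //; rewrite nm0 nm_ge0.
  move=> x; have := (coefP f).2 (pi x).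
  rewrite fv; last by move=> i yi; rewrite mxE yi.
  apply: eq_hsum => I.
  by rewrite zpi; case: ifP => _; rewrite ?mul0r ?mulr0.
by move=> /tser0_eq0 H I yI; have := H I; rewrite yI eqxx.
Qed.

(* Inverting the Lie derivative along the Euler field of the y-directions:
   [n] is the y-degree and [s] the weight of the differentials. *)
Lemma lam_euler (b c : bool) (f : tate) :
  (forall x : 'rV[Zp]_l, (forall i, y i -> x 0 i = 0) -> f x = 0) ->
  b%:R * lam c.+1 f + c%:R * lam b.+1 f
    + \sum_(a | y a) tX p_pr a * (tC l p%:R * lam (b + c).+1 (td a f)) = tscale 1 f.
Proof.
move=> fv; apply: coef_inj; apply/funext => I.
rewrite 2!tcoefD tcoef_sum coef_tscale expr1.
have natM (d : bool) (g : tate) : coef (d%:R * g) I = d%:R * coef g I.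
  by have -> : d%:R * g = tC l d%:R * g; [rewrite rmorph_nat|rewrite tcoefZ].
rewrite !natM !coef_lam.
have -> : \sum_(a | y a) coef (tX p_pr a * (tC l p%:R * lam (b + c).+1 (td a f))) I
  = (ydeg I)%:R * (p%:R ^+ degm I / (ydeg I + (b + c))%:R * coef f I).
  rewrite /ydeg natr_sum mulr_suml; apply: eq_bigr => a ya; rewrite -/(ydeg I).
  rewrite tcoefXM; case: (posnP (I a)) => [->|Ia]; first by rewrite mul0r.
  have E := submKC (unitm_le Ia).
  rewrite tcoefZ coef_lam coef_td /dcoef E !ffunE eqxx subn1 prednK //.
  rewrite -[in RHS]E degm_unit ydeg_unit ya exprS add1n addSnnS E.
  by ring.
have [y0|y0] := posnP (ydeg I).
  by rewrite (coef_vanish fv y0) !mulr0 !addr0.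
by apply: weight_sum => m; rewrite nat_neq0 // addn_gt0 y0.
Qed.

(** Cartan's formula [d i_E + i_E d = L_E] for the Euler field [E] of the [y]-directions: the
    primitive is the contraction of [eta] with [E], each coefficient divided by its weight, to which
    the differentials contribute; closedness removes [i_E d]. That [g] vanishes at the origin is
    recorded for the size of the Moser field. *)
Lemma poincare (eta : 'I_l -> 'I_l -> tate) :
  (forall b c, eta c b = - eta b c) ->
  (forall a b c, td a (eta b c) + td b (eta c a) + td c (eta a b) = 0) ->
  (forall b c (x : 'rV[Zp]_l), (forall i, y i -> x 0 i = 0) -> eta b c x = 0) ->
  exists g : 'I_l -> 'I_l -> tate, (forall a c, g a c 0 = 0) /\
    forall b c, td b (\sum_(a | y a) tX p_pr a * g a c)
              - td c (\sum_(a | y a) tX p_pr a * g a b) = tscale 1 (eta b c).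
Proof.
move=> asym closed van.
exists (fun a c => lam (y c).+1 (eta a c)); split=> [a c|b c].
  by apply/lam_at0/van => i _; rewrite mxE.
have tdS b' c' : td b' (\sum_(a | y a) tX p_pr a * lam (y c').+1 (eta a c')) =
   (y b')%:R * lam (y c').+1 (eta b' c')
   + \sum_(a | y a) tX p_pr a * (tC l p%:R * lam (y b' + y c').+1 (td b' (eta a c'))).
  rewrite raddf_sum /=.
  under eq_bigr => a _ do rewrite tdM tdX td_lam addnS.
  rewrite big_split /=; congr (_ + _).
  rewrite big_mkcond /= (bigD1 b') //= eqxx big1 ?addr0.
    by case: (y b'); rewrite ?mul1r ?mul0r.
  by move=> a /negPf ->; rewrite mul0r if_same.
rewrite !tdS -(lam_euler (y b) (y c)); last exact: van.
rewrite opprD addrACA -addrA.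
rewrite -[RHS]addrA; congr (_ + _).
rewrite (asym b c) lamN mulrN opprK; congr (_ + _).
rewrite -sumrB; apply: eq_bigr => a _.
rewrite -mulrBr -mulrBr; congr (_ * (_ * _)).
rewrite (addnC (y c)) -lamN -lamD; congr (lam _ _).
have /eqP := closed a b c; rewrite -addrA addr_eq0 => /eqP ->.
rewrite opprD; congr (_ - _); by rewrite -raddfN -asym.
Qed.

End Poincare.

(** * Flows *)

Section ExpSeq.

(* The recursion satisfied by [L^n f / n!], in a form free of division. *)
Definition expseq (V : zmodType) (L : V -> V) (s : nat -> V) : Prop :=
  forall n, s n.+1 *+ n.+1 = L (s n).

(** Leibniz rule for exponential series: the factor [n.+1] is split as [i + (n.+1 - i)], one part
    for each argument of [B]. The pairings used are products of functions, of a jacobian with a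
    matrix, and with a transposed jacobian. *)
Lemma expseq_conv (U V W : zmodType) (L1 : U -> U) (L2 : V -> V)
    (L : W -> W) (B : U -> V -> W) (u : nat -> U) (v : nat -> V) :
  {morph L : x y / x + y} ->
  (forall a, {morph B a : x y / x + y}) ->
  (forall b, {morph B^~ b : x y / x + y}) ->
  (forall a b, L (B a b) = B (L1 a) b + B a (L2 b)) ->
  expseq L1 u -> expseq L2 v ->
  expseq L (fun n => \sum_(i < n.+1) B (u i) (v (n - i)%N)).
Proof.
move=> LD Br Bl LB eu ev n.
have L0 : L 0 = 0 by apply: (addIr (L 0)); rewrite -LD !add0r.
have B0 b : B 0 b = 0 by apply: (addIr (B 0 b)); rewrite -Bl !add0r.
have B0r a : B a 0 = 0 by apply: (addIr (B a 0)); rewrite -Br !add0r.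
have Bmn a b m : B (a *+ m) b = B a b *+ m.
  by elim: m => [|m IH]; rewrite ?mulr0n ?B0 // !mulrS Bl IH.
have Bmr a b m : B a (b *+ m) = B a b *+ m.
  by elim: m => [|m IH]; rewrite ?mulr0n ?B0r // !mulrS Br IH.
rewrite (big_morph L LD L0) (eq_bigr _ (fun i _ => LB _ _)) big_split /=.
rewrite -sumrMnl (eq_bigr (fun i : 'I_n.+2 => B (u i) (v (n.+1 - i)%N) *+ i
    + B (u i) (v (n.+1 - i)%N) *+ (n.+1 - i))); last first.
  by move=> i _; rewrite -mulrnDr subnKC // -ltnS.
rewrite big_split /=; congr (_ + _).
  rewrite big_ord_recl /= mulr0n add0r; apply: eq_bigr => i _.
  by rewrite /bump /= add1n subSS -Bmn eu.
rewrite big_ord_recr /= subnn mulr0n addr0; apply: eq_bigr => i _.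
by rewrite subSn; [rewrite -Bmr ev|rewrite -ltnS].
Qed.

Lemma expseq_unique (V : zmodType) (L : V -> V) u v :
  (forall n (f g : V), f *+ n.+1 = g *+ n.+1 -> f = g) ->
  expseq L u -> expseq L v -> u 0%N = v 0%N -> forall n, u n = v n.
Proof.
by move=> natI eu ev uv; elim=> [//|n IH]; apply: (natI n); rewrite eu ev IH.
Qed.

End ExpSeq.

Section Flow.
Variables (p : nat) (p_pr : prime p) (l : nat).
Local Notation Zp := (padic_int p_pr).
Local Notation Qp := (padic p_pr).
Local Notation nm := (@nm p p_pr).
Local Notation T := (tate p_pr l.+1).
Local Notation tC := (@tC p p_pr l.+1).
Local Notation sp i := (lift ord0 i).

Variable Y : 'I_l -> T.
Hypothesis Y1 : forall i, tbound (Y i) 1.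

(** Coordinate [ord0] is time, so this is the field [d/dt + Y] as a derivation. *)
Definition vf (f : T) : T := td ord0 f + \sum_i Y i * td (sp i) f.

Lemma vf_zmod : zmod_morphism vf.
Proof.
move=> f g; rewrite /vf raddfB opprD addrACA; congr (_ + _).
by rewrite -sumrB; apply: eq_bigr => i _; rewrite raddfB mulrBr.
Qed.
HB.instance Definition _ := GRing.isZmodMorphism.Build T T vf vf_zmod.

Lemma vfM f g : vf (f * g) = vf f * g + f * vf g.
Proof.
rewrite /vf tdM mulrDl mulrDr addrACA; congr (_ + _).
rewrite mulr_suml mulr_sumr -big_split /=; apply: eq_bigr => i _.
by rewrite tdM mulrDr [in LHS]mulrA [in X in _ + X]mulrCA.
Qed.

Lemma vfC a : vf (tC a) = 0.
Proof. by rewrite /vf tdC big1 ?addr0 // => i _; rewrite tdC mulr0. Qed.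

Lemma vfZ a f : vf (tC a * f) = tC a * vf f.
Proof. by rewrite vfM vfC mul0r add0r. Qed.

Lemma vfX0 : vf (tX p_pr ord0) = 1.
Proof.
rewrite /vf tdX big1 ?addr0 //= => i _; rewrite tdX mulr0; exact: erefl.
Qed.

Lemma vfXs i : vf (tX p_pr (sp i)) = Y i.
Proof.
rewrite /vf tdX add0r (bigD1 i) //= tdX eqxx mulr1 big1 ?addr0 // => j ji.
by rewrite tdX (inj_eq (@lift_inj _ ord0)) eq_sym (negPf ji) mulr0.
Qed.

Lemma tbound_vf f B : 0 <= B -> tbound f B -> tbound (vf f) B.
Proof.
move=> B0 fB; apply: tboundD; first exact: tbound_td.
apply: tbound_sum => // i _; rewrite -[B]mul1r.
by apply: tboundM => //; apply: tbound_td.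
Qed.

Lemma Tsum_vf (A : choiceType) (f : A -> T) F : Tsum f F -> Tsum (fun a => vf (f a)) (vf F).
Proof.
move=> fF; apply: TsumD; first exact: Tsum_td.
by apply: Tsum_sum => i; apply/TsumM/Tsum_td.
Qed.

Lemma td_vf i f : td (sp i) (vf f) =
  vf (td (sp i) f) + \sum_j td (sp i) (Y j) * td (sp j) f.
Proof.
rewrite {1}/vf raddfD raddf_sum /= td_comm -addrA; congr (_ + _).
rewrite -big_split /=; apply: eq_bigr => j _.
by rewrite tdM (td_comm (sp i)) addrC.
Qed.

Definition ecf (a : Qp) n : Qp := a ^+ n / n`!%:R.

Lemma ecf0 a : ecf a 0 = 1.
Proof. by rewrite /ecf expr0 fact0 divr1. Qed.

Lemma ecfS a n : ecf a n.+1 *+ n.+1 = a * ecf a n.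
Proof.
have n0 : (n.+1%:R : Qp) != 0 by apply: nat_neq0.
have f0 : (n`!%:R : Qp) != 0 by apply: nat_neq0; apply: fact_gt0.
rewrite /ecf factS natrM exprS -[LHS]mulr_natr.
move: (n.+1%:R) n0 (n`!%:R) f0 => u u0 v v0; rewrite invfM.
transitivity (a * a ^+ n * v^-1 * (u / u)); first by ring.
by rewrite divff // mulr1 mulrA.
Qed.

(** As [Y] has Gauss norm at most one, [vf] does not increase Gauss norms, and this decay alone
    makes the exponential of [a] times [vf] converge. *)
Definition admissible a := forall n, nm (ecf a n) <= p%:R ^- n.

Definition flt a n f : T := tC (ecf a n) * iter n vf f.

Lemma flt0 a f : flt a 0 f = f.
Proof. by rewrite /flt ecf0 rmorph1 mul1r. Qed.

Lemma expseq_flt a f : expseq (fun g => tC a * vf g) (fun n => flt a n f).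
Proof.
move=> n; rewrite /flt vfZ mulrA -rmorphM -ecfS rmorphMn /=.
by rewrite mulrnAl.
Qed.

Lemma tate_natI n (f g : T) : f *+ n.+1 = g *+ n.+1 -> f = g.
Proof.
move=> fg; apply: tfun_inj => x.
have n0 : (n.+1%:R : Qp) != 0 by apply: nat_neq0.
apply: (mulIf n0); rewrite !mulr_natr.
by rewrite -!(raddfMn (ev x)) fg.
Qed.

Lemma tbound_iter f B n : 0 <= B -> tbound f B -> tbound (iter n vf f) B.
Proof. by move=> B0 fB; elim: n => //= n IH; apply: tbound_vf. Qed.

Lemma tbound_flt a f B n : admissible a -> 0 <= B -> tbound f B ->
  tbound (flt a n f) (B * p%:R ^- n).
Proof.
move=> ad B0 fB; apply: tbound_le (tboundZ _ (tbound_iter n B0 fB)).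
by rewrite mulrC ler_wpM2l.
Qed.

Lemma flow_ex a f : exists F, admissible a -> Tsum (fun n => flt a n f) F.
Proof.
have [ad|nad] := pselect (admissible a); last by exists 0 => /nad.
have [B B0 fB] := tboundE f.
have [|F FS] := @Tsum_ex p p_pr l.+1 _ (fun n => flt a n f).
  move=> e e0; have [X HX] := cofinite_geom p_pr B0 e0.
  by exists X => i /HX; move=> iX; apply: tbound_le iX (tbound_flt i ad B0 fB).
by exists F.
Qed.

Definition flow a f : T := sval (cid (flow_ex a f)).

Lemma flowP a f : admissible a -> Tsum (fun n => flt a n f) (flow a f).
Proof. by rewrite /flow; case: cid. Qed.

Lemma flow_at a f x : admissible a -> hsum (fun n => flt a n f x) (flow a f x).
Proof. by move=> /(flowP f)[]. Qed.

Lemma tbound_flow a f B : admissible a -> 0 <= B -> tbound f B -> tbound (flow a f) B.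
Proof.
move=> ad B0 fB; apply: Tsum_bound (flowP f ad) _ => // n.
apply: tbound_le (tbound_flt n ad B0 fB); rewrite ler_piMr //.
by have := le_pXV p_pr (leq0n n); rewrite expr0 invr1.
Qed.

(** Both sides satisfy the exponential recursion of the derivation [a] times [vf] with the same
    first term, and [tate] has no torsion. *)
Lemma fltM a f g n :
  flt a n (f * g) = \sum_(i < n.+1) flt a i f * flt a (n - i)%N g.
Proof.
pose L (h : T) := tC a * vf h.
apply: (@expseq_unique _ L (flt a ^~ (f * g))
  (fun n => \sum_(i < n.+1) flt a i f * flt a (n - i)%N g) tate_natI); first exact: expseq_flt.
  apply: (@expseq_conv T T T L L L (fun u v => u * v) (flt a ^~ f) (flt a ^~ g))
    => [x y|b x y|b x y|x y||].
  - by rewrite /L raddfD mulrDr.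
  - exact: mulrDr.
  - exact: mulrDl.
  - by rewrite /L vfM mulrDr [in LHS]mulrA [in X in _ + X]mulrCA.
  - exact: expseq_flt.
  - exact: expseq_flt.
by rewrite big_ord1 !flt0.
Qed.

Lemma flowM a f g : admissible a -> flow a (f * g) = flow a f * flow a g.
Proof.
move=> ad; apply: tfun_inj => x; apply: hsum_unique (flow_at _ _ ad) _.
apply: eq_hsum (hsum_cauchy (flow_at f x ad) (flow_at g x ad)) => n.
by rewrite fltM tfun_sum.
Qed.

Lemma iter_vf0 n : iter n vf 0 = 0.
Proof. by elim: n => //= n ->; rewrite raddf0. Qed.

Lemma flowC a b : admissible a -> flow a (tC b) = tC b.
Proof.
move=> ad; apply: tfun_inj => x; apply: hsum_unique (flow_at _ _ ad) _.
have := @hsum1 _ p_pr _ (fun n => flt a n (tC b) x) 0%N.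
rewrite flt0; apply=> -[//|n] _.
by rewrite /flt iterSr vfC iter_vf0 mulr0.
Qed.

Lemma flowX0 a : admissible a -> flow a (tX p_pr ord0) = tX p_pr ord0 + tC a.
Proof.
move=> ad; apply: tfun_inj => x; apply: hsum_unique (flow_at _ _ ad) _.
have := @hsum_ord _ p_pr (fun n => flt a n (tX p_pr ord0) x) 2.
have sum2 (u : nat -> Qp) : \sum_(i < 2) u i = u 0%N + u 1%N.
  by rewrite !big_ord_recl big_ord0 addr0.
rewrite (sum2 (fun n => flt a n (tX p_pr ord0) x)) flt0.
have -> : flt a 1 (tX p_pr ord0) = tC a.
  by rewrite /flt /= vfX0 mulr1 /ecf expr1 divr1.
have vf1 : vf 1 = 0 by rewrite -(vfC 1) rmorph1.
by apply=> -[//|[//|n]] _; rewrite /flt !iterSr vfX0 vf1 iter_vf0 mulr0.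
Qed.

Definition fpt a : 'I_l.+1 -> T := fun j => flow a (tX p_pr j).

Lemma tbound_fpt a j : admissible a -> tbound (fpt a j) 1.
Proof. by move=> ad; apply: tbound_flow => //; apply: tboundX. Qed.

(** A ring morphism that fixes constants agrees on monomials with substitution of the images of the
    coordinates. For general [f] the series over monomials and the exponential series are exchanged
    by Fubini. *)
Lemma flow_comp a f x : admissible a -> flow a f x = f (tpt (fpt a) x).
Proof.
move=> ad.
pose W := tmon (tX p_pr (k := l.+1)).
have W1 I : tbound (W I) 1 by apply: tbound_tmon => i; apply: tboundX.
have fl1 : flow a 1 = 1 by have := flowC 1 ad; rewrite rmorph1.
have EW I : flow a (W I) x = zmon I (tpt (fpt a) x).
  rewrite -tmonE => [|j]; last exact: tbound_fpt.
  rewrite /W /tmon (big_morph _ (fun u v => flowM u v ad) fl1); congr (tfun _ x).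
  apply: eq_bigr => i _.
  by elim: (I i) => [|n IH]; rewrite ?expr0 ?fl1 // !exprS flowM // IH.
have fS : Tsum (fun I => tC (coef f I) * W I) f by apply: Tsum_tmonX.
have DS n : Tsum (fun I => tC (coef f I) * iter n vf (W I)) (iter n vf f).
  elim: n => //= n /Tsum_vf IH.
  have -> : (fun I => tC (coef f I) * vf (iter n vf (W I))) =
    (fun I => vf (tC (coef f I) * iter n vf (W I))) by apply/funext => I; rewrite vfZ.
  exact: IH.
have [B B0 fB] := coef_bound f.
have Wn n I : nm (iter n vf (W I) x) <= 1.
  by apply: (tfun_le x ler01); apply: tbound_iter.
apply: hsum_unique ((coefP f).2 (tpt (fpt a) x)).
apply: (@hsum_fubini _ p_pr _ _ (fun n I => ecf a n * (coef f I * iter n vf (W I) x))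
   (fun n => flt a n f x) _ _ _ _ _ (flow_at f x ad)).
- apply: null2I => [n|e e0].
    apply: hsum_null (hsumZ (ecf a n) _); exact: (DS n).2.
  have [X HX] := cofinite_geom p_pr B0 e0; exists X => i /HX iX I.
  apply: le_trans iX; rewrite (nmM (ecf a i)) mulrC ler_pM ?nm_ge0 //.
  by rewrite nmM -[B]mulr1 ler_pM ?nm_ge0.
- by move=> n; rewrite /flt tfunM; apply: hsumZ; apply: (DS n).2.
move=> I; rewrite -EW; apply: eq_hsum (hsumZ (coef f I) (flow_at (W I) x ad)) => n.
by rewrite /flt tfunM tfunC mulrCA.
Qed.

(** The term of order [n] in [exp(-a) exp(a)], by the binomial theorem for [(a - a) ^ n]. *)
Lemma ecf_conv a n : \sum_(i < n.+1) ecf (- a) i * ecf a (n - i)%N = (n == 0%N)%:R.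
Proof.
have f0 m : (m`!%:R : Qp) != 0 by apply: nat_neq0; apply: fact_gt0.
apply: (mulfI (f0 n)); rewrite mulr_sumr.
transitivity ((a - a) ^+ n); last first.
  by rewrite subrr expr0n; case: n => [|n] /=; rewrite ?fact0 ?mulr1 ?mulr0.
rewrite exprDn; apply: eq_bigr => i _; rewrite /ecf.
have ni : (i <= n)%N by rewrite -ltnS.
rewrite -(bin_fact ni) !natrM -[RHS]mulr_natr; have := f0 i; have := f0 (n - i)%N.
move: ('C(n, i)%:R : Qp) (i`!%:R : Qp) ((n - i)`!%:R : Qp) => A b c c0 b0.
transitivity (a ^+ (n - i) * (- a) ^+ i * A * (b / b) * (c / c)); first by ring.
by rewrite (divff b0) (divff c0) !mulr1.
Qed.

(** Regrouping the double exponential series by total order [k], the coefficient of the [k]-th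
    iterate of [vf] is given by [ecf_conv], so only [k = 0] survives. *)
Lemma flow_flowN a f : admissible a -> admissible (- a) ->
  flow (- a) (flow a f) = f.
Proof.
move=> ad adN; apply: tfun_inj => x; apply: hsum_unique (flow_at _ _ adN) _.
have DS n : Tsum (fun m => iter n vf (flt a m f)) (iter n vf (flow a f)).
  elim: n => [|n IH] /=; first exact: flowP.
  exact: Tsum_vf.
have [B B0 fB] := tboundE f.
have nF m n : nm (iter m vf (flt a n f) x) <= B * p%:R ^- n.
  apply: tfun_le; first by rewrite mulr_ge0 // ltW // pQ_gt0.
  by apply: tbound_iter; [rewrite mulr_ge0 // ltW // pQ_gt0|apply: tbound_flt].
have n2 : null2 (fun m n => ecf (- a) m * iter m vf (flt a n f) x).
  apply: null2I => [m|e e0].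
    by apply: hsum_null (hsumZ _ ((DS m).2 x)).
  have [X HX] := cofinite_geom p_pr B0 e0; exists X => i /HX iX j.
  apply: le_trans iX; rewrite (nmM (ecf (- a) i)) mulrC.
  apply: ler_pM; rewrite ?nm_ge0 //.
  apply: le_trans (nF i j) _; rewrite ler_piMr //.
  by have := le_pXV p_pr (leq0n j); rewrite expr0 invr1.
have rows m : hsum (fun n => ecf (- a) m * iter m vf (flt a n f) x) (flt (- a) m (flow a f) x).
  by rewrite /flt tfunM; apply: hsumZ; apply: (DS m).2.
have [s ss] := hsum_ex (hsum_null (flow_at (flow a f) x adN)).
have := hsum_diag n2 rows ss.
have iterZ c g m : iter m vf (tC c * g) = tC c * iter m vf g.
  by elim: m => //= m ->; rewrite vfZ.
have D k : \sum_(i < k.+1) ecf (- a) i * iter i vf (flt a (k - i) f) x =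
   (k == 0%N)%:R * iter k vf f x.
  rewrite -(ecf_conv a) mulr_suml; apply: eq_bigr => i _.
  rewrite /flt iterZ tfunM tfunC -iterD subnKC; last by rewrite -ltnS.
  by rewrite mulrA.
move=> /(eq_hsum D) fs; suff <- : s = f x by [].
apply: hsum_unique fs _.
have := @hsum1 _ p_pr _ (fun k => (k == 0%N)%:R * iter k vf f x) 0%N.
by rewrite mul1r; apply=> k /negPf ->; rewrite mul0r.
Qed.

End Flow.

(** * Action of the flow on two-forms *)

Section FlowForm.
Variables (p : nat) (p_pr : prime p) (l : nat).
Local Notation Zp := (padic_int p_pr).
Local Notation Qp := (padic p_pr).
Local Notation nm := (@nm p p_pr).
Local Notation T := (tate p_pr l.+1).
Local Notation tC := (@tC p p_pr l.+1).
Local Notation sp i := (lift ord0 i).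

Variable Y : 'I_l -> T.
Hypothesis Y1 : forall i, tbound (Y i) 1.
Local Notation vf := (vf Y).
Local Notation flt := (flt Y).
Local Notation flow := (flow Y1).
Local Notation fpt := (fpt Y1).

Definition vjac : 'M[T]_l := \matrix_(i, j) td (sp i) (Y j).

(* The matrix of the Lie derivative along [d/dt + Y] of the space part of a
   two-form whose matrix is [A]. *)
Definition lie (A : 'M[T]_l) : 'M[T]_l := map_mx vf A + vjac *m A + A *m vjac^T.

(** Cartan's formula: for closed [A] the Lie derivative is the time derivative plus [d (i_Y A)],
    that is [ds - ds]. In coordinates, closedness rewrites the derivative of [A] along [Y]. *)
Lemma lie_eq0 (A : 'M[T]_l) (s : 'I_l -> T) :
  A^T = - A ->
  (forall i j k, td (sp i) (A j k) + td (sp j) (A k i) + td (sp k) (A i j) = 0) ->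
  (forall j, \sum_k Y k * A k j = - s j) ->
  (forall i j, td ord0 (A i j) = td (sp i) (s j) - td (sp j) (s i)) ->
  lie A = 0.
Proof.
move=> AT clA YA tA; apply/matrixP => i j; rewrite !mxE.
have asym a b : A a b = - A b a by move/matrixP: AT => /(_ b a); rewrite !mxE.
have D a b : \sum_k td (sp a) (Y k) * A k b = - td (sp a) (s b) - \sum_k Y k * td (sp a) (A k b).
  rewrite -raddfN -YA raddf_sum -sumrB /=; apply: eq_bigr => k _.
  by rewrite tdM addrK.
under [X in _ + X + _ = _]eq_bigr => k _ do rewrite mxE.
rewrite D.
have -> : \sum_k A i k * (vjac^T) k j = - \sum_k td (sp j) (Y k) * A k i.
  by rewrite -sumrN; apply: eq_bigr => k _; rewrite !mxE (asym i k) mulNr mulrC.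
rewrite D /vf tA.
have -> : \sum_k Y k * td (sp k) (A i j) =
  \sum_k Y k * td (sp i) (A k j) - \sum_k Y k * td (sp j) (A k i).
  rewrite -sumrB; apply: eq_bigr => k _; rewrite -mulrBr; congr (_ * _).
  have /eqP := clA k i j; rewrite -addrA addr_eq0 => /eqP ->.
  by rewrite (asym k j) raddfN opprD.
by ring.
Qed.

Lemma map_vfM m n q (P : 'M[T]_(m, n)) (Q : 'M[T]_(n, q)) :
  map_mx vf (P *m Q) = map_mx vf P *m Q + P *m map_mx vf Q.
Proof.
apply/matrixP => i j; rewrite !mxE raddf_sum -big_split /=.
by apply: eq_bigr => k _; rewrite !mxE vfM.
Qed.

Definition fjacn a n : 'M[T]_l := \matrix_(i, j) td (sp i) (flt a n (tX p_pr (sp j))).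
Definition fjac a : 'M[T]_l := \matrix_(i, j) td (sp i) (flow a (tX p_pr (sp j))).
Definition mev k m n (x : 'rV[Zp]_k) (A : 'M[tate p_pr k]_(m, n)) : 'M[Qp]_(m, n) :=
  map_mx (ev x) A.

Lemma mx_natI (n : nat) (P Q : 'M[T]_l) : P *+ n.+1 = Q *+ n.+1 -> P = Q.
Proof.
move=> PQ; apply/matrixP => i j; apply: (@tate_natI _ _ _ n).
by move/matrixP: PQ => /(_ i j); rewrite !mulmxnE.
Qed.

Lemma lieD : {morph lie : A B / A + B}.
Proof.
move=> A B; rewrite /lie map_mxD mulmxDr mulmxDl.
by rewrite [X in X + _ = _]addrACA [LHS]addrACA.
Qed.

(** The pulled back matrix is the sum of a series whose terms [R n] satisfy the exponential
    recursion of [a] times [lie]. As [lie A = 0], so does the sequence [A, 0, 0, ...], and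
    uniqueness leaves only the first term. *)
Lemma fjac_pullback (a : Qp) (A : 'M[T]_l) x : admissible a -> lie A = 0 ->
  mev x (fjac a) *m mev (tpt (fpt a) x) A *m (mev x (fjac a))^T = mev x A.
Proof.
move=> ad lA.
have trD (M N : 'M[T]_l) : (M + N)^T = M^T + N^T by apply/matrixP => i j; rewrite !mxE.
have trZ c (M : 'M[T]_l) : (c *: M)^T = c *: M^T by apply/matrixP => i j; rewrite !mxE.
pose L1 (J : 'M[T]_l) := tC a *: (map_mx vf J + vjac *m J).
pose L2 (B : 'M[T]_l) := tC a *: map_mx vf B.
pose L (R : 'M[T]_l) := tC a *: lie R.
(* Differentiating the flow of a coordinate brings in [vjac], through the commutator of [td] and
   [vf] given by [td_vf]. *)
have eJ : expseq L1 (fjacn a).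
  move=> n; apply/matrixP => i j; rewrite mulmxnE !mxE -raddfMn expseq_flt /= [LHS]tdZ.
  rewrite td_vf; congr (_ * (_ + _)); apply: eq_bigr => k _.
  by rewrite !mxE.
pose An n : 'M[T]_l := map_mx (flt a n) A.
have eA : expseq L2 An.
  by move=> n; apply/matrixP => i j; rewrite mulmxnE !mxE expseq_flt.
pose P n : 'M[T]_l := \sum_(i < n.+1) fjacn a i *m An (n - i)%N.
have eP : expseq L1 P.
  apply: (@expseq_conv _ _ _ L1 L2 L1 (fun u v => u *m v)) => //.
  - by move=> u v; rewrite /L1 map_mxD mulmxDr addrACA scalerDr.
  - by move=> u v w; rewrite mulmxDr.
  - by move=> u v w; rewrite mulmxDl.
  - move=> u v; rewrite /L1 /L2 map_vfM -scalemxAl -scalemxAr -scalerDr mulmxDl.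
    by rewrite -mulmxA addrAC.
pose R n : 'M[T]_l := \sum_(i < n.+1) P i *m (fjacn a (n - i)%N)^T.
have eR : expseq L R.
  apply: (@expseq_conv _ _ _ L1 L1 L (fun u v => u *m v^T)) => //.
  - by move=> u v; rewrite /L lieD scalerDr.
  - by move=> u v w; rewrite trD mulmxDr.
  - by move=> u v w; rewrite mulmxDl.
  - move=> u v; rewrite /L /L1 /lie map_vfM -map_trmx trZ -scalemxAl -scalemxAr -scalerDr.
    rewrite trD trmx_mul mulmxDr mulmxDl !mulmxA; congr (_ *: _).
    by rewrite -!addrA; congr (_ + _); rewrite addrCA.
have L0 : L 0 = 0.
  by apply: (addIr (L 0)); rewrite add0r /L -scalerDr -lieD addr0.
have J0 : fjacn a 0 = 1%:M.
  apply/matrixP => i j; rewrite !mxE flt0 tdX (inj_eq (@lift_inj _ ord0)) eq_sym.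
  by case: eqP.
have A0 : An 0%N = A by apply/matrixP => i j; rewrite mxE flt0.
have R0 : R 0%N = A by rewrite /R big_ord1 J0 trmx1 mulmx1 /P big_ord1 J0 mul1mx A0.
pose K n : 'M[T]_l := if n is 0%N then A else 0.
have eK : expseq L K.
  by case=> [|n]; rewrite /K mul0rn ?L0 // /L lA scaler0.
have RK := expseq_unique mx_natI eR eK R0.
have sJ i j : hsum (fun n => fjacn a n i j x) (mev x (fjac a) i j).
  rewrite /mev !mxE; apply: eq_hsum ((Tsum_td (sp i) (flowP Y1 (tX p_pr (sp j)) ad)).2 x) => n.
  by rewrite mxE.
have sA i j : hsum (fun n => An n i j x) (mev (tpt (fpt a) x) A i j).
  rewrite /mev mxE /ev -(flow_comp Y1 (A i j) x ad).
  by apply: eq_hsum (flow_at Y1 (A i j) x ad) => n; rewrite mxE.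
have sP i j : hsum (fun n => P n i j x) ((mev x (fjac a) *m mev (tpt (fpt a) x) A) i j).
  rewrite mxE.
  have := @hsum_sum _ p_pr _ _ (index_enum 'I_l)
    (fun k n => \sum_(s < n.+1) fjacn a s i k x * An (n - s)%N k j x)
    (fun k => mev x (fjac a) i k * mev (tpt (fpt a) x) A k j)
    (fun k => hsum_cauchy (sJ i k) (sA k j)).
  apply: eq_hsum => n; rewrite exchange_big /P summxE tfun_sum; apply: eq_bigr => s _.
  by rewrite mxE tfun_sum.
have sR i j : hsum (fun n => R n i j x)
    ((mev x (fjac a) *m mev (tpt (fpt a) x) A *m (mev x (fjac a))^T) i j).
  rewrite mxE.
  have sJT k : hsum (fun n => fjacn a n j k x) ((mev x (fjac a))^T k j) by rewrite mxE.
  have := @hsum_sum _ p_pr _ _ (index_enum 'I_l)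
    (fun k n => \sum_(s < n.+1) P s i k x * fjacn a (n - s)%N j k x) _
    (fun k => hsum_cauchy (sP i k) (sJT k)).
  apply: eq_hsum => n; rewrite exchange_big /R summxE tfun_sum; apply: eq_bigr => s _.
  by rewrite mxE tfun_sum; apply: eq_bigr => k _; rewrite [in RHS]mxE.
apply/matrixP => i j; apply: hsum_unique (sR i j) _.
have := @hsum1 _ p_pr _ (fun n => R n i j x) 0%N.
rewrite [mev x A i j]mxE /ev R0; apply=> -[//|n] _.
by rewrite RK /= mxE.
Qed.

(** The first iterate of [vf] on a space coordinate is [Y i], zero on [Q] at all times; [vf]
    preserves this vanishing, because [d/dt] is tangent to the set and [Y] is zero on it. Only the
    term of order zero is left. *)
Lemma flow_fix (a : Qp) (y : pred 'I_l) (x : 'rV[Zp]_l.+1) i : admissible a ->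
  (forall j (z : 'rV[Zp]_l.+1), (forall i, y i -> z 0 (sp i) = 0) -> Y j z = 0) ->
  (forall i, y i -> x 0 (sp i) = 0) ->
  flow a (tX p_pr (sp i)) x = zemb (x 0 (sp i)).
Proof.
move=> ad Yv xv.
pose van (f : T) := forall z : 'rV[Zp]_l.+1, (forall i, y i -> z 0 (sp i) = 0) -> f z = 0.
have vvan f : van f -> van (vf f).
  move=> fv z zv; rewrite /vf tfunD tfun_sum big1 ?addr0; last first.
    by move=> j _; rewrite tfunM (Yv j) ?mul0r.
  apply: isD_unique (tdP ord0 f z) _; exists 0 => // h.
  rewrite !fv //; first by rewrite mulr0 !subr0 nm0 mul0r.
  by move=> j yj; rewrite stepvE /= addr0 zv.
have vn n : van (iter n.+1 vf (tX p_pr (sp i))).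
  elim: n => [|n IH]; last exact: vvan.
  by move=> z zv; rewrite [iter _ _ _](vfXs Y i) Yv.
apply: hsum_unique (flow_at Y1 _ x ad) _.
have := @hsum1 _ p_pr _ (fun n => flt a n (tX p_pr (sp i)) x) 0%N.
rewrite flt0; apply=> -[//|n] _.
by rewrite tfunM vn // mulr0.
Qed.

End FlowForm.

(** * Inversion of matrices close to the identity *)

Section Neumann.
Variables (p : nat) (p_pr : prime p).
Local Notation Zp := (padic_int p_pr).
Local Notation Qp := (padic p_pr).
Local Notation nm := (@nm p p_pr).
Local Notation tate := (tate p_pr).

Lemma unif_tbound k (I : finType) (f : I -> tate k) :
  exists2 B, 0 <= B & forall i, tbound (f i) B.
Proof.
have H i : exists B, 0 <= B /\ tbound (f i) B by have [B B0 fB] := tboundE (f i); exists B.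
pose B i := sval (cid (H i)).
have BP i : 0 <= B i /\ tbound (f i) (B i) by rewrite /B; case: cid.
exists (\sum_i B i) => [|i]; first by apply: sumr_ge0 => i _; case: (BP i).
apply: tbound_le (BP i).2; rewrite (bigD1 i) //= lerDl.
by apply: sumr_ge0 => j _; case: (BP j).
Qed.

Lemma unif_nm (I : finType) (f : I -> Qp) : exists2 B, 0 <= B & forall i, nm (f i) <= B.
Proof.
exists (\sum_i nm (f i)) => [|i]; first by apply: sumr_ge0 => i _; apply: nm_ge0.
by rewrite (bigD1 i) //= lerDl sumr_ge0 // => j _; apply: nm_ge0.
Qed.

Lemma hsum_succ (c : nat -> Qp) t :
  hsum (fun n => c n.+1) t -> hsum c (c 0%N + t).
Proof.
move=> ct.
have h0 : hsum (fun n => if n is 0%N then c 0%N else 0) (c 0%N).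
  have := @hsum1 _ p_pr _ (fun n => if n is 0%N then c 0%N else 0) 0%N.
  by apply=> -[].
have h1 : hsum (fun n => if n is 0%N then 0 else c n) t.
  by apply: (@hsum_reindex _ _ _ _ S) ct => [x y []//|[//|n] /(_ n)].
by apply: eq_hsum (hsumD h0 h1) => -[|n]; rewrite ?addr0 ?add0r.
Qed.

(** Geometric series: by the ultrametric inequality the entries of [S ^ n] have Gauss norm at most
    [p ^- n], and shifting the index gives [V = 1 + S V]. *)
Lemma neumann k l (S : 'M[tate k]_l) :
  (forall i j, tbound (S i j) p%:R^-1) ->
  exists2 V : 'M[tate k]_l, (1%:M - S) *m V = 1%:M & forall i j, tbound (V i j) 1.
Proof.
move=> Sp; pose P n : 'M[tate k]_l := iter n (mulmx S) 1%:M.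
have p1 : p%:R ^- 1 <= (1 : rat).
  by have := le_pXV p_pr (leq0n 1); rewrite expr0 invr1.
have Pn n i j : tbound (P n i j) (p%:R ^- n).
  elim: n i j => [|n IH] i j.
    rewrite expr0 invr1 mxE; case: eqP => _; first exact: tbound1.
    exact: tbound0.
  rewrite mxE; apply: tbound_sum => [|m _]; first exact/ltW/pQ_gt0.
  rewrite exprS invfM; apply: tboundM => //.
  - by rewrite invr_ge0 ltW // pr_gt0.
  - exact/ltW/pQ_gt0.
have sumP i j : exists F, Tsum (fun n => P n i j) F.
  apply: Tsum_ex => e e0; have [X HX] := cofinite_geom p_pr ler01 e0.
  by exists X => m /HX; rewrite mul1r => mX; apply: tbound_le mX (Pn m i j).
pose V : 'M[tate k]_l := \matrix_(i, j) sval (cid (sumP i j)).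
have VP i j : Tsum (fun n => P n i j) (V i j) by rewrite mxE; case: cid.
exists V => [|i j]; last first.
  apply: Tsum_bound (VP i j) _ => // n; apply: tbound_le (Pn n i j).
  by have := le_pXV p_pr (leq0n n); rewrite expr0 invr1.
rewrite mulmxBl mul1mx; apply/eqP; rewrite subr_eq; apply/eqP/matrixP => i j.
apply: tfun_inj => x; apply: hsum_unique ((VP i j).2 x) _.
rewrite mxE tfunD; apply: hsum_succ.
have := @Tsum_sum p p_pr k _ _ (index_enum 'I_l) (fun m n => S i m * P n m j)
  (fun m => S i m * V m j) (fun m => TsumM (S i m) (VP m j)).
by move=> [_ /(_ x)]; rewrite [(S *m V) i j]mxE; apply: eq_hsum => n; rewrite [P n.+1 i j]mxE.
Qed.

End Neumann.

(** * Functions independent of time, and restriction to a time slice *)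

Section Extension.
Variables (p : nat) (p_pr : prime p) (l : nat).
Local Notation Zp := (padic_int p_pr).
Local Notation Qp := (padic p_pr).
Local Notation nm := (@nm p p_pr).
Local Notation tate := (tate p_pr).
Local Notation sp i := (lift ord0 i).

Definition tailv (x : 'rV[Zp]_l.+1) : 'rV[Zp]_l := \row_i x 0 (sp i).

Definition ext (f : tate l) : tate l.+1 := tcomp (fun i => tX p_pr (sp i)) f.

Lemma extE f x : ext f x = f (tailv x).
Proof.
rewrite tcompE; last by move=> i; apply: tboundX.
congr (tfun f _); apply/rowP => i; apply: (@zemb_inj p p_pr).
by rewrite tptE ?mxE // => j; apply: tboundX.
Qed.

Lemma tbound_ext f B : 0 <= B -> tbound f B -> tbound (ext f) B.
Proof. by move=> B0 fB; apply: tbound_tcomp => // i; apply: tboundX. Qed.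

Lemma td_ext f i : td (sp i) (ext f) = ext (td i f).
Proof.
apply: td_unique => x; rewrite extE; have [B B0 H] := tdP i f (tailv x).
exists B => // h; rewrite !extE; have := H h.
suff -> : tailv (stepv x (sp i) h) = stepv (tailv x) i h by [].
apply/rowP => j; rewrite mxE !stepvE mxE.
by rewrite (inj_eq (@lift_inj _ ord0)).
Qed.

Lemma td0_ext f : td ord0 (ext f) = 0.
Proof.
apply: td_unique => x; exists 0 => // h; rewrite !extE mul0r mulr0 subr0.
suff -> : tailv (stepv x ord0 h) = tailv x by rewrite subrr nm0.
by apply/rowP => j; rewrite !mxE eqxx /= mulr0 addr0.
Qed.

(* The inclusion of the time slice [t = c]; time is the coordinate [ord0]. *)
Definition sct (c : Qp) (j : 'I_l.+1) : tate l :=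
  if unlift ord0 j is Some i then tX p_pr i else tC l c.

Lemma sct0 c : sct c ord0 = tC l c.
Proof. by rewrite /sct unlift_none. Qed.

Lemma sctS c i : sct c (sp i) = tX p_pr i.
Proof. by rewrite /sct liftK. Qed.

Lemma tbound_sct c j : nm c <= 1 -> tbound (sct c j) 1.
Proof.
by move=> c1; rewrite /sct; case: unlift => [i|]; [apply: tboundX|apply: tboundC].
Qed.

Lemma sct_pt0 c w : nm c <= 1 -> zemb (tpt (sct c) w 0 ord0) = c.
Proof. by move=> c1; rewrite tptE ?sct0 // => j; apply: tbound_sct. Qed.

Lemma sct_ptS c w i : nm c <= 1 -> tpt (sct c) w 0 (sp i) = w 0 i.
Proof.
move=> c1; apply: (@zemb_inj p p_pr); rewrite tptE ?sctS //.
by move=> j; apply: tbound_sct.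
Qed.

Lemma tailv_sct c w : nm c <= 1 -> tailv (tpt (sct c) w) = w.
Proof. by move=> c1; apply/rowP => i; rewrite mxE sct_ptS. Qed.

Lemma td_sct c f i w : nm c <= 1 ->
  td i (tcomp (sct c) f) w = td (sp i) f (tpt (sct c) w).
Proof.
move=> c1; apply: isD_unique (tdP i _ w) _.
have [B B0 H] := tdP (sp i) f (tpt (sct c) w); exists B => // h.
rewrite !tcompE; try by move=> j; apply: tbound_sct.
suff -> : tpt (sct c) (stepv w i h) = stepv (tpt (sct c) w) (sp i) h by [].
apply/rowP => j; rewrite stepvE; case: (unliftP ord0 j) => [k|] ->.
  by rewrite !sct_ptS // stepvE (inj_eq (@lift_inj _ ord0)).
rewrite addr0; apply: (@zemb_inj p p_pr); by rewrite !sct_pt0.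
Qed.

End Extension.

(** * The local Moser argument *)

Section Moser.
Variables (p : nat) (p_pr : prime p) (l : nat).
Local Notation Zp := (padic_int p_pr).
Local Notation Qp := (padic p_pr).
Local Notation nm := (@nm p p_pr).
Local Notation tate := (tate p_pr).
Local Notation sp i := (lift ord0 i).
Local Notation eps := (p%:R ^+ 2 : Qp).

Lemma admissible_eps : admissible eps.
Proof. by move=> n; apply: nm_expcoef. Qed.

Lemma admissibleN (a : Qp) : admissible a -> admissible (- a).
Proof.
move=> ad n; apply: le_trans (ad n).
by rewrite /ecf !nmM !nmX nmN.
Qed.

Lemma nm_eps_le1 : nm eps <= 1.
Proof. by rewrite -natrX nm_nat. Qed.

Section FlowMaps.
Variable Y : 'I_l -> tate l.+1.
Hypothesis Y1 : forall i, tbound (Y i) 1.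

(** The flow for time [a] of the slice [t = c], without its time coordinate, which ends at [c + a]
    by [fpt_sct]. *)
Definition moser (a c : Qp) (i : 'I_l) : tate l :=
  tcomp (sct c) (flow Y1 a (tX p_pr (sp i))).

Lemma tbound_moser a c i : admissible a -> nm c <= 1 -> tbound (moser a c i) 1.
Proof.
move=> ad c1; apply: tbound_tcomp => // [j|]; first exact: tbound_sct.
by apply: tbound_flow => //; apply: tboundX.
Qed.

Lemma fpt_sct a c w : admissible a -> nm a <= 1 -> nm c <= 1 ->
  tpt (fpt Y1 a) (tpt (sct c) w) = tpt (sct (c + a)) (tpt (moser a c) w).
Proof.
move=> ad a1 c1; have ca1 := nmD_le c1 a1.
have fB j : tbound (fpt Y1 a j) 1 by apply: tbound_fpt.
apply/rowP => j; apply: (@zemb_inj p p_pr); rewrite tptE //.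
case: (unliftP ord0 j) => [i|] ->; last first.
  by rewrite sct_pt0 // /fpt flowX0 // tfunD tfunX1 sct_pt0.
rewrite sct_ptS // tptE => [|m]; last exact: tbound_moser.
by rewrite /moser tcompE // => m; apply: tbound_sct.
Qed.

Lemma moserK a c : admissible a -> nm a <= 1 -> nm c <= 1 ->
  cancel (tpt (moser a c)) (tpt (moser (- a) (c + a))).
Proof.
move=> ad a1 c1 w; have ca1 := nmD_le c1 a1; have adN := admissibleN ad.
apply/rowP => i; apply: (@zemb_inj p p_pr).
rewrite tptE => [|m]; last exact: tbound_moser.
rewrite /moser tcompE; last by move=> m; apply: tbound_sct.
rewrite -fpt_sct // -flow_comp // -{1}[a]opprK flow_flowN ?opprK //.
by rewrite tfunX1 sct_ptS.
Qed.

End FlowMaps.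

Definition tclosed k (A : 'M[tate k]_k) := forall i j m : 'I_k,
  td i (A j m) + td j (A m i) + td m (A i j) = 0.

Variable y : pred 'I_l.
Definition onQ (x : 'rV[Zp]_l) := forall i, y i -> x 0 i = 0.

Variables a0 a1 : 'M[tate l]_l.
Hypotheses (a0T : a0^T = - a0) (a1T : a1^T = - a1).
Hypotheses (a0c : tclosed a0) (a1c : tclosed a1).
Hypothesis a01 : forall x, onQ x -> mev x a0 = mev x a1.
Hypothesis a0u : mev 0 a0 \in unitmx.

Let eta (i j : 'I_l) : tate l := a1 i j - a0 i j.

Let antisym (a : 'M[tate l]_l) : a^T = - a -> forall i j, a j i = - a i j.
Proof. by move=> aT i j; move/matrixP: aT => /(_ i j); rewrite !mxE. Qed.

Lemma eta_antisym b c : eta c b = - eta b c.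
Proof. by rewrite /eta (antisym a0T b c) (antisym a1T b c) opprK opprB addrC. Qed.

Lemma eta_closed i j k : td i (eta j k) + td j (eta k i) + td k (eta i j) = 0.
Proof.
rewrite /eta !raddfB /=; have := a0c i j k; have := a1c i j k.
move: (td i (a0 j k)) (td j (a0 k i)) (td k (a0 i j)) => u1 u2 u3.
move: (td i (a1 j k)) (td j (a1 k i)) (td k (a1 i j)) => v1 v2 v3 H1 H0.
transitivity ((v1 + v2 + v3) - (u1 + u2 + u3)); first by ring.
by rewrite H0 H1 subrr.
Qed.

Lemma eta_van b c x : onQ x -> eta b c x = 0.
Proof.
move=> /a01 /matrixP/(_ b c); rewrite !mxE /ev => E.
by rewrite tfunB E subrr.
Qed.

Section Scale.
Variable g : 'I_l -> 'I_l -> tate l.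
Hypothesis g0 : forall a c, g a c 0 = 0.
Hypothesis dg : forall b c, td b (\sum_(a | y a) tX p_pr a * g a c)
              - td c (\sum_(a | y a) tX p_pr a * g a b) = tscale 1 (eta b c).
Variable M : nat.
Local Notation N := M.+1.

(** The primitive on the ball of radius [p ^- M], divided by the [p ^ M] that rescaling puts in
    front of derivatives. The coordinate [tX a] absorbs this division, so [g] is merely rescaled.
    The remaining unit in [N = M + 1] is the rescaling built into [poincare]. *)
Let sM (c : 'I_l) : tate l := \sum_(a | y a) tX p_pr a * tscale M (g a c).

Lemma sM_scale c : sM c = tC l (p%:R ^- M) * tscale M (\sum_(a | y a) tX p_pr a * g a c).
Proof.
apply: tfun_inj => x; rewrite tfunM tfunC tscaleE !tfun_sum mulr_sumr.
apply: eq_bigr => a _; rewrite !tfunM tscaleE !tfunX1 mxE rmorphM rmorphXn rmorph_nat.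
by rewrite -!mulrA mulKf // pX_neq0.
Qed.

Lemma d_sM b c : td b (sM c) - td c (sM b) = tscale N (eta b c).
Proof.
rewrite !sM_scale !tdZ !td_tscale !mulrA -!rmorphM mulVf ?pX_neq0 // rmorph1 !mul1r.
by rewrite -tscaleN -tscaleD dg tscale_tscale addn1.
Qed.

(* The interpolating form [a0 + (t / eps) (a1 - a0)] on the scaled ball, equal to
   [a1] at [t = eps]. *)
Let A : 'M[tate l.+1]_l := \matrix_(i, j)
  (ext (tscale N (a0 i j)) + tC l.+1 eps^-1 * (tX p_pr ord0 * ext (tscale N (eta i j)))).
Let s (j : 'I_l) : tate l.+1 := tC l.+1 eps^-1 * ext (sM j).

Lemma A_ev x i j : A i j x = a0 i j (p%:R ^+ N *: tailv x)
   + eps^-1 * (zemb (x 0 ord0) * eta i j (p%:R ^+ N *: tailv x)).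
Proof. by rewrite mxE tfunD !tfunM !extE !tscaleE. Qed.

Lemma A_T : A^T = - A.
Proof.
apply/matrixP => i j; rewrite mxE [RHS]mxE; apply: tfun_inj => x.
rewrite tfunN !A_ev (antisym a0T i j) (eta_antisym i j) !tfunN.
by rewrite !mulrN opprD.
Qed.

Lemma td_A x i j k : td (sp i) (A j k) x = p%:R ^+ N * td i (a0 j k) (p%:R ^+ N *: tailv x)
   + eps^-1 * (zemb (x 0 ord0) * (p%:R ^+ N * td i (eta j k) (p%:R ^+ N *: tailv x))).
Proof.
rewrite mxE tdD tdZ tdM tdX !td_ext !td_tscale /=.
by rewrite mul0r add0r !extE !tfunM !tscaleE !tfunC.
Qed.

Lemma A_closed i j k : td (sp i) (A j k) + td (sp j) (A k i) + td (sp k) (A i j) = 0.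
Proof.
apply: tfun_inj => x; rewrite 2!tfunD !td_A.
set z := p%:R ^+ N *: tailv x.
have H0 := congr1 (fun f : tate l => f z) (a0c i j k).
have H1 := congr1 (fun f : tate l => f z) (eta_closed i j k).
move: H0 H1 => /=.
move: (td i (a0 j k) z) (td j (a0 k i) z) (td k (a0 i j) z) => u1 u2 u3.
move: (td i (eta j k) z) (td j (eta k i) z) (td k (eta i j) z) => v1 v2 v3 H0 H1.
move: (p%:R ^+ N) (eps^-1) (zemb _) => q e t.
transitivity (q * (u1 + u2 + u3) + e * t * q * (v1 + v2 + v3)); first by ring.
by rewrite H0 H1 !mulr0 addr0.
Qed.

Lemma A_tau i j : td ord0 (A i j) = td (sp i) (s j) - td (sp j) (s i).
Proof.
rewrite mxE tdD tdZ tdM tdX !td0_ext eqxx mulr0 addr0 add0r mul1r.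
rewrite !tdZ !td_ext -mulrBr -d_sM; congr (_ * _).
by apply: tfun_inj => x; rewrite tfunB !extE tfunB.
Qed.

Section Field.
Variable Y : 'I_l -> tate l.+1.
Hypothesis Y1 : forall i, tbound (Y i) 1.
Hypothesis YA : forall j, \sum_k Y k * A k j = - s j.
Hypothesis Yv : forall j (z : 'rV[Zp]_l.+1), (forall i, y i -> z 0 (sp i) = 0) -> Y j z = 0.

(** The two maps are the flow for time [eps] from the slice [t = 0], where [A] is [a0], to the slice
    [t = eps], where it is [a1], and the flow back. *)
Lemma moser_spec : exists psi psi' : 'I_l -> tate l,
  [/\ (forall i, tbound (psi i) 1) /\ (forall i, tbound (psi' i) 1),
      cancel (tpt psi) (tpt psi'), cancel (tpt psi') (tpt psi),
      (forall x, onQ x -> tpt psi x = x)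
    & forall x, let J := \matrix_(i, j) td i (psi j) x in
        J *m mev (p%:R ^+ N *: tpt psi x) a1 *m J^T = mev (p%:R ^+ N *: x) a0].
Proof.
have ad := admissible_eps; have adN := admissibleN ad.
have e1 := nm_eps_le1; have eN1 : nm (- eps) <= 1 by rewrite nmN.
have z1 : nm 0 <= 1 by rewrite nm0.
have ne0 : eps != 0 by apply: pX_neq0.
exists (moser Y1 eps 0), (moser Y1 (- eps) eps); split.
- by split=> i; apply: tbound_moser.
- by have := moserK Y1 ad e1 z1; rewrite add0r.
- by have := moserK Y1 adN eN1 e1; rewrite opprK subrr.
- move=> x xQ; apply/rowP => i; apply: (@zemb_inj p p_pr).
  rewrite tptE => [|m]; last exact: tbound_moser.
  rewrite /moser tcompE => [|m]; last exact: tbound_sct.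
  rewrite (@flow_fix _ _ _ _ Y1 _ y) ?sct_ptS // => j yj.
  by rewrite sct_ptS // xQ.
move=> w J; set u := tpt (sct 0) w.
have := fjac_pullback Y1 u ad (lie_eq0 A_T A_closed YA A_tau).
have -> : mev u (fjac Y1 eps) = J.
  by apply/matrixP => i j; rewrite !mxE /ev -td_sct.
rewrite fpt_sct // add0r.
have -> : mev u A = mev (p%:R ^+ N *: w) a0.
  apply/matrixP => i j; rewrite [LHS]mxE [RHS]mxE /ev A_ev sct_pt0 // tailv_sct //.
  by rewrite mul0r mulr0 addr0.
have -> // : mev (tpt (sct eps) (tpt (moser Y1 eps 0) w)) A
   = mev (p%:R ^+ N *: tpt (moser Y1 eps 0) w) a1.
apply/matrixP => i j; rewrite [LHS]mxE [RHS]mxE /ev A_ev sct_pt0 // tailv_sct //.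
by rewrite mulKf // /eta tfunB subrKC.
Qed.

End Field.

Variables Bg Beta B0 BC : rat.
Hypotheses (Bg0 : 0 <= Bg) (Beta0 : 0 <= Beta) (B00 : 0 <= B0) (BC0 : 0 <= BC).
Hypotheses (gB : forall a c, tbound (g a c) Bg) (etaB : forall i j, tbound (eta i j) Beta).
Hypothesis a0B : forall i j, tbound (a0 i j) B0.
Hypothesis CB : forall i j, nm (invmx (mev 0 a0) i j) <= BC.
(** [B0] bounds the variation of [a0]; [p ^ 2] times [Beta] and [Bg] bounds the interpolation term
    and the primitive, both divided by [eps]; [BC] accounts for the inverse at the centre. One
    condition on [M] thus serves both the Neumann series and the bound on [Y]. *)
Let K := BC * (B0 + p%:R ^+ 2 * (Beta + Bg)).
Hypothesis MK : K * p%:R ^- M <= p%:R^-1.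

Lemma nm_epsV : nm eps^-1 = p%:R ^+ 2.
Proof. by rewrite nmV nm_pX invrK. Qed.

Lemma tscale_g a c : tbound (tscale M (g a c)) (Bg * p%:R ^- M).
Proof. by have := tscale_small M (gB a c) Bg0; rewrite g0 rmorph0 subr0. Qed.

(** [A] differs little from the constant matrix [C] of [a0] at the centre: [a0 - a0(0)] and [eta]
    vanish there, and the decay of the latter outweighs [eps^-1]. Hence [A] is [C] times a matrix
    that [neumann] inverts. *)
Lemma A_inv : exists2 V : 'M[tate l.+1]_l, V *m A = 1%:M & forall i j, tbound (V i j) BC.
Proof.
pose C : 'M[tate l.+1]_l := map_mx (tC l.+1) (mev 0 a0).
pose C' : 'M[tate l.+1]_l := map_mx (tC l.+1) (invmx (mev 0 a0)).
have C'C : C' *m C = 1%:M by rewrite -map_mxM mulVmx // map_mx1.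
have p0 n : 0 <= (p%:R ^- n : rat) by apply/ltW/pQ_gt0.
have q0 : 0 <= (p%:R ^+ 2 : rat) by rewrite exprn_ge0 ?ler0n.
have C'B i j : tbound (C' i j) BC by rewrite mxE; apply: tboundC.
have AC i j : tbound ((A - C) i j) ((B0 + p%:R ^+ 2 * (Beta + Bg)) * p%:R ^- M).
  have -> : (A - C) i j = ext (tscale N (a0 i j) - tC l (a0 i j 0))
      + tC l.+1 eps^-1 * (tX p_pr ord0 * ext (tscale N (eta i j))).
    rewrite !mxE; apply: tfun_inj => x; rewrite !(tfunD, tfunN, tfunM) !extE.
    by rewrite tfunB !tfunC addrAC.
  have pN : (p%:R ^- N : rat) <= p%:R ^- M by apply: le_pXV.
  apply: tboundD.
    apply: (@tbound_le _ _ _ _ (B0 * p%:R ^- N)).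
      by rewrite ler_pM // lerDl mulr_ge0 // addr_ge0.
    by apply: tbound_ext; [rewrite mulr_ge0|apply: tscale_small].
  have eN : tbound (tscale N (eta i j)) (Beta * p%:R ^- N).
    have := tscale_small N (etaB i j) Beta0; rewrite eta_van ?rmorph0 ?subr0 //.
    by move=> m _; rewrite mxE.
  apply: (@tbound_le _ _ _ _ (p%:R ^+ 2 * (1 * (Beta * p%:R ^- N)))).
    rewrite mul1r mulrA ler_pM // ?mulr_ge0 //.
    by apply: (le_trans (y := p%:R ^+ 2 * (Beta + Bg))); rewrite ?lerDr // ler_wpM2l // lerDl.
  rewrite -nm_epsV; apply: tboundZ; apply: tboundM => //; first by rewrite mulr_ge0.
    exact: tboundX.
  by apply: tbound_ext; rewrite ?mulr_ge0.
have [|V SV VB] := @neumann p p_pr l.+1 l (- (C' *m (A - C))).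
  move=> i j; rewrite mxE; apply: tboundN; rewrite mxE.
  apply: tbound_sum => [|m _]; first by rewrite invr_ge0 ler0n.
  apply: tbound_le MK _; rewrite /K -mulrA; apply: tboundM => //.
  by rewrite mulr_ge0 // addr_ge0 // mulr_ge0 // addr_ge0.
have {}SV : (C' *m A) *m V = 1%:M.
  by rewrite -SV opprK mulmxBr C'C addrC subrK.
exists (V *m C'); first by rewrite -mulmxA; apply: mulmx1C.
move=> i j; rewrite mxE; apply: tbound_sum => // m _.
by rewrite -[BC]mul1r; apply: tboundM.
Qed.

(** [Y] is minus the row [s] times the inverse of [A]. It vanishes on [Q] since each summand of [s]
    contains a factor [tX a] with [y a]. *)
Lemma moser_field : exists Y : 'I_l -> tate l.+1,
  [/\ forall i, tbound (Y i) 1, forall j, \sum_k Y k * A k j = - s j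
    & forall j (z : 'rV[Zp]_l.+1), (forall i, y i -> z 0 (sp i) = 0) -> Y j z = 0].
Proof.
have [V VA VB] := A_inv.
have p0 n : 0 <= (p%:R ^- n : rat) by apply/ltW/pQ_gt0.
have q0 : 0 <= (p%:R ^+ 2 : rat) by rewrite exprn_ge0 ?ler0n.
pose S : 'rV[tate l.+1]_l := \row_j s j.
exists (fun i => - (S *m V) 0 i); split=> [i|j|j z zQ].
- have KB : p%:R ^+ 2 * (1 * (Bg * p%:R ^- M)) * BC <= 1.
    apply: (le_trans (y := K * p%:R ^- M)); last first.
      by apply: le_trans MK _; have := le_pXV p_pr (leq0n 1); rewrite expr0 invr1.
    rewrite -subr_ge0 /K; move: (p%:R ^+ 2 : rat) (p%:R ^- M) q0 (p0 M) => P q P0 q0'.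
    have -> : BC * (B0 + P * (Beta + Bg)) * q - P * (1 * (Bg * q)) * BC =
      BC * (B0 + P * Beta) * q by ring.
    by rewrite mulr_ge0 // mulr_ge0 // addr_ge0 // mulr_ge0.
  apply: tboundN; rewrite mxE; apply: tbound_sum => // m _.
  apply: tbound_le KB _; apply: tboundM => //; first by rewrite !mulr_ge0.
  rewrite mxE -nm_epsV; apply: tboundZ; apply: tbound_ext; first by rewrite !mulr_ge0.
  apply: tbound_sum => [|a _]; first by rewrite !mulr_ge0.
  by apply: tboundM; rewrite ?mulr_ge0 //; [apply: tboundX|apply: tscale_g].
- transitivity (- ((S *m V) *m A) 0 j); last by rewrite -mulmxA VA mulmx1 mxE.
  by rewrite mxE -sumrN; apply: eq_bigr => k _; rewrite mulNr.
rewrite tfunN mxE tfun_sum big1 ?oppr0 // => k _.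
rewrite mxE !tfunM extE tfun_sum big1 ?mulr0 ?mul0r // => a ya.
by rewrite tfunM tfunX1 mxE zQ // rmorph0 mul0r.
Qed.

End Scale.

Lemma tate_moser : exists N0, forall N, (N0 <= N)%N ->
  exists psi psi' : 'I_l -> tate l,
  [/\ (forall i, tbound (psi i) 1) /\ (forall i, tbound (psi' i) 1),
      cancel (tpt psi) (tpt psi'), cancel (tpt psi') (tpt psi),
      (forall x, onQ x -> tpt psi x = x)
    & forall x, let J := \matrix_(i, j) td i (psi j) x in
        J *m mev (p%:R ^+ N *: tpt psi x) a1 *m J^T = mev (p%:R ^+ N *: x) a0].
Proof.
have [g [g0 dg]] := poincare eta_antisym eta_closed eta_van.
have [Bg Bg0 gB] := unif_tbound (fun ij : 'I_l * 'I_l => g ij.1 ij.2).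
have [Be Be0 eB] := unif_tbound (fun ij : 'I_l * 'I_l => eta ij.1 ij.2).
have [B0 B00 a0B] := unif_tbound (fun ij : 'I_l * 'I_l => a0 ij.1 ij.2).
have [BC BC0 CB] := unif_nm (fun ij : 'I_l * 'I_l => invmx (mev 0 a0) ij.1 ij.2).
have pV0 : 0 < (p%:R^-1 : rat) by rewrite invr_gt0 pr_gt0.
have [M0 HM0] := small_pXM p_pr (BC * (B0 + p%:R ^+ 2 * (Be + Bg))) pV0.
exists M0.+1 => -[//|M]; rewrite ltnS => MM.
have K0 : 0 <= BC * (B0 + p%:R ^+ 2 * (Be + Bg)).
  by rewrite mulr_ge0 // addr_ge0 // mulr_ge0 ?exprn_ge0 ?ler0n // addr_ge0.
have HM := le_pXM p_pr MM K0 HM0.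
have [Y [Y1 YA Yv]] := @moser_field g g0 M Bg Be B0 BC Bg0 Be0 B00 BC0
  (fun a c => gB (a, c)) (fun a c => eB (a, c)) (fun a c => a0B (a, c))
  (fun a c => CB (a, c)) HM.
exact: (@moser_spec g dg M Y Y1 YA Yv).
Qed.

End Moser.

(** * Balls, analytic maps and jacobians *)

Section Topology.
Variables (p : nat) (p_pr : prime p).
Local Notation Zp := (padic_int p_pr).
Local Notation Qp := (padic p_pr).
Local Notation nm := (@nm p p_pr).
Local Notation tate := (tate p_pr).

Lemma padic_ballE (x : Qp) e y : ball x e y = (nm (x - y) < e) :> Prop.
Proof. by rewrite ballEmdist nmE. Qed.

Lemma nm_le_pX (x : Qp) N : nm x <= p%:R ^- N -> exists z : Zp, x = p%:R ^+ N * zemb z.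
Proof.
move=> xN; have pN := pX_neq0 p_pr N.
have /zembP [z zE] : nm ((p%:R ^+ N)^-1 * x) <= 1.
  by rewrite nmM nmV nm_pX invrK mulrC -ler_pdivlMr ?exprn_gt0 ?pr_gt0 // mul1r.
by exists z; rewrite -zE mulVKf.
Qed.

Lemma rV_le_pX k (v : 'rV[Qp]_k) N : (forall i, nm (v 0 i) <= p%:R ^- N) ->
  exists w : 'rV[Zp]_k, v = p%:R ^+ N *: zv w.
Proof.
move=> H; pose w : 'rV[Zp]_k := \row_i sval (cid (nm_le_pX (H i))).
exists w; apply/rowP => i; rewrite mxE zvE mxE.
by case: cid => z /= ->.
Qed.

Lemma nm_pXz N (z : Zp) : nm (p%:R ^+ N * zemb z) <= p%:R ^- N.
Proof.
rewrite nmM nm_pX ler_piMr ?nm_zemb_le1 //; exact/ltW/pQ_gt0.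
Qed.

Lemma pXV_lt N : (p%:R ^- N.+1 : rat) < p%:R ^- N.
Proof.
rewrite ltf_pV2 ?posrE ?exprn_gt0 ?pr_gt0 // ltr_eXn2l ?pr_gt1 //.
Qed.

Definition zball k (x : 'rV[Qp]_k) N : set 'rV[Qp]_k :=
  [set x + p%:R ^+ N *: zv w | w in setT].

Lemma zballP k (x y : 'rV[Qp]_k) N :
  zball x N y <-> forall i, nm (y 0 i - x 0 i) <= p%:R ^- N.
Proof.
split=> [[w _ <-] i|H].
  by rewrite !mxE [X in nm X]addrC addKr nm_pXz.
have [|w wE] := @rV_le_pX k (y - x) N; first by move=> i; rewrite !mxE.
by exists w => //; rewrite -wE subrKC.
Qed.

Lemma zball_ball k (x : 'rV[Qp]_k) N : ball x (p%:R ^- N) `<=` zball x N.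
Proof.
move=> y [_ H]; apply/zballP => i; have := H 0 i.
by rewrite padic_ballE -nmN opprB => /ltW.
Qed.

Lemma ball_zball k (x : 'rV[Qp]_k) N : zball x N.+1 `<=` ball x (p%:R ^- N).
Proof.
move=> y /zballP H; split=> [|i j]; first exact: pQ_gt0.
rewrite padic_ballE -nmN opprB (ord1 i); exact: le_lt_trans (H j) (pXV_lt N).
Qed.

Lemma nbhs_zball k (x : 'rV[Qp]_k) N : nbhs x (zball x N).
Proof.
by apply/nbhs_ballP; exists (p%:R ^- N); [apply: pQ_gt0|apply: zball_ball].
Qed.

Lemma nbhs_zballP k (x : 'rV[Qp]_k) (P : set 'rV[Qp]_k) :
  nbhs x P -> exists N, zball x N `<=` P.
Proof.
move=> /nbhs_ballP [e /= e0 eP]; have [N Ne] := small_pX p_pr e0.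
exists N.+1; apply: subset_trans (ball_zball (N := N)) _.
exact: subset_trans (le_ball Ne) eP.
Qed.

Lemma zball_le k (x : 'rV[Qp]_k) N N' : (N <= N')%N -> zball x N' `<=` zball x N.
Proof.
move=> NN y /zballP H; apply/zballP => i; apply: le_trans (H i) _.
exact: le_pXV.
Qed.

Lemma zball_refl k (x : 'rV[Qp]_k) N : zball x N x.
Proof. by apply/zballP => i; rewrite subrr nm0; apply/ltW/pQ_gt0. Qed.

Lemma zball_trans k (x y : 'rV[Qp]_k) N : zball x N y -> zball y N `<=` zball x N.
Proof.
move=> /zballP xy z /zballP yz; apply/zballP => i.
by rewrite -(subrKA (y 0 i)); apply: nmD_le.
Qed.

Lemma zball_open k (x : 'rV[Qp]_k) N : open (zball x N).
Proof.
rewrite openE => y xy; apply: filterS (zball_trans xy) _; exact: nbhs_zball.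
Qed.

Lemma hausdorff_mx m n : hausdorff_space 'M[Qp]_(m, n).
Proof.
move=> A B AB; apply/matrixP => i j; apply: (@metric_hausdorff rat Qp) => X Y AX BY.
pose mk (S : set Qp) : set 'M[Qp]_(m, n) := [set M | S (M i j)].
have mkP S (M : 'M[Qp]_(m, n)) : nbhs (M i j) S -> nbhs M (mk S).
  move=> MS; exists (fun i' j' => if (i' == i) && (j' == j) then S else setT).
    by move=> i' j'; case: ifP => [/andP[/eqP -> /eqP ->]//|_]; apply: filterT.
  by move=> N H; have := H i j; rewrite !eqxx.
by have [M [MX MY]] := AB _ _ (mkP _ _ AX) (mkP _ _ BY); exists (M i j).
Qed.

#[local] Instance dnbhs_padic_proper (x : Qp) : ProperFilter x^'.
Proof.
apply: Build_ProperFilter_ex => P /nbhs_ballP [e /= e0 H].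
have [N Ne] := small_pX p_pr e0; exists (x + p%:R ^+ N.+1).
apply: H => /=; last by rewrite -subr_eq0 addrC addKr pX_neq0.
rewrite padic_ballE opprD addNKr nmN nm_pX.
exact: lt_le_trans (pXV_lt N) Ne.
Qed.

Lemma cvg_mx m n (F : set_system Qp) (f : Qp -> 'M[Qp]_(m, n)) (L : 'M[Qp]_(m, n)) :
  Filter F ->
  (forall i j e, 0 < e -> \forall h \near F, nm (f h i j - L i j) < e) ->
  f @ F --> L.
Proof.
move=> FF H; apply/cvg_ballP => e e0.
have K : \forall h \near F, forall i j, nm (f h i j - L i j) < e.
  by apply: filter_forall => i; apply: filter_forall => j; apply: H.
by apply: filterS K => h Hh; split=> // i j; rewrite padic_ballE -nmN opprB.
Qed.

(** An ultrafilter on the unit ball selects a residue modulo [p ^ n] for each [n]: otherwise every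
    value would be excluded in turn, up to the bound [p ^ n]. The selected residues form the
    limit. *)
Lemma zp_compact : compact [set x : Qp | nm x <= 1].
Proof.
rewrite compact_ultra => F UF FA.
have PF := @ultra_proper _ F UF.
have H n : exists r : nat, F [set x : Qp | exists z : Zp, x = zemb z /\ zres z n = r].
  apply: contrapT => /forallNP nF.
  have K m : F [set x : Qp | nm x <= 1 /\ forall z : Zp, x = zemb z -> (m <= zres z n)%N].
    elim: m => [|m IH]; first by apply: filterS FA => x.
    have [Fm|Fm] := in_ultra_setVsetC [set x : Qp | exists z : Zp, x = zemb z /\ zres z n = m] UF.
      by have := nF m Fm.
    apply: filterS (filterI IH Fm) => x [[x1 xm] nx]; split=> // z xz.
    rewrite ltn_neqAle xm // andbT; apply/eqP => E; apply: nx; exists z; by rewrite E.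
  have [x [x1 Hx]] := filter_ex (K (p ^ n)%N).
  have [z xz] := zembP x1; have := Hx z xz.
  by rewrite leqNgt zres_lt.
pose r n := sval (cid (H n)).
have rP n : F [set x : Qp | exists z : Zp, x = zemb z /\ zres z n = r n].
  by rewrite /r; case: cid.
have cons n : (r n.+1 = r n %[mod p ^ n])%N.
  have [x [[z [xz zn]] [z' [xz' zn']]]] := filter_ex (filterI (rP n) (rP n.+1)).
  have E : z' = z by apply: (@zemb_inj p p_pr); rewrite -xz.
  by rewrite -zn -zn' E zmod_succ.
pose s : Zp := zmk p_pr cons.
exists (zemb s); split; first exact: nm_zemb_le1.
apply/cvg_ballP => e e0; have [n ne] := small_pX p_pr e0.
apply: filterS (rP n.+1) => x [z [-> zn]].
rewrite padic_ballE; apply: lt_le_trans ne; apply: le_lt_trans (pXV_lt n).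
by rewrite zres_sub_eq zn /= -zn zres_small.
Qed.

Lemma zball_compact k (x : 'rV[Qp]_k) N : compact (zball x N).
Proof.
have cu : compact [set v : 'rV[Qp]_k | forall i, nm (v 0 i) <= 1].
  exact: (@matrix_normedtype.rV_compact Qp k (fun _ => [set x : Qp | nm x <= 1]) (fun _ => zp_compact)).
pose f (v : 'rV[Qp]_k) := x + p%:R ^+ N *: v.
suff -> : zball x N = f @` [set v : 'rV[Qp]_k | forall i, nm (v 0 i) <= 1].
  apply: continuous_compact cu; apply: continuous_subspaceT => v.
  move=> P /nbhs_zballP [n nP].
  apply: filterS (nbhs_zball v n) => u uv; apply: nP.
  apply/zballP => i; move/zballP: uv => /(_ i).
  rewrite !mxE opprD addrACA subrr add0r -mulrBr nmM nm_pX; apply: le_trans.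
  rewrite ler_piMl ?nm_ge0 //.
  by have := le_pXV p_pr (leq0n N); rewrite expr0 invr1.
apply/seteqP; split=> y.
  move=> [w _ <-]; exists (zv w) => // i; by rewrite zvE nm_zemb_le1.
move=> [v v1 <-]; have [|w ->] := @rV_le_pX k v 0.
  by move=> i; rewrite expr0 invr1.
by exists w; [exact: I|rewrite /f expr0 scale1r].
Qed.

End Topology.

Section ChainRule.
Variables (p : nat) (p_pr : prime p).
Local Notation Zp := (padic_int p_pr).
Local Notation Qp := (padic p_pr).
Local Notation nm := (@nm p p_pr).
Local Notation tate := (tate p_pr).

Lemma td1 k i : td i (1 : tate k) = 0.
Proof. by have := tdC i (1 : Qp); rewrite rmorph1. Qed.

(** The property [C] (values and derivatives compose) holds for coordinates and passes to products,
    hence to monomials; both sides are then summed termwise. *)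
Lemma td_tcomp k l (h : 'I_l -> tate k) (f : tate l) i x :
  (forall j, tbound (h j) 1) ->
  td i (tcomp h f) x = \sum_j td i (h j) x * td j f (tpt h x).
Proof.
move=> h1.
pose C (P : tate k) (W : tate l) := (forall x, P x = W (tpt h x)) /\
  forall x, td i P x = \sum_j td i (h j) x * td j W (tpt h x).
have C1 : C 1 1.
  split=> // z; rewrite td1 big1 // => j _; by rewrite td1 mulr0.
have CM P W P' W' : C P W -> C P' W' -> C (P * P') (W * W').
  move=> [e d] [e' d']; split=> z; first by rewrite !tfunM e e'.
  rewrite tdM tfunD !tfunM d d' mulr_suml mulr_sumr -big_split /=.
  by apply: eq_bigr => j _; rewrite tdM tfunD !tfunM e e'; ring.
have CX j : C (h j) (tX p_pr j).
  split=> z; first by rewrite tfunX1 tptE.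
  rewrite (bigD1 j) //= tdX eqxx mulr1 big1 ?addr0 // => m /negPf mj.
  by rewrite tdX eq_sym mj mulr0.
have CPW I : C (tmon h I) (tmon (tX p_pr (k := l)) I).
  rewrite /tmon; apply: (big_ind2 (fun a b => C a b)) => //.
  move=> j _; elim: (I j) => [|n IH]; first by rewrite !expr0.
  by rewrite !exprS; exact: CM (CX j) IH.
have fS := Tsum_tmonX f.
have hS := Tsum_tmon h1 (fun x => tcompE f x h1).
apply: hsum_unique ((Tsum_td i hS).2 x) _.
have := @hsum_sum _ p_pr _ _ (index_enum 'I_l)
  (fun j I => td i (h j) x *
     td j (tC l (coef f I) * tmon (tX p_pr (k := l)) I) (tpt h x))
  (fun j => td i (h j) x * td j f (tpt h x))
  (fun j => hsumZ _ ((Tsum_td j fS).2 (tpt h x))).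
apply: eq_hsum => I; rewrite tdZ tfunM (CPW I).2 mulr_sumr tfunC.
by apply: eq_bigr => j _; rewrite tdZ tfunM tfunC mulrCA.
Qed.

End ChainRule.

(** * Local power series representations and their comparison with [analytic_on] *)

Section AnalyticAt.
Variables (p : nat) (p_pr : prime p).
Local Notation Zp := (padic_int p_pr).
Local Notation Qp := (padic p_pr).
Local Notation nm := (@nm p p_pr).
Local Notation tate := (tate p_pr).

(** The restriction of [f] to the ball of radius [p ^- N] about [x], read on [Zp^k]: the bridge
    between functions on [Qp^k] and the Tate algebra. *)
Definition rep k a b (f : 'rV[Qp]_k -> 'M[Qp]_(a, b)) x N
    (G : 'I_a -> 'I_b -> tate k) :=
  forall w i j, f (x + p%:R ^+ N *: zv w) i j = G i j w.

Definition analytic_at k a b (f : 'rV[Qp]_k -> 'M[Qp]_(a, b)) x :=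
  exists N G, rep f x N G.

Lemma zvZ k (a : Zp) (w : 'rV[Zp]_k) : zv (a *: w) = zemb a *: zv w.
Proof. by apply/rowP => i; rewrite zvE !mxE rmorphM. Qed.

Lemma zvD k (v w : 'rV[Zp]_k) : zv (v + w) = zv v + zv w.
Proof. by apply/rowP => i; rewrite zvE !mxE rmorphD. Qed.

Lemma zv0 k : zv (0 : 'rV[Zp]_k) = 0.
Proof. by apply/rowP => i; rewrite zvE !mxE rmorph0. Qed.

Lemma zemb_pX N : zemb (p%:R ^+ N : Zp) = p%:R ^+ N :> Qp.
Proof. by rewrite rmorphXn rmorph_nat. Qed.

Lemma rep_le k a b (f : 'rV[Qp]_k -> 'M[Qp]_(a, b)) x N N' G : (N <= N')%N ->
  rep f x N G -> rep f x N' (fun i j => tscale (N' - N) (G i j)).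
Proof.
move=> NN H w i j; rewrite tscaleE -H zvZ zemb_pX scalerA -exprD.
by rewrite subnKC.
Qed.

Lemma rep_eq k a b (f g : 'rV[Qp]_k -> 'M[Qp]_(a, b)) x N G :
  rep f x N G -> (forall y, zball x N y -> f y = g y) -> rep g x N G.
Proof. by move=> H fg w i j; rewrite -fg ?H //; exists w. Qed.

Lemma rep_near k a b (f g : 'rV[Qp]_k -> 'M[Qp]_(a, b)) x N G :
  rep f x N G -> (\forall y \near x, f y = g y) ->
  exists N' G', rep f x N' G' /\ rep g x N' G'.
Proof.
move=> H /nbhs_zballP [M HM]; exists (maxn N M), (fun i j => tscale (maxn N M - N) (G i j)).
have H' := rep_le (leq_maxl N M) H; split=> //; apply: rep_eq H' _ => y xy.
by apply: HM; apply: zball_le xy; apply: leq_maxr.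
Qed.

Lemma analytic_at_near k a b (f g : 'rV[Qp]_k -> 'M[Qp]_(a, b)) x :
  (\forall y \near x, f y = g y) -> analytic_at f x -> analytic_at g x.
Proof.
by move=> fg [N [G H]]; have [N' [G' [_ H']]] := rep_near H fg; exists N', G'.
Qed.

Lemma rep_at k a b (f : 'rV[Qp]_k -> 'M[Qp]_(a, b)) x N G i j :
  rep f x N G -> f x i j = G i j 0.
Proof. by move=> /(_ 0 i j); rewrite zv0 scaler0 addr0. Qed.

Lemma zv_step k (w : 'rV[Zp]_k) m (t : Zp) :
  zv (stepv w m t) = zemb t *: 'e_m + zv w.
Proof. by apply/rowP => i; rewrite zvE stepvE !mxE eqxx rmorphD rmorphMn /= addrC eq_sym mulr_natr. Qed.

(** Small steps [h] have the form [p ^ N t] with [t] in [Zp], so the quadratic remainder of [isD]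
    controls the difference quotient; the rescaling accounts for [p ^- N]. *)
Lemma rep_pderive k a b (f : 'rV[Qp]_k -> 'M[Qp]_(a, b)) x N G w m :
  rep f x N G ->
  pderive f m (x + p%:R ^+ N *: zv w) = \matrix_(i, j) (p%:R ^- N * td m (G i j) w).
Proof.
move=> H; apply: (cvg_lim (@hausdorff_mx p p_pr a b) (FF := @dnbhs_padic_proper p p_pr 0)).
have pN := pX_neq0 p_pr N.
apply: cvg_mx => i j e e0; have [B B0 HB] := tdP m (G i j) w.
have e20 : 0 < e / 2 by rewrite divr_gt0.
have [n ne] := small_pXM p_pr (B * p%:R ^+ N) e20.
rewrite /dnbhs; apply/nbhs_ballP; exists (p%:R ^- (N + n)); first exact: pQ_gt0.
move=> h /=; rewrite padic_ballE sub0r nmN => hN h0.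
have [t tE] : exists t : Zp, h = p%:R ^+ N * zemb t.
  by apply: nm_le_pX; apply: le_trans (ltW hN) _; exact: (le_pXV p_pr (leq_addr _ _)).
have t0 : zemb t != 0 by apply: contra h0 => /eqP t0; rewrite tE t0 mulr0.
have nt : nm (zemb t) <= p%:R ^- n.
  move: (ltW hN); rewrite tE nmM nm_pX exprD invfM ler_pM2l //; exact: pQ_gt0.
rewrite !mxE.
have -> : h *: 'e_m + (x + p%:R ^+ N *: zv w) = x + p%:R ^+ N *: zv (stepv w m t).
  by rewrite zv_step tE scalerDr scalerA addrCA.
rewrite !H tE.
set q := p%:R ^+ N; set D := td m (G i j) w.
have -> : (q * zemb t)^-1 * (G i j (stepv w m t) - G i j w) - q^-1 * D =
   (q * zemb t)^-1 * (G i j (stepv w m t) - G i j w - zemb t * D).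
  rewrite [RHS]mulrBr; congr (_ - _); rewrite invfM -mulrA mulKf //.
rewrite nmM nmV nmM.
have nt0 : 0 < nm (zemb t) by rewrite nm_gt0.
have nq0 : 0 < nm q by rewrite nm_gt0.
apply: (le_lt_trans (y := e / 2)); last by rewrite ltr_pdivrMr // ltr_pMr // ltr1n.
rewrite mulrC ler_pdivrMr ?mulr_gt0 //; apply: le_trans (HB t) _.
rewrite expr2 !mulrA ler_pM2r //.
have nqE : nm q = p%:R ^- N by rewrite /q nm_pX.
rewrite -ler_pdivrMr // nqE invrK.
apply: le_trans ne; rewrite mulrAC.
by rewrite ler_wpM2l // mulr_ge0 ?exprn_ge0 ?ler0n.
Qed.

Lemma rep_jacobian k l (f : 'rV[Qp]_k -> 'rV[Qp]_l) x N G w :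
  rep f x N G ->
  jacobian f (x + p%:R ^+ N *: zv w) = \matrix_(i, j) (p%:R ^- N * td i (G 0 j) w).
Proof.
by move=> H; apply/matrixP => i j; rewrite !mxE (rep_pderive _ _ H) mxE.
Qed.

Lemma rep_jacobian0 k l (f : 'rV[Qp]_k -> 'rV[Qp]_l) x N G :
  rep f x N G -> jacobian f x = \matrix_(i, j) (p%:R ^- N * td i (G 0 j) 0).
Proof. by move=> H; rewrite -(rep_jacobian 0 H) zv0 scaler0 addr0. Qed.

Lemma jacobian_near k l (f g : 'rV[Qp]_k -> 'rV[Qp]_l) x :
  (\forall y \near x, f y = g y) -> analytic_at f x -> jacobian f x = jacobian g x.
Proof.
move=> fg [N [G H]]; have [N' [G' [H1 H2]]] := rep_near H fg.
by rewrite (rep_jacobian0 H1) (rep_jacobian0 H2).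
Qed.

(** The source is shrunk until the image lies in the ball of radius [p ^- M] about [f x]; the
    rescaled map then has Gauss norm at most one and can be substituted in a series on that ball. *)
Lemma rep_small k l (f : 'rV[Qp]_k -> 'rV[Qp]_l) x N G M : rep f x N G ->
  exists K (h : 'I_l -> tate k), [/\ (forall i, tbound (h i) 1),
    forall i, h i = tC k (p%:R ^- M) * (tscale K (G 0 i) - tC k (f x 0 i))
    & forall w, f (x + p%:R ^+ (N + K) *: zv w) = f x + p%:R ^+ M *: zv (tpt h w)].
Proof.
move=> H; have [B B0 GB] := unif_tbound (fun i => G 0 i).
have [K HK] := small_pXM p_pr B (pQ_gt0 p_pr M).
have h1 i : tbound (tC k (p%:R ^- M) * (tscale K (G 0 i) - tC k (f x 0 i))) 1.
  apply: (@tbound_le _ _ _ _ (nm (p%:R ^- M) * p%:R ^- M)).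
    by rewrite nmV nm_pX mulVf // gt_eqF // pQ_gt0.
  apply: tboundZ; rewrite (rep_at 0 i H); apply: tbound_le HK _.
  exact: tscale_small.
exists K, (fun i => tC k (p%:R ^- M) * (tscale K (G 0 i) - tC k (f x 0 i))).
split=> // w; apply/rowP => i; rewrite [RHS]mxE [X in _ = _ + X]mxE zvE tptE //.
rewrite tfunM tfunB !tfunC mulrA.
rewrite divff ?pX_neq0 // mul1r tscaleE subrKC -H zvZ zemb_pX scalerA -exprD.
by [].
Qed.

Lemma rep_cont k l (f : 'rV[Qp]_k -> 'rV[Qp]_l) x P :
  analytic_at f x -> nbhs (f x) P -> nbhs x (f @^-1` P).
Proof.
move=> [N [G H]] /nbhs_zballP [M HM]; have [K [h [_ _ hE]]] := rep_small M H.
apply: filterS (nbhs_zball x (N + K)) => y [w _ <-] /=; apply: HM; rewrite hE.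
by exists (tpt h w).
Qed.

Lemma rep_comp k l a b (g : 'rV[Qp]_k -> 'rV[Qp]_l) (f : 'rV[Qp]_l -> 'M[Qp]_(a, b)) x :
  analytic_at g x -> analytic_at f (g x) ->
  exists N (h : 'I_l -> tate k) M F G,
  [/\ forall i, tbound (h i) 1, rep f (g x) M F, rep g x N G,
      forall i j, td i (h j) 0 = p%:R ^- M * td i (G 0 j) 0
    & tpt h 0 = 0 /\ rep (f \o g) x N (fun i j => tcomp h (F i j))].
Proof.
move=> [N [G HG]] [M [F HF]]; have [K [h [h1 hE gE]]] := rep_small M HG.
have HG' := rep_le (leq_addr K N) HG; rewrite addKn in HG'.
exists (N + K)%N, h, M, F, (fun i j => tscale K (G i j)); split=> //.
- by move=> i j; rewrite hE tdZ tfunM tfunC raddfB /= tdC subr0.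
split; last by move=> w i j; rewrite /= gE HF tcompE.
apply: zv_inj; rewrite zv0; have := gE 0; rewrite zv0 scaler0 addr0.
move=> /eqP; rewrite eq_sym -subr_eq0 addrC addKr => /eqP E.
have pM := pX_neq0 p_pr M.
by rewrite -[LHS](scale1r) -(mulVf pM) -scalerA E scaler0.
Qed.

Lemma analytic_at_comp k l a b (g : 'rV[Qp]_k -> 'rV[Qp]_l)
    (f : 'rV[Qp]_l -> 'M[Qp]_(a, b)) x :
  analytic_at g x -> analytic_at f (g x) -> analytic_at (f \o g) x.
Proof.
move=> ga fa; have [N [h [M [F [G [_ _ _ _ [_ H]]]]]]] := rep_comp ga fa.
by exists N; eexists; exact: H.
Qed.

Lemma jacobian_comp k l m (g : 'rV[Qp]_k -> 'rV[Qp]_l) (f : 'rV[Qp]_l -> 'rV[Qp]_m) x :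
  analytic_at g x -> analytic_at f (g x) ->
  jacobian (f \o g) x = jacobian g x *m jacobian f (g x).
Proof.
move=> ga fa; have [N [h [M [F [G [h1 HF HG dh [h0 H]]]]]]] := rep_comp ga fa.
rewrite (rep_jacobian0 H) (rep_jacobian0 HG) (rep_jacobian0 HF).
apply/matrixP => i j; rewrite !mxE td_tcomp // mulr_sumr.
apply: eq_bigr => s _; rewrite !mxE dh h0.
by rewrite [RHS]mulrACA -!mulrA.
Qed.

Lemma analytic_at_id k (x : 'rV[Qp]_k) : analytic_at id x /\ jacobian id x = 1%:M.
Proof.
have H : rep id x 0 (fun _ j => tC k (x 0 j) + tX p_pr j).
  move=> w i j; rewrite expr0 scale1r !mxE (ord1 i).
  by rewrite tfunD tfunC tfunX1.
split; first by exists 0%N; eexists; exact: H.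
rewrite (rep_jacobian0 H); apply/matrixP => i j; rewrite !mxE.
rewrite expr0 invr1 mul1r tdD tdC add0r tdX eq_sym.
by case: eqP.
Qed.

Lemma power_series_hsum k (c : {ffun 'I_k -> nat} -> Qp) a x s :
  power_series_sum c a x s <-> hsum (fun I => c I * monomial I (x - a)) s.
Proof.
have E (A : {fset {ffun 'I_k -> nat}}) : partial_sum (fun I => c I * monomial I (x - a)) A =
   \sum_(I <- A) c I * monomial I (x - a) by rewrite /partial_sum big_seq_fsetE.
split=> [H e e0|H].
  have [A _ HA] := H _ (nbhsx_ballx _ _ e0).
  exists A => B AB; have := HA B AB; rewrite /= padic_ballE E => /ltW.
  by rewrite -nmN opprB.
move=> P /nbhs_ballP [e /= e0 eP]; have e20 : 0 < e / 2 by rewrite divr_gt0.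
have [A HA] := H _ e20; exists A => // B /HA B2; apply: eP; move: B2; rewrite padic_ballE E -nmN opprB => B2.
by apply: le_lt_trans B2 _; rewrite ltr_pdivrMr // ltr_pMr // ltr1n.
Qed.

(** Serves to replace a ball of arbitrary rational radius by a polydisc whose radius is the norm of
    a scalar and which still contains the given point. *)
Lemma max_radius k (v : 'I_k -> Qp) r : 0 < r -> (forall i, nm (v i) < r) ->
  exists c : Qp, [/\ c != 0, nm c < r & forall i, nm (v i) <= nm c].
Proof.
move=> r0 vr; have [n nr] := small_pX p_pr r0.
(* The extra candidate [p ^ n.+1] keeps the maximum nonzero when all [v i] vanish. *)
pose F (o : option 'I_k) : Qp := if o is Some i then v i else p%:R ^+ n.+1.
have [o _ Ho] := @Order.TotalTheory.arg_maxP _ _ _ None xpredT (fun o => nm (F o)) isT.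
exists (F o); split=> [||i]; last exact: (Ho (Some i)).
  by rewrite -nm_gt0; apply: lt_le_trans (Ho None isT); rewrite nm_pX pQ_gt0.
case: o {Ho} => [i|]; first exact: vr.
by rewrite /= nm_pX; apply: lt_le_trans (pXV_lt p_pr n) nr.
Qed.

Lemma monomial_scale k (c : Qp) (I : {ffun 'I_k -> nat}) (v : 'rV[Qp]_k) :
  monomial I (c *: v) = c ^+ degm I * monomial I v.
Proof.
rewrite /monomial /degm -prodrXr -big_split /=; apply: eq_bigr => i _.
by rewrite mxE exprMn.
Qed.

Lemma analytic_on_at k a b (U : set 'rV[Qp]_k) (f : 'rV[Qp]_k -> 'M[Qp]_(a, b)) x :
  analytic_on U f -> U x -> analytic_at f x.
Proof.
move=> fU /fU [x0 [r [c [xr rU fc]]]]; have [r0 xr'] := xr.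
have [|q [q0 qr Hq]] := @max_radius k (fun i => x 0 i - x0 0 i) r r0.
  by move=> i; have := xr' 0 i; rewrite padic_ballE -nmN opprB.
have nq : 0 < nm q by rewrite nm_gt0.
have in_ball (y : 'rV[Qp]_k) : (forall i, nm (y 0 i) <= 1) -> ball x0 r (x0 + q *: y).
  move=> y1; split=> // i j; rewrite (ord1 i) padic_ballE !mxE opprD addNKr nmN nmM.
  by apply: le_lt_trans qr; rewrite ler_piMr // ltW.
have tF i j : exists F : tate k, forall w, F w = f (x0 + q *: zv w) i j.
  have [|F [FE _]] := @tateI p p_pr k (fun w => f (x0 + q *: zv w) i j)
     (fun I => c i j I * q ^+ degm I); last by exists F => w; rewrite FE.
  have S w : hsum (fun I => c i j I * q ^+ degm I * zmon I w) (f (x0 + q *: zv w) i j).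
    have wb : ball x0 r (x0 + q *: zv w) by apply: in_ball => m; rewrite zvE nm_zemb_le1.
    have /power_series_hsum := fc _ wb i j; apply: eq_hsum => I.
    by rewrite addrC addKr monomial_scale mulrA.
  (* At the corner where all coordinates are one every monomial equals one, so convergence there
     makes the rescaled coefficients null. *)
  split=> //; have := hsum_null (S (const_mx 1)); apply: null_le => I.
  suff -> : zmon I (const_mx 1 : 'rV[Zp]_k) = 1 by rewrite mulr1.
  by rewrite /zmon /monomial big1 // => m _; rewrite zvE mxE rmorph1 expr1n.
have [N HN] := small_pX p_pr nq.
have [u uE] : exists u : 'rV[Zp]_k, x - x0 = q *: zv u.
  pose v : 'rV[Qp]_k := q^-1 *: (x - x0).
  have [|u uE] := @rV_le_pX p p_pr k v 0.
    move=> i; rewrite !mxE nmM nmV expr0 invr1 mulrC ler_pdivrMr // mul1r; exact: Hq.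
  exists u; move: uE; rewrite expr0 scale1r => <-.
  by rewrite scalerA divff // scale1r.
have [m mE] : exists m : Zp, p%:R ^+ N = q * zemb m.
  have /zembP [m mE] : nm (q^-1 * p%:R ^+ N) <= 1.
    by rewrite nmM nmV nm_pX mulrC ler_pdivrMr // mul1r.
  by exists m; rewrite -mE mulVKf.
(* Recentring at [x]: the point [x + p^N w] is [x0 + q (u + m w)], an affine substitution with
   integral coefficients. *)
pose h (i : 'I_k) : tate k := tC k (zemb (u 0 i)) + tC k (zemb m) * tX p_pr i.
have h1 i : tbound (h i) 1.
  apply: tboundD; first by apply: tboundC; rewrite ?nm_zemb_le1.
  by apply: tboundM1; [apply: tboundC; rewrite ?nm_zemb_le1|apply: tboundX].
have hE w : zv (tpt h w) = zv u + zemb m *: zv w.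
  by apply/rowP => i; rewrite zvE tptE // [RHS]mxE [X in _ = _ + X]mxE !zvE tfunD tfunM !tfunC tfunX1.
exists N, (fun i j => tcomp h (sval (cid (tF i j)))) => w i j.
rewrite tcompE //; case: cid => F /= ->; rewrite hE scalerDr scalerA -mE addrA -uE.
by rewrite subrKC.
Qed.

Lemma analytic_onI k a b (U : set 'rV[Qp]_k) (f : 'rV[Qp]_k -> 'M[Qp]_(a, b)) :
  (forall x, U x -> nbhs x U /\ analytic_at f x) -> analytic_on U f.
Proof.
move=> H x /H [/nbhs_zballP [M MU] [N0 [G0 H0]]].
pose N := maxn N0 M; have HN := rep_le (leq_maxl N0 M) H0; rewrite -/N in HN.
set G := fun i j => _ in HN.
have pN := pX_neq0 p_pr N.
exists x, (p%:R ^- N), (fun i j I => coef (G i j) I * (p%:R ^+ N) ^- degm I); split.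
- by apply: ballxx; apply: pQ_gt0.
- by apply: subset_trans (zball_ball (N := N)) (subset_trans (zball_le (leq_maxr N0 M)) MU).
move=> y /zball_ball [w _ <-] i j; rewrite HN; apply/power_series_hsum.
apply: eq_hsum ((coefP (G i j)).2 w) => I.
rewrite addrC addKr monomial_scale mulrA mulfVK //.
by rewrite expf_neq0.
Qed.

End AnalyticAt.

(** * Maps read in charts *)

Section Charts.
Variables (p : nat) (p_pr : prime p) (l : nat) (M : manifold p_pr l).
Local Notation Qp := (padic p_pr).
Implicit Types (c d e : chart p_pr l M) (m : M) (f g : M -> M).

Lemma nbhs_dom c m : dom c m -> nbhs m (dom c).
Proof. by move=> cm; apply: open_nbhs_nbhs; split=> //; apply: dom_open. Qed.

Lemma nbhs_img c m : dom c m -> nbhs (c m) (c @` dom c).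
Proof.
by move=> cm; apply: open_nbhs_nbhs; split; [apply: img_open|exists m].
Qed.

Lemma chart_nbhs c m P : dom c m -> nbhs (c m) P -> nbhs m (c @^-1` P).
Proof.
move=> cm; have := @cmap_continuous p p_pr l M c; rewrite (continuous_open_subspace _ (@dom_open p p_pr l M c)).
by move=> /(_ m (mem_set cm)); apply.
Qed.

Lemma cinv_nbhs c m P : dom c m -> nbhs m P -> nbhs (c m) (cinv c @^-1` P).
Proof.
move=> cm mP; have := @cinv_continuous p p_pr l M c; rewrite (continuous_open_subspace _ (@img_open p p_pr l M c)).
have cI : (c @` dom c) (c m) by exists m.
by move=> /(_ (c m) (mem_set cI)); apply; rewrite cmapK.
Qed.

Lemma near_coord c m (P : set M) : dom c m -> nbhs m P ->
  nbhs (c m) [set z | exists m', [/\ P m', dom c m', z = c m' & cinv c z = m']].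
Proof.
move=> cm mP; apply: filterS (filterI (nbhs_img cm) (cinv_nbhs cm mP)).
by move=> z [[m' cm' <-]]; rewrite /= cmapK // => Pm'; exists m'.
Qed.

Lemma trans_atlas c e m : is_chart c -> atlas e -> dom c m -> dom e m ->
  analytic_at (e \o cinv c) (c m) /\ analytic_at (c \o cinv e) (e m).
Proof.
move=> ic ae cm em; have [H1 H2] := ic e ae.
by split; [apply: analytic_on_at H1 _|apply: analytic_on_at H2 _]; exists m.
Qed.

(** Both charts are only known to be compatible with the atlas, so the change of charts is factored
    through an atlas chart at [m]. *)
Lemma trans_an c d m : is_chart c -> is_chart d -> dom c m -> dom d m ->
  analytic_at (d \o cinv c) (c m).
Proof.
move=> ic id_ cm dm; have [e ae em] := atlas_cover m.
have [ec _] := trans_atlas ic ae cm em; have [_ de] := trans_atlas id_ ae dm em.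
have : analytic_at ((d \o cinv e) \o (e \o cinv c)) (c m).
  by apply: analytic_at_comp => //=; rewrite cmapK.
apply: analytic_at_near; apply: filterS (near_coord cm (nbhs_dom em)).
by move=> z [m' [em' cm' -> /= ->]]; rewrite cmapK.
Qed.

Lemma trans_id c m : dom c m ->
  analytic_at (c \o cinv c) (c m) /\ jacobian (c \o cinv c) (c m) = 1%:M.
Proof.
move=> cm; have [ia ij] := analytic_at_id (c m).
have H : \forall z \near c m, id z = (c \o cinv c) z.
  by apply: filterS (near_coord cm (nbhs_dom cm)) => z [m' [_ _ -> /= ->]].
by split; [apply: analytic_at_near ia|rewrite -(jacobian_near H)].
Qed.

Lemma trans_jac c d e m : is_chart c -> is_chart d -> is_chart e ->
  dom c m -> dom d m -> dom e m ->
  jacobian (e \o cinv c) (c m) =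
    jacobian (d \o cinv c) (c m) *m jacobian (e \o cinv d) (d m).
Proof.
move=> ic id_ ie cm dm em.
have H1 := trans_an ic id_ cm dm; have H2 := trans_an id_ ie dm em.
have H3 : (d \o cinv c) (c m) = d m by rewrite /= cmapK.
have H2' : analytic_at (e \o cinv d) ((d \o cinv c) (c m)) by rewrite H3.
have := jacobian_comp H1 H2'; rewrite H3 => <-.
apply/esym/jacobian_near; last exact: analytic_at_comp.
apply: filterS (near_coord cm (nbhs_dom dm)).
by move=> z [m' [em' cm' -> /= ->]]; rewrite cmapK.
Qed.

Lemma tangent_of c m (cm : is_chart c /\ dom c m) (v : 'rV[Qp]_l) :
  exists u : tangent m, u (exist _ c cm) = v /\
    forall d : chart_at m, u d = v *m jacobian (d \o cinv c) (c m).
Proof.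
have uP : (fun d : chart_at m => v *m jacobian (d \o cinv c) (c m)) \in tangent_pred (m:=m).
  apply/asboolP => -[d [id_ dm]] [e [ie em]]; rewrite /chart_of_at /=.
  by rewrite -mulmxA -trans_jac //; case: cm.
exists (Tangent uP); split=> //=.
by have [_ ->] := trans_id cm.2; rewrite mulmx1.
Qed.

Lemma tangent_change m (u : tangent m) c d (cm : is_chart c /\ dom c m)
    (dm : is_chart d /\ dom d m) :
  u (exist _ d dm) = u (exist _ c cm) *m jacobian (d \o cinv c) (c m).
Proof.
by have /asboolP/(_ (exist _ c cm) (exist _ d dm)) := tcoordP u.
Qed.

(** One pair of charts suffices by [man_at_chain]. Continuity ensures that the coordinate expression
    describes [f] near [m] rather than irrelevant values of the charts. *)
Definition man_at f m := {for m, continuous f} /\ exists c d,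
  [/\ is_chart c, is_chart d, dom c m, dom d (f m) & analytic_at (d \o f \o cinv c) (c m)].

Lemma man_at_chain f m c d c' d' : {for m, continuous f} ->
  is_chart c -> is_chart d -> dom c m -> dom d (f m) ->
  is_chart c' -> is_chart d' -> dom c' m -> dom d' (f m) ->
  analytic_at (d \o f \o cinv c) (c m) ->
  analytic_at (d' \o f \o cinv c') (c' m) /\
  jacobian (d' \o f \o cinv c') (c' m) = jacobian (c \o cinv c') (c' m) *m
    jacobian (d \o f \o cinv c) (c m) *m jacobian (d' \o cinv d) (d (f m)).
Proof.
move=> fc ic id_ cm dm ic' id' cm' dm' fa.
have H1 := trans_an ic' ic cm' cm.
have H2 := trans_an id_ id' dm dm'.
have E1 : (c \o cinv c') (c' m) = c m by rewrite /= cmapK.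
have E2 : ((d \o f \o cinv c) \o (c \o cinv c')) (c' m) = d (f m) by rewrite /= !cmapK.
have fa' : analytic_at (d \o f \o cinv c) ((c \o cinv c') (c' m)) by rewrite E1.
have A1 := analytic_at_comp H1 fa'.
have H2' : analytic_at (d' \o cinv d) (((d \o f \o cinv c) \o (c \o cinv c')) (c' m)).
  by rewrite E2.
have A2 := analytic_at_comp A1 H2'.
have nr : \forall z \near c' m,
    ((d' \o cinv d) \o ((d \o f \o cinv c) \o (c \o cinv c'))) z = (d' \o f \o cinv c') z.
  apply: filterS (near_coord cm' (filterI (nbhs_dom cm) (fc _ (nbhs_dom dm)))).
  by move=> z [m' [[cm1 dm1] cm2 -> /= ->]]; rewrite !cmapK.
split; first exact: analytic_at_near A2.
have J1 := jacobian_comp A1 H2'; have J2 := jacobian_comp H1 fa'.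
rewrite E2 J2 E1 in J1.
exact: etrans (esym (jacobian_near nr A2)) J1.
Qed.

Lemma man_at_any f m c d : man_at f m -> is_chart c -> is_chart d ->
  dom c m -> dom d (f m) -> analytic_at (d \o f \o cinv c) (c m).
Proof.
move=> [fc [c0 [d0 [ic0 id0 cm0 dm0 H]]]] ic id_ cm dm.
by have [] := man_at_chain fc ic0 id0 cm0 dm0 ic id_ cm dm H.
Qed.

Lemma man_at_near f g m : (\forall x \near m, f x = g x) -> man_at f m -> man_at g m.
Proof.
move=> fg [fc [c [d [ic id_ cm dm fa]]]]; have E := nbhs_singleton fg.
have gc : {for m, continuous g}.
  move=> P; rewrite -E => /fc fP; apply: filterS (filterI fg fP).
  by move=> x [/= <-].
split=> //; exists c, d; split=> //; first by rewrite -E.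
apply: analytic_at_near fa; apply: filterS (near_coord cm fg).
by move=> z [m' [/= fg' _ -> /= ->]]; rewrite fg'.
Qed.

Lemma analytic_map_at (U : set M) f : open U -> (forall m, U m -> man_at f m) ->
  analytic_map U f.
Proof.
move=> Uo fU c d ic id_; apply: analytic_onI => _ [m [[Um cm] dm] <-].
have fm := fU m Um; split; last exact: man_at_any.
have Um' : nbhs m U by apply: open_nbhs_nbhs.
have W : nbhs m (U `&` dom c `&` f @^-1` dom d).
  exact: filterI (filterI Um' (nbhs_dom cm)) (fm.1 _ (nbhs_dom dm)).
apply: filterS (near_coord cm W) => z [m' [[[Um1 cm1] dm1] _ -> _]].
by exists m'.
Qed.

(** One chart can serve at both [m] and [f m], because the local maps preserve a chart ball. *)
Definition pullback_at (w1 w0 : form_field M) f m := exists c A0 A1,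
  [/\ is_chart c, dom c m /\ dom c (f m), coefficients w0 c A0, coefficients w1 c A1
    & let J := jacobian (c \o f \o cinv c) (c m) in J *m A1 (c (f m)) *m J^T = A0 (c m)].

Lemma pullback_near (w1 w0 : form_field M) f g m :
  (\forall x \near m, f x = g x) -> man_at f m ->
  pullback_at w1 w0 f m -> pullback_at w1 w0 g m.
Proof.
move=> fg fm [c [A0 [A1 [ic [cm cfm] H0 H1 J]]]]; have E := nbhs_singleton fg.
have Jn : jacobian (c \o f \o cinv c) (c m) = jacobian (c \o g \o cinv c) (c m).
  apply: jacobian_near; last exact: man_at_any.
  apply: filterS (near_coord cm fg) => z [m' [fg' _ -> /= ->]].
  by rewrite [f m']fg'.
exists c, A0, A1; split;
  [exact: ic|by split; [exact: cm|rewrite -E; exact: cfm]|exact: H0|exact: H1|].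
by rewrite -E -Jn; exact: J.
Qed.

(** The image of a tangent vector is defined by its coordinates in the one chart [c]; [man_at_chain]
    gives the pushforward relation in every other pair of charts. *)
Lemma pullback_on (w1 w0 : form_field M) (U : set M) f :
  (forall m, U m -> man_at f m /\ pullback_at w1 w0 f m) -> is_pullback_on U f w1 w0.
Proof.
move=> H m /H [fm [c [A0 [A1 [ic [cm cfm] H0 H1 J]]]]] u v.
have ca := man_at_any fm ic ic cm cfm.
have alg (a b : 'rV[Qp]_l) (X F D Z : 'M[Qp]_l) :
    a = b *m X -> Z = X *m F *m D -> a *m F *m D = b *m Z.
  by move=> -> ->; rewrite !mulmxA.
have K (t : tangent m) : exists t' : tangent (f m), pushforward t t' /\
    t' (exist _ c (conj ic cfm)) =
    t (exist _ c (conj ic cm)) *m jacobian (c \o f \o cinv c) (c m).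
  have [t' [t'c t'd]] := @tangent_of c (f m) (conj ic cfm)
     (t (exist _ c (conj ic cm)) *m jacobian (c \o f \o cinv c) (c m)).
  exists t'; split; last exact: t'c.
  move=> [c1 [ic1 cm1]] [d1 [id1 dm1]]; rewrite t'd /chart_of_at /=.
  have [_ E] := man_at_chain fm.1 ic ic cm cfm ic1 id1 cm1 dm1 ca.
  exact: alg (tangent_change t (conj ic1 cm1) (conj ic cm)) E.
have [u' [pu u'c]] := K u; have [v' [pv v'c]] := K v.
exists u', v'; split; [exact: pu|exact: pv|].
rewrite (H0 m (conj ic cm)) (H1 (f m) (conj ic cfm)) u'c v'c -J.
by rewrite trmx_mul !mulmxA.
Qed.

End Charts.

(** * Maps of a chart ball given by Tate series *)

Section LocalMaps.
Variables (p : nat) (p_pr : prime p) (l : nat) (M : manifold p_pr l).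
Local Notation Zp := (padic_int p_pr).
Local Notation Qp := (padic p_pr).
Local Notation nm := (@nm p p_pr).
Local Notation tate := (tate p_pr).

Lemma rep_recenter k a b (f : 'rV[Qp]_k -> 'M[Qp]_(a, b)) x N (G : 'I_a -> 'I_b -> tate k) w0 :
  rep f x N G -> analytic_at f (x + p%:R ^+ N *: zv w0).
Proof.
move=> H; pose h (i : 'I_k) : tate k := tC k (zemb (w0 0 i)) + tX p_pr i.
have h1 i : tbound (h i) 1.
  apply: tboundD; last exact: tboundX.
  by apply: tboundC; rewrite ?nm_zemb_le1.
exists N, (fun i j => tcomp h (G i j)) => w i j.
rewrite tcompE // -H -addrA -scalerDr -zvD; congr (f (_ + _ *: _) i j).
by apply/rowP => m; rewrite !zvE tptE // tfunD tfunC tfunX1 mxE rmorphD.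
Qed.

Variables (c : chart p_pr l M) (x0 : 'rV[Qp]_l) (R : nat).
Hypothesis ic : is_chart c.
Hypothesis x0R : zball x0 R `<=` c @` dom c.

Definition zcoord (z : 'rV[Qp]_l) : 'rV[Zp]_l :=
  \row_i zint (p%:R ^- R * (z 0 i - x0 0 i)).

Lemma zcoordK w : zcoord (x0 + p%:R ^+ R *: zv w) = w.
Proof.
apply/rowP => i; apply: (@zemb_inj p p_pr); rewrite mxE.
have -> : p%:R ^- R * ((x0 + p%:R ^+ R *: zv w) 0 i - x0 0 i) = zemb (w 0 i).
  by rewrite !mxE addrC addKr mulKf // pX_neq0.
by rewrite zintK // nm_zemb_le1.
Qed.

Definition cmodel (phi : 'I_l -> tate l) (z : 'rV[Qp]_l) : 'rV[Qp]_l :=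
  x0 + p%:R ^+ R *: zv (tpt phi (zcoord z)).

Definition lmap (phi : 'I_l -> tate l) (m : M) : M := cinv c (cmodel phi (c m)).

Definition lball N x : set M := dom c `&` c @^-1` (zball x N).

Lemma lball_open N x : open (lball N x).
Proof.
rewrite openE => m [cm xm]; apply: filterI; first exact: nbhs_dom.
by apply: chart_nbhs => //; apply: open_nbhs_nbhs; split=> //; apply: zball_open.
Qed.

Lemma zball_dom w : exists m, [/\ lball R x0 m, c m = x0 + p%:R ^+ R *: zv w
   & cinv c (x0 + p%:R ^+ R *: zv w) = m].
Proof.
have xw : zball x0 R (x0 + p%:R ^+ R *: zv w) by exists w.
have [m cm mE] := x0R xw; exists m; rewrite -mE cmapK //; split=> //.
by split=> //=; rewrite mE.
Qed.

Lemma lball_compact : compact (lball R x0).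
Proof.
suff -> : lball R x0 = cinv c @` zball x0 R.
  apply: continuous_compact _ (@zball_compact p p_pr l x0 R).
  exact: continuous_subspaceW x0R (@cinv_continuous p p_pr l M c).
apply/seteqP; split=> m; first by move=> [cm xm]; exists (c m) => //; rewrite cmapK.
by move=> [_ [w _ <-] <-]; have [m' [? _ ->]] := zball_dom w.
Qed.

Lemma lball_coord m : lball R x0 m -> c m = x0 + p%:R ^+ R *: zv (zcoord (c m)).
Proof. by move=> [_ [w _ /= <-]]; rewrite zcoordK. Qed.

Section OneMap.
Variable phi : 'I_l -> tate l.
Hypothesis phi1 : forall i, tbound (phi i) 1.

Lemma lmapE m : lball R x0 m -> lball R x0 (lmap phi m) /\
  c (lmap phi m) = x0 + p%:R ^+ R *: zv (tpt phi (zcoord (c m))).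
Proof.
move=> Bm; have [m' [Bm' cm' E]] := zball_dom (tpt phi (zcoord (c m))).
by rewrite /lmap /cmodel E.
Qed.

Lemma rep_cmodel :
  rep (cmodel phi) x0 R (fun _ j => tC l (x0 0 j) + tC l (p%:R ^+ R) * phi j).
Proof.
move=> w i j; rewrite (ord1 i) /cmodel zcoordK tfunD tfunM !tfunC.
by rewrite [LHS]mxE [X in _ + X = _]mxE zvE tptE.
Qed.

Lemma cmodel_near m : lball R x0 m ->
  \forall z \near c m, cmodel phi z = (c \o lmap phi \o cinv c) z.
Proof.
move=> Bm; have Bn : nbhs m (lball R x0) by apply: open_nbhs_nbhs; split=> //; apply: lball_open.
apply: filterS (near_coord Bm.1 Bn) => z [m' [Bm' _ -> /= ->]].
by rewrite (lmapE Bm').2.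
Qed.

Lemma cmodel_an m : lball R x0 m -> analytic_at (cmodel phi) (c m).
Proof. by move=> Bm; rewrite (lball_coord Bm); apply: rep_recenter rep_cmodel. Qed.

Lemma man_at_lmap m : lball R x0 m -> man_at (lmap phi) m.
Proof.
move=> Bm; have [fB fE] := lmapE Bm; have ca := cmodel_an Bm; split.
  move=> P fP; have := cinv_nbhs fB.1 fP; rewrite fE.
  by move=> /(rep_cont ca)/(chart_nbhs Bm.1).
exists c, c; split=> //; [exact: Bm.1|exact: fB.1|].
exact: analytic_at_near (cmodel_near Bm) ca.
Qed.

Lemma lmap_jac m : lball R x0 m ->
  jacobian (c \o lmap phi \o cinv c) (c m) = \matrix_(i, j) td i (phi j) (zcoord (c m)).
Proof.
move=> Bm; rewrite -(jacobian_near (cmodel_near Bm) (cmodel_an Bm)).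
rewrite {1}(lball_coord Bm) (rep_jacobian _ rep_cmodel); apply/matrixP => i j.
rewrite [LHS]mxE [RHS]mxE tdD tdC add0r tdZ tfunM tfunC mulKf //; exact: pX_neq0.
Qed.

Variable q : M.
Hypothesis qB : lball R x0 q.
Hypothesis qfix : tpt phi (zcoord (c q)) = zcoord (c q).

Lemma lmap_fix : lmap phi q = q.
Proof. by rewrite /lmap /cmodel qfix -lball_coord // cmapK //; case: qB. Qed.

(** Components of Gauss norm at most one do not increase distances, so balls about a fixed point are
    mapped into themselves. *)
Lemma lmap_ball K m : (R <= K)%N -> lball K (c q) m -> lball K (c q) (lmap phi m).
Proof.
move=> RK [cm qm].
have Bm : lball R x0 m.
  split=> //=; apply: zball_trans (zball_le RK qm); exact: qB.2.
have [fB fE] := lmapE Bm; split; first exact: fB.1.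
move/zballP: qm; rewrite /= fE [X in zball X](lball_coord qB).
rewrite [c m](lball_coord Bm) [c q in X in X -> _](lball_coord qB) => qm.
have pR := pX_neq0 p_pr R; have nR : 0 < nm (p%:R ^+ R) by rewrite nm_gt0.
have D (u v : 'rV[Zp]_l) i : (x0 + p%:R ^+ R *: zv u) 0 i - (x0 + p%:R ^+ R *: zv v) 0 i
   = p%:R ^+ R * (zemb (u 0 i) - zemb (v 0 i)).
  by rewrite !mxE opprD addrACA subrr add0r mulrBr.
have dq i : nm (zemb (zcoord (c m) 0 i) - zemb (zcoord (c q) 0 i))
    <= p%:R ^- K / nm (p%:R ^+ R).
  by have := qm i; rewrite D nmM mulrC -ler_pdivlMr.
apply/zballP => i; rewrite D nmM mulrC -ler_pdivlMr //.
rewrite -{1}qfix !tptE //; rewrite -[leRHS]mul1r.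
have e0 : 0 <= p%:R ^- K / nm (p%:R ^+ R) by rewrite divr_ge0 // ltW // pQ_gt0.
by rewrite zcoordK; exact: tfun_lip ler01 e0 (phi1 i) dq.
Qed.

End OneMap.
End LocalMaps.

Section FormCoefficients.
Variables (p : nat) (p_pr : prime p) (l : nat) (M : manifold p_pr l).
Local Notation Zp := (padic_int p_pr).
Local Notation Qp := (padic p_pr).

Lemma delta_entry (A : 'M[Qp]_l) i j :
  ((delta_mx 0 i : 'rV[Qp]_l) *m A *m (delta_mx 0 j : 'rV[Qp]_l)^T) 0 0 = A i j.
Proof. by rewrite -rowE trmx_delta -colE !mxE. Qed.

Variables (c : chart p_pr l M) (m : M) (cm : is_chart c /\ dom c m).

Definition frame i : tangent m := sval (cid (tangent_of cm (delta_mx 0 i))).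

Lemma frameE i : frame i (exist _ c cm) = delta_mx 0 i.
Proof. by rewrite /frame; case: cid => u []. Qed.

Lemma coef_frame (w : form_field M) A i j : coefficients w c A ->
  A (c m) i j = w m (frame i) (frame j).
Proof. by move=> wA; rewrite (wA m cm) !frameE delta_entry. Qed.

Lemma coef_antisym (w : form_field M) A : Defs.alternating_form w -> coefficients w c A ->
  forall i j, A (c m) j i = - A (c m) i j.
Proof.
move=> alt wA i j; rewrite !(coef_frame _ _ wA).
have [lr ll w0] := alt m.
have wD u v t : w m t (u + v) = w m t u + w m t v.
  by have := lr t 1 u v; rewrite scale1r mul1r.
have Dw u v t : w m (u + v) t = w m u t + w m v t.
  by have := ll t 1 u v; rewrite /= scale1r mul1r.
have := w0 (frame i + frame j); rewrite wD !Dw !w0 add0r addr0 addrC => /eqP.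
by rewrite addr_eq0 => /eqP ->; rewrite opprK.
Qed.

(** A nonzero row in the kernel of the matrix would be the coordinates of a nonzero tangent vector
    orthogonal to all others. *)
Lemma coef_unitmx (w : form_field M) A : Defs.nondegenerate w -> coefficients w c A ->
  A (c m) \in unitmx.
Proof.
move=> nd wA; rewrite -row_free_unit -kermx_eq0; apply/negPn/negP => K0.
have v0 : nz_row (kermx (A (c m))) != 0 by rewrite nz_row_eq0.
have vA : nz_row (kermx (A (c m))) *m A (c m) = 0 by apply/sub_kermxP/nz_row_sub.
have [u [uc _]] := tangent_of cm (nz_row (kermx (A (c m)))).
have u0 : u != 0 by apply: contra v0 => /eqP u0; rewrite -uc u0.
have [v] := nd m u u0; rewrite (wA m cm) uc vA mul0mx mxE.
by rewrite eqxx.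
Qed.

End FormCoefficients.

(** * The local maps at a point of [Q] *)

Section LocalModel.
Variables (p : nat) (p_pr : prime p) (l : nat) (M : manifold p_pr l).
Local Notation Zp := (padic_int p_pr).
Local Notation Qp := (padic p_pr).
Local Notation nm := (@nm p p_pr).
Local Notation tate := (tate p_pr).
Variables (Q : set M) (w0 w1 : form_field M).
Hypotheses (w0_symplectic : symplectic_form w0) (w1_symplectic : symplectic_form w1).
Hypothesis w01 : forall m : M, Q m -> forall u v : tangent m, @w0 m u v = @w1 m u v.
Hypothesis Qsub : submanifold Q.

(** Compactness makes [B] closed, hence clopen, as the gluing needs. The last clause provides
    arbitrarily small open sets preserved by both maps; [domain_Q] rests on it. *)
Definition local_model (B : set M) (f f' : M -> M) := [/\
  open B, compact B,
  forall m, B m -> [/\ B (f m), B (f' m), f' (f m) = m & f (f' m) = m],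
  forall m, B m -> [/\ man_at f m, man_at f' m & pullback_at w1 w0 f m]
  & forall q, Q q -> B q -> f q = q /\ forall P, nbhs q P -> exists B', [/\ open B',
     B' q, B' `<=` P & forall m, B' m -> B' (f m) /\ B' (f' m)]].

Lemma local_model_ex q : Q q -> exists B f f', B q /\ local_model B f f'.
Proof.
move=> Qq; have [c [ic cq [k [b [kl cQ]]]]] := Qsub Qq.
have [alt0 an0 cl0 nd0] := w0_symplectic; have [alt1 an1 cl1 nd1] := w1_symplectic.
have [A0 [A0c A0an]] := an0 c ic; have [A1 [A1c A1an]] := an1 c ic.
(* From index [k] on the coordinates are constant on [Q]; measured from [x0], which is the image of
   a point of [Q], they vanish. *)
set x0 := c q; pose y := [pred i : 'I_l | (k <= i)%N].
have cqI : (c @` dom c) x0 by exists q.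
have [N0 [G0 H0]] := analytic_on_at A0an cqI.
have [N1 [G1 H1]] := analytic_on_at A1an cqI.
have [N2 HN2] := nbhs_zballP (nbhs_img cq).
(* On this ball both matrices are Tate series and the chart is defined; [tate_moser] then shrinks it
   by a further [K]. *)
pose N := maxn N0 (maxn N1 N2).
have H0N := rep_le (leq_maxl N0 (maxn N1 N2)) H0.
have NN1 : (N1 <= N)%N by rewrite /N leq_max leq_max leqnn orbT.
have H1N := rep_le NN1 H1; rewrite -/N in H0N.
have NN2 : (N2 <= N)%N by rewrite /N !leq_max leqnn !orbT.
have xN : zball x0 N `<=` c @` dom c := subset_trans (zball_le NN2) HN2.
pose a0 : 'M[tate l]_l := \matrix_(i, j) tscale (N - N0) (G0 i j).
pose a1 : 'M[tate l]_l := \matrix_(i, j) tscale (N - N1) (G1 i j).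
have R0 : rep A0 x0 N (fun i j => a0 i j) by move=> w i j; rewrite mxE H0N.
have R1 : rep A1 x0 N (fun i j => a1 i j) by move=> w i j; rewrite mxE H1N.
have pt w : exists m, (is_chart c /\ dom c m) /\ c m = x0 + p%:R ^+ N *: zv w.
  by have [|m cm mE] := xN (x0 + p%:R ^+ N *: zv w); [exists w|exists m].
have tT (a : 'M[tate l]_l) A w : Defs.alternating_form w -> coefficients w c A ->
    rep A x0 N (fun i j => a i j) -> a^T = - a.
  move=> alt wA R; apply/matrixP => i j; rewrite mxE [RHS]mxE; apply: tfun_inj => x.
  have [m [cm mE]] := pt x; rewrite tfunN -!R -mE.
  exact: (coef_antisym cm alt wA).
have alg (u v z : Qp) : p%:R ^- N * u + p%:R ^- N * v + p%:R ^- N * z = 0 -> u + v + z = 0.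
  move=> E; have e0 : (p%:R ^- N : Qp) != 0 by rewrite invr_eq0 pX_neq0.
  by apply: (mulfI e0); rewrite mulr0 !mulrDr.
have tC (a : 'M[tate l]_l) A w : Defs.closed_form w -> coefficients w c A ->
    rep A x0 N (fun i j => a i j) -> tclosed a.
  move=> cl wA R i j m; apply: tfun_inj => x.
  have xI : (c @` dom c) (x0 + p%:R ^+ N *: zv x) by apply: xN; exists x.
  have := cl c A ic wA _ xI i j m; rewrite /exterior_derivative !(rep_pderive _ _ R) !mxE.
  exact: alg.
have onQP w : onQ y w -> exists m, [/\ Q m, is_chart c /\ dom c m & c m = x0 + p%:R ^+ N *: zv w].
  move=> yw; have : (c @` (dom c `&` Q)) (x0 + p%:R ^+ N *: zv w).
    rewrite cQ; split; first by apply: xN; exists w.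
    move=> i ki; have : (c @` (dom c `&` Q)) x0 by exists q.
    by rewrite cQ => -[_ /(_ i ki) <-]; rewrite mxE [X in _ + X]mxE zvE yw // rmorph0 mulr0 addr0.
  by move=> [m [cm Qm] mE]; exists m.
have a01 w : onQ y w -> mev w a0 = mev w a1.
  move=> /onQP[m [Qm cm mE]]; apply/matrixP => i j.
  rewrite [LHS]mxE [RHS]mxE /ev -R0 -R1 -mE.
  by rewrite (coef_frame cm i j A0c) (coef_frame cm i j A1c) w01.
have a0u : mev 0 a0 \in unitmx.
  suff -> : mev 0 a0 = A0 x0 by apply: (coef_unitmx (conj ic cq) nd0 A0c).
  by apply/matrixP => i j; rewrite mxE (rep_at i j R0).
have [K HK] := tate_moser (tT _ _ _ alt0 A0c R0) (tT _ _ _ alt1 A1c R1)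
  (tC _ _ _ cl0 A0c R0) (tC _ _ _ cl1 A1c R1) a01 a0u.
have [phi [phi' [[phi1 phi1'] K1 K2 fixQ pull]]] := HK K (leqnn K).
pose R := (N + K)%N.
have xR : zball x0 R `<=` c @` dom c by apply: subset_trans (zball_le (leq_addr K N)) xN.
have qB : lball c R x0 q by split=> //=; apply: zball_refl.
have fixq m : Q m -> lball c R x0 m -> tpt phi (zcoord x0 R (c m)) = zcoord x0 R (c m).
  move=> Qm Bm; apply: fixQ => i ki.
  have : (c @` (dom c `&` Q)) (c m) by exists m => //; split=> //; exact: Bm.1.
  have : (c @` (dom c `&` Q)) x0 by exists q.
  rewrite cQ => -[_ /(_ i ki) x0i] [_ /(_ i ki)].
  rewrite {1}(lball_coord Bm) -x0i mxE [X in _ + X = _]mxE zvE => /eqP.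
  rewrite -subr_eq0 addrC addKr mulf_eq0 (negPf (pX_neq0 p_pr R)) /= => /eqP z0.
  by apply: (@zemb_inj p p_pr); rewrite z0 rmorph0.
have fixq' m : Q m -> lball c R x0 m -> tpt phi' (zcoord x0 R (c m)) = zcoord x0 R (c m).
  by move=> Qm Bm; rewrite -{1}(fixq m Qm Bm) K1.
have inv f g m : cancel (tpt f) (tpt g) -> lball c R x0 m ->
    lmap c x0 R g (lmap c x0 R f m) = m.
  move=> fg Bm; have [fB fE] := lmapE xR f Bm.
  by rewrite {1}/lmap /cmodel fE zcoordK fg -lball_coord // cmapK //; exact: Bm.1.
exists (lball c R x0), (lmap c x0 R phi), (lmap c x0 R phi'); split=> //; split.
- exact: lball_open.
- exact: lball_compact.
- move=> m Bm; split; [exact: (lmapE xR phi Bm).1|exact: (lmapE xR phi' Bm).1| |];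
    exact: inv.
- move=> m Bm; have [fB fE] := lmapE xR phi Bm; split; try exact: man_at_lmap.
  exists c, A0, A1; split=> //; first by split; [exact: Bm.1|exact: fB.1].
  rewrite /= lmap_jac // fE [in RHS](lball_coord Bm).
  have E (A : 'rV[Qp]_l -> 'M[Qp]_l) (a : 'M[tate l]_l) w : rep A x0 N (fun i j => a i j) ->
      A (x0 + p%:R ^+ R *: zv w) = mev (p%:R ^+ K *: w) a.
    move=> HA; apply/matrixP => i j; rewrite [RHS]mxE /ev -HA zvZ zemb_pX scalerA -exprD.
    by [].
  by rewrite (E _ _ _ R0) (E _ _ _ R1) pull.
move=> q' Qq' Bq'; split; first by apply: lmap_fix => //; apply: fixq.
move=> P Pq'; have [T HT] := nbhs_zballP (cinv_nbhs Bq'.1 Pq').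
exists (lball c (maxn R T) (c q')); split.
- exact: lball_open.
- by split; [exact: Bq'.1|exact: zball_refl].
- move=> m [cm /(zball_le (leq_maxr R T))/HT]; by rewrite /= cmapK.
move=> m Bm; split; apply: lmap_ball => //; rewrite ?leq_maxl //.
  exact: fixq.
exact: fixq'.
Qed.

End LocalModel.

(** * Patching *)

Section Patching.
Variables (p : nat) (p_pr : prime p) (l : nat) (M : manifold p_pr l).
Variables (Q : set M) (w0 w1 : form_field M).
Variables (B : M -> set M) (f f' : M -> M -> M).
Hypothesis BQ : forall q, Q q -> B q q.
Hypothesis model : forall q, Q q -> local_model Q w0 w1 (B q) (f q) (f' q).

(* The filter on finite lists of points "eventually containing" each point
   turns near-covering compactness into the extraction of a finite subcover. *)
Lemma finite_subcover : compact Q ->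
  exists s : seq M, (forall q, List.In q s -> Q q) /\
    forall m, Q m -> exists2 q, List.In q s & B q m.
Proof.
move=> /compact_near_coveringP Qc.
pose F : set_system (seq M) := [set S | exists s0 : seq M, (forall q, List.In q s0 -> Q q) /\
  forall s, (forall q, List.In q s -> Q q) -> (forall q, List.In q s0 -> List.In q s) -> S s].
have FF : Filter F.
  split=> [|S T [s [sQ sS]] [t [tQ tT]]|S T ST [s [sQ sS]]].
  - by exists [::].
  - exists (s ++ t); split=> [q H|u uQ H].
      by case: (List.in_app_or _ _ _ H) => [/sQ|/tQ].
    by split; [apply: sS|apply: tT] => // q qs; apply: H; apply: List.in_or_app; [left|right].
  - by exists s; split=> // u uQ us; apply/ST/sS.
have [|s [sQ H]] := Qc _ F (fun s m => exists2 q, List.In q s & B q m) FF.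
  move=> q Qq; have [Bo _ _ _ _] := model Qq.
  exists (B q, [set s | List.In q s]); last by move=> [x s] [/= Bx qs]; exists q.
  split=> /=; first by apply: open_nbhs_nbhs; split=> //; apply: BQ.
  by exists [:: q]; split=> [r [<-|//]//|s _ H]; apply: H; left.
by exists s; split=> // m Qm; apply: (H s).
Qed.

Fixpoint sel (s : seq M) (m : M) : option M :=
  if s is q :: s then (if `[< B q m >] then Some q else sel s m) else None.

Lemma selP s m q : sel s m = Some q -> List.In q s /\ B q m.
Proof.
elim: s => //= r s IH; case: asboolP => [Br [<-]|_ /IH[qs Bq]].
  by split=> //; left.
by split=> //; right.
Qed.

Lemma sel_ex s m : (exists2 q, List.In q s & B q m) -> exists q, sel s m = Some q.
Proof.
elim: s => [[q []]|r s IH [q /= qs Bq]] /=; case: asboolP => [_|nB]; first by exists r.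
by apply: IH; exists q => //; case: qs => // E; case: nB; rewrite E.
Qed.

(** Each [B q] is open, and closed as a compact subset of a Hausdorff space, so membership in it is
    locally constant. *)
Lemma sel_near s m : (forall q, List.In q s -> Q q) ->
  \forall m' \near m, sel s m' = sel s m.
Proof.
elim: s => [|q s IH] sQ; first exact: nearW.
have [Bo Bc _ _ _] := model (sQ q (or_introl erefl)).
have {}IH := IH (fun r rs => sQ r (or_intror rs)).
have [Bm|nBm] := pselect (B q m).
  have Bn : nbhs m (B q) by apply: open_nbhs_nbhs.
  apply: filterS Bn => m' Bm' /=.
  by rewrite (asboolT Bm) (asboolT Bm').
have Bcl : closed (B q) := compact_closed (@manifold_hausdorff p p_pr l M) Bc.
have Bn : nbhs m (~` B q).
  by apply: open_nbhs_nbhs; split=> //; apply: closed_openC.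
apply: filterS (filterI IH Bn) => m' [/= E nBm'].
by rewrite (asboolF nBm) (asboolF nBm').
Qed.

Variable s : seq M.
Hypothesis sQ : forall q, List.In q s -> Q q.
Hypothesis s_cover : forall m, Q m -> exists2 q, List.In q s & B q m.

Definition glue (g : M -> M -> M) (m : M) : M := if sel s m is Some q then g q m else m.

(* Gluing preserves a neighborhood on which a single local map is selected and
   which this map and its inverse preserve. *)
Definition stable q (B' : set M) := open B' /\ forall m, B' m ->
  [/\ sel s m = Some q, B' (f q m) & B' (f' q m)].

(** Both glued maps preserve this union of stable sets, so it serves as source and target of the
    diffeomorphism. *)
Definition domain : set M := [set m | exists q B', stable q B' /\ B' m].

Lemma domain_open : open domain.
Proof.
rewrite openE => m [q [B' [[B'o B's] B'm]]].
have nB : nbhs m B' by apply: open_nbhs_nbhs.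
by apply: filterS nB => m' Bm'; exists q, B'.
Qed.

(** The last clause of [local_model] is applied to a neighborhood of [m] on which the selection is
    constant. *)
Lemma domain_Q : Q `<=` domain.
Proof.
move=> m Qm; have [q qE] := sel_ex (s_cover Qm); have [qs Bqm] := selP qE.
have [_ _ _ _ /(_ m Qm Bqm)[_ fQ]] := model (sQ qs).
have [B' [B'o B'm B'sel B'f]] := fQ _ (sel_near m sQ).
exists q, B'; split=> //; split=> // m' Bm'.
by have [? ?] := B'f m' Bm'; split=> //; rewrite -qE; apply: B'sel.
Qed.

Lemma glue_fix m : Q m -> glue f m = m.
Proof.
move=> Qm; have [q qE] := sel_ex (s_cover Qm); have [qs Bqm] := selP qE.
have [_ _ _ _ /(_ m Qm Bqm)[fm _]] := model (sQ qs).
by rewrite /glue qE.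
Qed.

(** A point and its images select the same [q], so inverses, analyticity and pullback are inherited
    from a single local model. *)
Lemma domain_glue m : domain m -> exists q, [/\ Q q /\ B q m,
  sel s m = Some q, domain (f q m) /\ sel s (f q m) = Some q,
  domain (f' q m) /\ sel s (f' q m) = Some q
  & (\forall x \near m, f q x = glue f x) /\ (\forall x \near m, f' q x = glue f' x)].
Proof.
move=> [q [B' [[B'o B's] B'm]]]; have [qE fm fm'] := B's m B'm; have [qs Bqm] := selP qE.
have [fE _ _] := B's _ fm; have [fE' _ _] := B's _ fm'.
have nB : nbhs m B' by apply: open_nbhs_nbhs.
exists q; split=> //; try (by split=> //; exists q, B'); first by split=> //; apply: sQ.
by split; apply: filterS nB => x /B's [xE _ _]; rewrite /glue xE.
Qed.

Lemma glueK m : domain m -> domain (glue f m) /\ glue f' (glue f m) = m.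
Proof.
move=> /domain_glue [q [[Qq Bm] qE [fD fE] _ _]]; rewrite {1}/glue qE; split=> //.
have [_ _ /(_ m Bm)[_ _ K _] _ _] := model Qq.
by rewrite {2}/glue qE /glue fE.
Qed.

Lemma glueK' m : domain m -> domain (glue f' m) /\ glue f (glue f' m) = m.
Proof.
move=> /domain_glue [q [[Qq Bm] qE _ [fD fE] _]]; rewrite {1}/glue qE; split=> //.
have [_ _ /(_ m Bm)[_ _ _ K] _ _] := model Qq.
by rewrite {2}/glue qE /glue fE.
Qed.

Lemma glue_man m : domain m ->
  [/\ man_at (glue f) m, man_at (glue f') m & pullback_at w1 w0 (glue f) m].
Proof.
move=> /domain_glue [q [[Qq Bm] _ _ _ [nf nf']]].
have [_ _ _ /(_ m Bm)[fm fm' pb] _] := model Qq.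
by split; [apply: man_at_near nf fm|apply: man_at_near nf' fm'|apply: pullback_near nf fm pb].
Qed.

Lemma glue_diffeo : analytic_diffeo domain domain (glue f).
Proof.
split; [exact: domain_open|exact: domain_open| | |].
- split=> [m /glueK[]//|x y|m Dm].
    move=> /set_mem/glueK[_ xK] /set_mem/glueK[_ yK] E.
    by rewrite -xK -yK E.
  by have [D K] := glueK' Dm; exists (glue f' m).
- by apply: analytic_map_at domain_open _ => m /glue_man[].
exists (glue f'); split=> [m /glueK[]//|].
by apply: analytic_map_at domain_open _ => m /glue_man[].
Qed.

End Patching.

Theorem theorem3 (n : nat) (n_gt0 : (0 < n)%N) (p : nat) (p_pr : prime p)
    (M : manifold p_pr (2 * n)) (Q : set M)
    (Q_compact : compact Q) (Q_submanifold : submanifold Q)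
    (w0 w1 : form_field M)
    (w0_symplectic : symplectic_form w0) (w1_symplectic : symplectic_form w1)
    (w01 : forall m : M, Q m -> forall u v : tangent m, w0 m u v = w1 m u v) :
  exists (U0 U1 : set M) (psi : M -> M),
    [/\ open U0 /\ Q `<=` U0, open U1 /\ Q `<=` U1,
        analytic_diffeo U0 U1 psi,
        forall m : M, Q m -> psi m = m
      & is_pullback_on U0 psi w1 w0].
Proof.
have H q : exists Bff : set M * (M -> M) * (M -> M), Q q ->
    Bff.1.1 q /\ local_model Q w0 w1 Bff.1.1 Bff.1.2 Bff.2.
  (* Off [Q] a dummy triple makes the family total, as [choice] asks. *)
  have [Qq|nQ] := pselect (Q q); last by exists (set0, id, id) => /nQ.
  have [B [f [f' Bf]]] := local_model_ex w0_symplectic w1_symplectic w01 Q_submanifold Qq.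
  by exists (B, f, f').
have [h hP] := choice H.
pose B q := (h q).1.1; pose f q := (h q).1.2; pose f' q := (h q).2.
have BQ q : Q q -> B q q by move=> /hP[].
have model q : Q q -> local_model Q w0 w1 (B q) (f q) (f' q) by move=> /hP[].
have [s [sQ s_cover]] := finite_subcover BQ model Q_compact.
have oD : open (domain B f f' s) /\ Q `<=` domain B f f' s.
  by split; [apply: domain_open|apply: domain_Q model _ sQ s_cover].
exists (domain B f f' s), (domain B f f' s), (glue B s f); split=> //.
- exact: (glue_diffeo model sQ).
- by move=> m; apply: (glue_fix model sQ s_cover).
by apply: pullback_on => m /(glue_man model sQ)[].
Qed.
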